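(* Let $\mathbb{F}$ be an algebraically closed field of characteristic $0$, $G$ an abelian group and $n\geq 1$. If a $G$-grading of Type I on the Lie superalgebra $A(n,n)$ is odd, then it is isomorphic to some $\Gamma_A(t_0,\overline{T},\overline{\beta},u,\gamma)$. Two such gradings, $\Gamma_A(t_0,\overline{T},\overline{\beta},u,\gamma)$ and $\Gamma_A(t_0',\overline{T}',\overline{\beta}',u',\gamma')$, are isomorphic if, and only if, $t_0=t_0'$, $\overline{T}=\overline{T}'$, and there are $\delta\in\{\pm1\}$ and $g\in G$ such that $\overline{\beta}^\delta=\overline{\beta}'$, $u^\delta\equiv u'\pmod{\langle t_0\rangle}$ and $g\,\Xi(\gamma^\delta)=\Xi(\gamma')$.
   Context: $M(r,r)$ is the associative superalgebra $M_{2r}(\mathbb{F})=\mathrm{End}(\mathbb{F}^r\oplus\mathbb{F}^r)$ whose even (odd) part consists of the block-diagonal (block-off-diagonal) matrices. $\mathfrak{gl}(r|r)$ is the same superspace with the supercommutator $[a,b]=ab-(-1)^{|a||b|}ba$, $\mathfrak{sl}(r|r)$ is its derived superalgebra (matrices with zero supertrace), and $A(n,n)=\mathfrak{psl}(n+1|n+1)=\mathfrak{sl}(n+1|n+1)/\mathbb{F}I_{2n+2}$. A $G$-grading on a (Lie or associative) superalgebra is an algebra grading $A=\bigoplus_{g\in G}A_g$ whose components are $\mathbb{Z}_2$-graded subspaces. Two $G$-gradings on $A$ are isomorphic if some superalgebra automorphism of $A$ maps each component of the first onto the component of the second of the same degree. Type I. Any $G$-grading on $M(n+1,n+1)$ is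 a grading on $\mathfrak{gl}(n+1|n+1)$, restricts to $\mathfrak{sl}(n+1|n+1)$ and induces a grading on $\mathfrak{psl}(n+1|n+1)$; the gradings on $A(n,n)$ obtained in this way are said to be of Type I. A $G$-grading corresponds to the action of $\widehat{G}=\mathrm{Hom}(G,\mathbb{F}^\times)$ by $\chi\cdot x=\chi(g)x$ for $x$ of degree $g$. A Type I grading on $A(n,n)$ is even if $\widehat{G}$ acts by automorphisms belonging to $\mathcal{E}$, the group of automorphisms of $A(n,n)$ induced by conjugations by invertible even (i.e. block-diagonal) matrices of $M(n+1,n+1)$; otherwise it is odd. Parameters. Put $G^\#=G\times\mathbb{Z}_2$, let $p:G^\#\to\mathbb{Z}_2$ be the projection, and identify $G$ with $G\times\{\bar 0\}$. Let $t_0\in G$ be an element of order $2$, $\overline{G}=G/\langle t_0\rangle$, $\overline{T}\subseteq\overline{G}$ a finite subgroup, $\overline{\beta}$ a nondegenerate alternating bicharacter on $\overline{T}$ with values in $\mathbb{F}^\times$, $T^+\subseteq G$ the inverse image of $\overline{T}$ and $\beta^+(s,t)=\overline{\beta}(\overline{s},\overline{t})$ for $s,t\in T^+$. For each pair $(t_0,\overline{T})$ a character $\chi:T^+\to\mathbb{F}^\times$ with $\chi(t_0)=-1$ is fixed once and for all. Since $\chi^2(t_0)=1$, $\chi^2$ is a character of $\overline{T}$; let $a$ be the unique element of $T^+$ such that $\chi(a)=1$ and $\chi^2(\overline{t})=\overline{\beta}(\overline{a},\overline{t})$ for all $t\in T^+$. The parameter $u$ is an element of $G$ with $u^2=a$.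 For such $u$, put $t_1=(u,\bar 1)\in G^\#$ and $T_u=T^+\cup t_1T^+$, a subgroup of $G^\#$, and let $\beta_u$ be the unique nondegenerate alternating bicharacter on $T_u$ extending $\beta^+$ with $\beta_u(t_1,t)=\chi(t)$ for all $t\in T^+$. Finally $\gamma=(g_1,\dots,g_k)$ is a $k$-tuple of elements of $G$ with $k\sqrt{|\overline{T}|}=n+1$. The grading. Let $D$ be the $G^\#$-graded division algebra (every nonzero homogeneous element invertible) with support $T_u$, one-dimensional components $\mathbb{F}X_t$ and $X_sX_t=\beta_u(s,t)X_tX_s$ (unique up to isomorphism). The algebra $M_k(\mathbb{F})\otimes D$ is $G^\#$-graded by $\deg(E_{ij}\otimes d)=g_i(\deg d)g_j^{-1}$ and is a superalgebra via $p$, isomorphic to $M(n+1,n+1)$. The corresponding $G$-grading on $M(n+1,n+1)$ (defined up to isomorphism) is denoted $\Gamma(t_0,\overline{T},\overline{\beta},u,\gamma)$, and $\Gamma_A(t_0,\overline{T},\overline{\beta},u,\gamma)$ is the induced grading on $A(n,n)$. $\gamma^\delta=(g_1^\delta,\dots,g_k^\delta)$, and $\Xi(\gamma)$ is the multiset in $G^\#/T_u\cong G/T^+$ of the cosets of $g_1,\dots,g_k$ counted with multiplicity; $G$ acts on such multisets by multiplication. *)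

(* Defs.v *)
(* MathComp. The abelian group G is written additively: the identity is 0, u^2
   is u *+ 2 and x^delta is x *~ delta. *)
From HB Require Import structures.
From mathcomp Require Import all_boot all_order all_algebra all_field.
From mathcomp Require Import ring_quotient finmap multiset.
From mathcomp Require Import boolp classical_sets.

Set Implicit Arguments.
Unset Strict Implicit.
Unset Printing Implicit Defensive.

Import GRing.Theory.
Local Open Scope ring_scope.

(* Only the data; the laws hold for the two instances [Mss] and [psl] below. *)
Record superalg (F : fieldType) := Superalg {
  sa_space :> vectType F;
  sa_part : 'Z_2 -> {vspace sa_space};
  sa_mul : sa_space -> sa_space -> sa_space }.

(* [H] may be infinite, hence the finite subfamilies. *)
Definition is_grading (F : fieldType) (H : zmodType) (V : vectType F)
    (mul : V -> V -> V) (Gam : H -> {vspace V}) : Prop :=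
  [/\ forall s : seq H, uniq s -> directv (\sum_(g <- s) Gam g),
      exists s : seq H, (\sum_(g <- s) Gam g)%VS = fullv
    & forall g h x y, x \in Gam g -> y \in Gam h -> mul x y \in Gam (g + h)].

Definition is_super_grading (F : fieldType) (H : zmodType) (A : superalg F)
    (Gam : H -> {vspace A}) : Prop :=
  is_grading (@sa_mul F A) Gam /\
  forall g, Gam g = (Gam g :&: sa_part A 0%R + Gam g :&: sa_part A 1%R)%VS.

Definition is_super_aut (F : fieldType) (A : superalg F) (phi : 'End(A)) :
    Prop :=
  [/\ lker phi = 0%VS,
      forall p, (phi @: sa_part A p)%VS = sa_part A p
    & forall x y, phi (sa_mul x y) = sa_mul (phi x) (phi y)].

Definition iso_gradings (F : fieldType) (H : zmodType) (A : superalg F)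
    (Gam Gam' : H -> {vspace A}) : Prop :=
  exists2 phi : 'End(A), is_super_aut phi
    & forall g, (phi @: Gam g)%VS = Gam' g.

Section Matrices.
Variables (F : fieldType) (r : nat).

Definition mx_part (p : 'Z_2) (A : 'M[F]_(r + r)) : 'M[F]_(r + r) :=
  if p == 0 then block_mx (ulsubmx A) 0 0 (drsubmx A)
  else block_mx 0 (ursubmx A) (dlsubmx A) 0.

Fact mx_part_is_linear p : linear (mx_part p).
Proof.
move=> c A B; rewrite /mx_part; case: ifP => _;
  apply/matrixP => i j; rewrite !mxE; case: (split i) => i'; rewrite !mxE;
  by case: (split j) => j'; rewrite !mxE ?mulr0 ?addr0.
Qed.
HB.instance Definition _ p :=
  GRing.isLinear.Build F 'M[F]_(r + r) 'M[F]_(r + r) _ (mx_part p)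
    (mx_part_is_linear p).

Definition Mpart (p : 'Z_2) : {vspace 'M[F]_(r + r)} :=
  limg (linfun (mx_part p)).

Definition Mss : superalg F :=
  @Superalg F 'M[F]_(r + r) Mpart (fun A B => A *m B).

Definition supercomm (A B : 'M[F]_(r + r)) : 'M[F]_(r + r) :=
  \sum_(p : 'Z_2) \sum_(q : 'Z_2)
    (mx_part p A *m mx_part q B
     - (-1) ^+ (p * q)%N *: (mx_part q B *m mx_part p A)).

Definition supertrace (A : 'M[F]_(r + r)) : F^o :=
  \tr (ulsubmx A) - \tr (drsubmx A).

Fact supertrace_is_linear : linear supertrace.
Proof.
have subD (X Y : 'M[F]_(r + r)) c :
    ulsubmx (c *: X + Y) = c *: ulsubmx X + ulsubmx Y
    /\ drsubmx (c *: X + Y) = c *: drsubmx X + drsubmx Y.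
  by split; apply/matrixP => i j; rewrite !mxE.
move=> c A B; rewrite /supertrace (subD A B c).1 (subD A B c).2 !linearP /=.
by rewrite opprD addrACA -mulrBr.
Qed.
HB.instance Definition _ :=
  GRing.isLinear.Build F 'M[F]_(r + r) F^o _ supertrace supertrace_is_linear.

Definition sl : {vspace 'M[F]_(r + r)} := lker (linfun supertrace).

Definition idline : {vspace 'M[F]_(r + r)} := <[1%:M]>%VS.

(* The quotient sl / F.I is modelled on a complement of F.I in sl; [psl_proj]
   is the canonical projection. It is defined on all matrices but is meaningful
   only on sl: see [psl_proj_eq0], [psl_proj_surj] and [psl_bracket_proj]. *)
Definition psl_space : vectType F := subvs_of (sl :\: idline)%VS.

Definition psl_proj : 'Hom('M[F]_(r + r), psl_space) :=
  (linfun (vsproj (sl :\: idline)) \o daddv_pi (sl :\: idline) idline)%VF.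

Definition psl : superalg F :=
  @Superalg F psl_space
    (fun p => (psl_proj @: (sl :&: Mpart p))%VS)
    (fun x y => psl_proj (supercomm (vsval x) (vsval y))).

Definition induced (H : zmodType) (Gam : H -> {vspace Mss}) :
    H -> {vspace psl} :=
  fun g => (psl_proj @: (sl :&: Gam g))%VS.

Lemma mem_Mpart p A : (A \in Mpart p) = (mx_part p A == A).
Proof.
apply/idP/eqP => [/memv_imgP[B _ ->]|<-].
  rewrite lfunE /= /mx_part; case: (p == 0);
    by rewrite ?block_mxKul ?block_mxKdr ?block_mxKur ?block_mxKdl.
by apply/memv_imgP; exists A; rewrite ?memvf // lfunE.
Qed.

Lemma mx_part_other p q A : A \in Mpart p -> q != p -> mx_part q A = 0.
Proof.
have z2 (x : 'Z_2) : x != 0 -> x = 1.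
  by case: x => [[|[|//]] ?] // _; apply/val_inj.
rewrite mem_Mpart => /eqP <- neq_qp; rewrite /mx_part.
have [p0|/z2 p1] := eqVneq p 0; have [q0|/z2 q1] := eqVneq q 0.
- by rewrite p0 q0 eqxx in neq_qp.
- by rewrite block_mxKur block_mxKdl /block_mx !row_mx0 col_mx0.
- by rewrite block_mxKul block_mxKdr /block_mx !row_mx0 col_mx0.
- by rewrite p1 q1 eqxx in neq_qp.
Qed.

Lemma supercomm_homog p q A B : A \in Mpart p -> B \in Mpart q ->
  supercomm A B = A *m B - (-1) ^+ (p * q)%N *: (B *m A).
Proof.
move=> Ap Bq; rewrite /supercomm (bigD1 p) //= [X in _ + X]big1 ?addr0.
  rewrite (bigD1 q) //= [X in _ + X]big1 ?addr0.
    by move: Ap Bq; rewrite !mem_Mpart => /eqP-> /eqP->.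
  by move=> s sq; rewrite (mx_part_other Bq sq) mulmx0 mul0mx scaler0 subrr.
move=> s sp; rewrite big1 // => t _.
by rewrite (mx_part_other Ap sp) mulmx0 mul0mx scaler0 subrr.
Qed.

Lemma mem_sl A : (A \in sl) = (supertrace A == 0).
Proof. by rewrite memv_ker lfunE. Qed.

Lemma id_sl : 1%:M \in sl.
Proof.
rewrite mem_sl /supertrace -[1%:M]submxK.
by rewrite scalar_mx_block !block_mxKul !block_mxKdr subrr.
Qed.

Lemma psl_projE A : A \in sl -> vsval (psl_proj A) - A \in idline.
Proof.
move=> Asl; set C := (sl :\: idline)%VS.
have capC : (C :&: idline)%VS = 0%VS by apply: capv_diff.
have AC : A \in (C + idline)%VS.
  by rewrite addv_diff (subvP (addvSl _ _)).
rewrite /psl_proj comp_lfunE lfunE /= vsprojK ?memv_pi // -/C.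
rewrite -[X in _ - X](daddv_pi_add capC AC) opprD addrA subrr sub0r.
by rewrite memvN memv_pi.
Qed.

Lemma psl_proj_vsval (x : psl_space) : psl_proj (vsval x) = x.
Proof.
by rewrite /psl_proj comp_lfunE lfunE /= daddv_pi_id ?capv_diff ?subvsP //
  vsvalK.
Qed.

Lemma vsval_sl (x : psl_space) : vsval x \in sl.
Proof. exact: subvP (diffvSl _ _) _ (subvsP x). Qed.

Lemma psl_proj_surj (x : psl_space) : exists2 A, A \in sl & psl_proj A = x.
Proof. by exists (vsval x); [apply: vsval_sl | apply: psl_proj_vsval]. Qed.

Lemma psl_proj_eq0 A : A \in sl -> (psl_proj A == 0) = (A \in idline).
Proof.
move=> Asl; have dA := psl_projE Asl; apply/eqP/idP => [A0 | AI].
  by move: dA; rewrite A0 linear0 sub0r memvN.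
apply/val_inj/eqP; rewrite linear0 -memv0 -(capv_diff sl idline) memv_cap.
by rewrite subvsP -(rpredBr _ AI).
Qed.

Lemma supercomm_linl B : linear (supercomm^~ B).
Proof.
move=> c A A'; rewrite /supercomm scaler_sumr -big_split; apply: eq_bigr => p _.
rewrite scaler_sumr -big_split; apply: eq_bigr => q _ /=.
rewrite linearP mulmxDl mulmxDr -scalemxAl -scalemxAr scalerDr scalerBr.
by rewrite opprD addrACA !scalerA [_ * c]mulrC.
Qed.

Lemma supercomm_linr A : linear (supercomm A).
Proof.
move=> c B B'; rewrite /supercomm scaler_sumr -big_split; apply: eq_bigr => p _.
rewrite scaler_sumr -big_split; apply: eq_bigr => q _ /=.
rewrite linearP mulmxDl mulmxDr -scalemxAl -scalemxAr scalerDr scalerBr.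
by rewrite opprD addrACA !scalerA [_ * c]mulrC.
Qed.

Lemma sum_mx_part A : \sum_(p : 'Z_2) mx_part p A = A.
Proof.
rewrite big_ord_recl big_ord1 /mx_part /= add_block_mx !addr0 !add0r.
exact: submxK.
Qed.

Lemma idline_part0 Z p : Z \in idline -> mx_part p Z = if p == 0 then Z else 0.
Proof.
case/vlineP => c ->; rewrite linearZ /=.
have E : mx_part 0 1%:M = 1%:M.
  by rewrite /mx_part eqxx -[RHS]submxK scalar_mx_block !block_mxKul
    !block_mxKdr !block_mxKur !block_mxKdl.
case: eqVneq => [->|p0]; first by rewrite E.
by rewrite (@mx_part_other 0) ?scaler0 // mem_Mpart E.
Qed.

Lemma supercomm_idl Z B : Z \in idline -> supercomm Z B = 0.
Proof.
move=> ZI; rewrite /supercomm big1 // => p _; rewrite big1 // => q _.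
rewrite idline_part0 //; case: eqVneq => [->|_]; last first.
  by rewrite mul0mx mulmx0 scaler0 subrr.
have [c ->] := vlineP _ _ ZI.
by rewrite mul0n expr0 scale1r -scalemxAl -scalemxAr mul1mx mulmx1 subrr.
Qed.

Lemma supercomm_idr A Z : Z \in idline -> supercomm A Z = 0.
Proof.
move=> ZI; rewrite /supercomm big1 // => p _; rewrite big1 // => q _.
rewrite (idline_part0 q) //; case: eqVneq => [->|_]; last first.
  by rewrite mul0mx mulmx0 scaler0 subrr.
have [c ->] := vlineP _ _ ZI.
by rewrite muln0 expr0 scale1r -scalemxAl -scalemxAr mul1mx mulmx1 subrr.
Qed.

Lemma psl_bracket_proj A B : A \in sl -> B \in sl ->
  @sa_mul F psl (psl_proj A) (psl_proj B) = psl_proj (supercomm A B).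
Proof.
move=> Asl Bsl; congr (psl_proj _).
set A' := vsval _; set B' := vsval _.
have scD X Y Z : supercomm (X + Y) Z = supercomm X Z + supercomm Y Z.
  by have := supercomm_linl Z 1 X Y; rewrite !scale1r.
have scDr X Y Z : supercomm X (Y + Z) = supercomm X Y + supercomm X Z.
  by have := supercomm_linr X 1 Y Z; rewrite !scale1r.
rewrite -[A'](subrK A) -[B'](subrK B) scD scDr.
by rewrite !(supercomm_idl _ (psl_projE Asl)) add0r scDr
  (supercomm_idr _ (psl_projE Bsl)) !add0r.
Qed.

End Matrices.

Notation A_ F n := (psl F n.+1).

Section Bicharacters.
Variables (F : fieldType) (H : zmodType) (S : {pred H}).

Definition is_subgroup : Prop :=
  0 \in S /\ {in S &, forall s t, s - t \in S}.

Definition is_char (chi : H -> F) : Prop :=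
  {in S, forall s, chi s != 0} /\
  {in S &, forall s t, chi (s + t) = chi s * chi t}.

Definition is_bichar (b : H -> H -> F) : Prop :=
  {in S, forall s, is_char (b s)} /\ {in S, forall t, is_char (b^~ t)}.

Definition alternating (b : H -> H -> F) : Prop :=
  {in S, forall t, b t t = 1}.

Definition nondegenerate (b : H -> H -> F) : Prop :=
  {in S, forall s, {in S, forall t, b s t = 1} -> s = 0}.

Definition nondeg_alt_bichar (b : H -> H -> F) : Prop :=
  [/\ is_bichar b, alternating b & nondegenerate b].

End Bicharacters.

Section TypeI.
Variables (F : fieldType) (G : zmodType) (n : nat).
Implicit Type Gam : G -> {vspace A_ F n}.

Definition typeI Gam : Prop :=
  exists2 Del : G -> {vspace Mss F n.+1},
    is_super_grading Del & forall g, Gam g = induced Del g.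

Definition in_E (alpha : 'End(A_ F n)) : Prop :=
  exists B : 'M[F]_(n.+1 + n.+1),
    [/\ B \in Mpart F n.+1 0, B \in unitmx
      & forall X, X \in sl F n.+1 ->
          alpha (psl_proj F n.+1 X) = psl_proj F n.+1 (B *m X *m invmx B)].

Definition acts_as Gam (chi : G -> F) (alpha : 'End(A_ F n)) : Prop :=
  forall g x, x \in Gam g -> alpha x = chi g *: x.

Definition even_typeI Gam : Prop :=
  typeI Gam /\
  forall chi : G -> F, is_char predT chi ->
    exists2 alpha, in_E alpha & acts_as Gam chi alpha.

Definition odd_typeI Gam : Prop := typeI Gam /\ ~ even_typeI Gam.

End TypeI.

Section Quotient.
Variables (G : zmodType) (t0 : G).

Definition cyc : {pred G} := fun x => `[< exists m : int, x = t0 *~ m >].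

Fact cyc_zmod_closed : zmod_closed cyc.
Proof.
split=> [|_ _ /asboolP[m ->] /asboolP[m' ->]]; apply/asboolP.
  by exists 0; rewrite mulr0z.
by exists (m - m'); rewrite mulrzBr.
Qed.
HB.instance Definition _ := GRing.isZmodClosed.Build G cyc cyc_zmod_closed.

Definition Gbar : zmodType := Quotient.quot cyc.
Definition bar (x : G) : Gbar := \pi_(Quotient.quot cyc)%qT x.

Definition Tplus (T : {fset Gbar}) : {pred G} := fun x => bar x \in T.

Lemma bar_eq x y : (bar x == bar y) = (x - y \in cyc).
Proof. by rewrite -Quotient.idealrBE. Qed.

End Quotient.

Record params (F : fieldType) (G : zmodType) := Params {
  p_t0 : G;
  p_T : {fset Gbar p_t0};
  p_beta : Gbar p_t0 -> Gbar p_t0 -> F;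
  p_u : G;
  p_k : nat;
  p_gamma : p_k.-tuple G }.
Arguments p_beta {F G} p.

Definition order2 (G : zmodType) (t0 : G) : Prop := t0 <> 0 /\ t0 *+ 2 = 0.

(* One character of T^+ for each pair (t0, T); its values off T^+ are
   irrelevant. *)
Definition char_choice (F : fieldType) (G : zmodType) :=
  forall t0 : G, {fset Gbar t0} -> G -> F.

Definition char_choice_ok (F : fieldType) (G : zmodType)
    (chi : char_choice F G) : Prop :=
  forall (t0 : G) (T : {fset Gbar t0}), order2 t0 -> is_subgroup (mem T) ->
    is_char (Tplus T) (chi t0 T) /\ chi t0 T t0 = -1.

Section Params.
Variables (F : fieldType) (G : zmodType) (chi : char_choice F G).
Variable P : params F G.

Local Notation T := (p_T P).
Local Notation u := (p_u P).
Local Notation k := (p_k P).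
Local Notation chiT := (@chi (p_t0 P) (p_T P)).

Definition is_a (a : G) : Prop :=
  [/\ a \in Tplus T, chiT a = 1
    & {in Tplus T, forall t, chiT t ^+ 2 = p_beta P (bar _ a) (bar _ t)}].

Definition valid (n : nat) : Prop :=
  [/\ order2 (p_t0 P),
      is_subgroup (mem T),
      nondeg_alt_bichar (mem T) (p_beta P),
      exists2 a, is_a a & u *+ 2 = a
    & exists2 l, (l ^ 2 = #|` T|)%N & (k * l = n.+1)%N].

Definition Gsharp : zmodType := (G * 'Z_2)%type.

Definition t1 : Gsharp := (u, 1).

Definition Tu : {pred Gsharp} := fun x =>
  (x.2 == 0) && (x.1 \in Tplus T) ||
  ((x - t1).2 == 0) && ((x - t1).1 \in Tplus T).

Definition is_beta_u (b : Gsharp -> Gsharp -> F) : Prop :=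
  [/\ nondeg_alt_bichar Tu b,
      {in Tplus T &, forall s t, b (s, 0) (t, 0) = p_beta P (bar _ s) (bar _ t)}
    & {in Tplus T, forall t, b t1 (t, 0) = chiT t}].

Definition is_graded_division (b : Gsharp -> Gsharp -> F) (D : falgType F)
    (DG : Gsharp -> {vspace D}) : Prop :=
  [/\ is_grading *%R DG,
      forall h x, x \in DG h -> x != 0 -> x \is a GRing.unit,
      forall h, h \notin Tu -> DG h = 0%VS
    & exists X : Gsharp -> D,
        {in Tu, forall t, X t != 0 /\ DG t = <[X t]>%VS} /\
        {in Tu &, forall s t, X s * X t = b s t *: (X t * X s)}].

(* M_k(F) (x) D is identified with M_k(D), E_ij (x) d being the matrix with the
   single entry d at (i, j). *)
Definition mxD_comp (D : falgType F) (DG : Gsharp -> {vspace D}) (h : Gsharp)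
    (A : 'M[D]_k) : Prop :=
  forall i j, A i j \in
    DG (h - ((tnth (p_gamma P) i, 0) : Gsharp)
          + ((tnth (p_gamma P) j, 0) : Gsharp)).

Definition is_algebra_iso (D : falgType F) (m : nat)
    (phi : 'M[D]_k -> 'M[F]_m) : Prop :=
  [/\ bijective phi,
      forall A B, phi (A + B) = phi A + phi B,
      forall (c : F) A, phi (map_mx ( *:%R c) A) = c *: phi A
    & forall A B, phi (A *m B) = phi A *m phi B].

(* [Gam] is one of the mutually isomorphic gradings on M(n+1,n+1) denoted by
   Gamma(t0, T, beta, u, gamma). The last clause makes [phi] both an isomorphism
   of superalgebras and a transport of the G^#-grading of M_k(D) to the pair
   formed by [Gam] and the parity. *)
Definition is_Gamma (n : nat) (Gam : G -> {vspace Mss F n.+1}) : Prop :=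
  is_super_grading Gam /\
  exists (b : Gsharp -> Gsharp -> F) (D : falgType F)
         (DG : Gsharp -> {vspace D}) (phi : 'M[D]_k -> 'M[F]_(n.+1 + n.+1)),
    [/\ is_beta_u b, is_graded_division b DG, is_algebra_iso phi
      & forall g p A,
          mxD_comp DG (g, p) A <-> phi A \in (Gam g :&: Mpart F n.+1 p)%VS].

Definition is_Gamma_A (n : nat) (Gam : G -> {vspace A_ F n}) : Prop :=
  exists2 Del : G -> {vspace Mss F n.+1}, is_Gamma Del
    & forall g, Gam g = induced Del g.

End Params.

Section Multiset.
Local Open Scope classical_set_scope.
Local Open Scope mset_scope.
Variable G : zmodType.

Definition translate (g : G) (C : set G) : set G := [set g + x | x in C].

Definition Xi (t0 : G) (T : {fset Gbar t0}) (gamma : seq G) : {mset (set G)} :=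
  seq_mset [seq translate g [set` Tplus T] | g <- gamma].

Definition mset_act (g : G) (M : {mset (set G)}) : {mset (set G)} :=
  seq_mset [seq translate g C | C <- M].

End Multiset.

Definition equiv_params (F : fieldType) (G : zmodType) (P P' : params F G) :
    Prop :=
  [/\ p_t0 P = p_t0 P',
      (* T = T' inside the common quotient of G, via preimages in G *)
      Tplus (p_T P) =i Tplus (p_T P')
    & exists (delta : int) (g : G),
      [/\ delta = 1 \/ delta = -1,
          {in Tplus (p_T P) &, forall s t,
            p_beta P (bar _ s) (bar _ t) ^ delta
            = p_beta P' (bar _ s) (bar _ t)},
          p_u P *~ delta - p_u P' \in cyc (p_t0 P)
        & mset_act g (Xi (p_T P) [seq x *~ delta | x <- p_gamma P])
          = Xi (p_T P') (p_gamma P')]].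

(* Main.v *)
(* Put H = G x Z_2; a Type I grading is an H-grading of M = M(n+1,n+1) by degree
   and parity. Homogeneous matrices of nonzero degree have trace 0, so for an
   idempotent e of degree 0 and minimal rank, e M e is a graded division algebra
   with one-dimensional components X_t, t in T, and M is described by a frame:
   matrices x_i, y_i of degrees gam_i, - gam_i with y_i x_j = delta_ij e and
   \sum_i x_i y_i = 1. A grading determines T, the commutation factor b of the X_t
   and, up to a common shift, the multiset of the gam_i modulo T; conversely these
   data determine the grading up to conjugation.
   If all of T is even, a character of G acts as conjugation by
   \sum_i chi(gam_i) x_i X_t y_i for the t with b(t, _) = chi on T, so the grading
   is even. Otherwise t0 is the element of T pairing with T by parity, i.e. the
   degree of E0 = diag(1, -1), and the other parameters are read off T and b.
   A superautomorphism phi of A(n,n) maps E0 Z to sg E0 phi(Z) on even traceless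
   Z, as E0 generates the centroid. For a suitable sign rho, v |-> phi(v) + rho E0
   phi(E0 v) is bijective on odd matrices and extends to an automorphism or an
   antiautomorphism of M mapping one grading to the other; an antiautomorphism
   inverts b and the gam_i, which is the case delta = -1. *)

(* The Lie superalgebra A(1,1) has superautomorphisms that mix the two off-diagonal blocks and come
   from no automorphism or antiautomorphism of M, even after rescaling odd matrices, so an attempt
   to lift phi itself would fail for n = 1. What is lifted is a part of phi on odd matrices that
   commutes or anticommutes with left multiplication by [E0]; this works for every n at once and
   needs no knowledge of the automorphism group. Nothing is lost for gradings: [E0] is homogeneous
   of degree t0 in both gradings and t0 has order 2, so passing to this part keeps degrees. [E0]
   also turns brackets into products: it anticommutes with odd v, whence E0 [E0 A, v] = A v + v A.
   Frames stand in for M_k(D): the algebra D appears only where a frame is compared with the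
   definition of Gamma. Characteristic 0 enters mainly through the trace, which detects
   non-nilpotent elements of degree 0 and counts the gam_i in each coset. *)
Require Import Defs.
From HB Require Import structures.
From mathcomp Require Import all_boot all_order all_algebra all_field.
From mathcomp Require Import ring_quotient finmap multiset.
From mathcomp Require Import boolp classical_sets.
From mathcomp Require Import zify ring.
Set Implicit Arguments.
Unset Strict Implicit.
Unset Printing Implicit Defensive.
Import GRing.Theory.
Local Open Scope ring_scope.

(** * Gradings as families of projections *)

Section DirectSums.
Variables (F : fieldType) (H : zmodType) (V : vectType F).
Implicit Types (Gam : H -> {vspace V}) (s : seq H).

Lemma directv_seqP Gam s : uniq s ->
  reflect (forall u : H -> V, (forall g, g \in s -> u g \in Gam g) ->
             \sum_(g <- s) u g = 0 -> forall g, g \in s -> u g = 0)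
          (directv (\sum_(g <- s) Gam g)).
Proof.
move=> us.
have -> : directv (\sum_(g <- s) Gam g)
  = directv (\sum_(i < size s) Gam (tnth (in_tuple s) i)).
  by rewrite !directvE /= (big_tnth _ _ s _ Gam) (big_tnth _ _ s _ (fun g => \dim (Gam g))).
have tnthE (i : 'I_(size s)) x0 : tnth (in_tuple s) i = nth x0 s i.
  by rewrite (tnth_nth x0).
apply: (iffP directv_sum_independent) => [dx u Gu u0 g gs | dx w Gw w0 i _].
  have Hw i : true -> u (tnth (in_tuple s) i) \in Gam (tnth (in_tuple s) i).
    by move=> _; rewrite Gu // (tnthE i 0) mem_nth.
  have := dx (fun i => u (tnth (in_tuple s) i)) Hw.
  rewrite big_tnth in u0; move=> /(_ u0 (Ordinal (etrans (index_mem g s) gs)) isT).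
  by rewrite (tnthE _ 0) /= nth_index.
(* [w] is indexed by positions in [s]; it becomes a family on H with value 0 off [s]. *)
pose u g := if insub (index g s) is Some i then w i else 0.
have uE (j : 'I_(size s)) : u (tnth (in_tuple s) j) = w j.
  by rewrite /u (tnthE _ 0) index_uniq ?ltn_ord // valK.
have -> : w i = u (tnth (in_tuple s) i) by rewrite uE.
apply: dx; last by rewrite (tnthE _ 0) mem_nth.
  move=> g gs; have gi : (index g s < size s)%N by rewrite index_mem.
  have := Gw (Ordinal gi) isT; rewrite -uE.
  by rewrite (tnthE _ 0) /= nth_index.
by rewrite big_tnth -[RHS]w0; apply: eq_bigr => j _; rewrite uE.
Qed.

(** A dimension count: the intersection of U and W has dimension dim U + dim W - dim (U + W), and
    dim W is at most the sum of the dimensions of its terms. *)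
Lemma directv_consP Gam g s : directv (\sum_(h <- g :: s) Gam h) ->
  (Gam g :&: \sum_(h <- s) Gam h)%VS = 0%VS.
Proof.
rewrite directvE /= !big_cons => /eqP dE; apply/eqP; rewrite -dimv_eq0.
have := dimv_sum_cap (Gam g) (\sum_(h <- s) Gam h)%VS.
have := dimv_leq_sum s xpredT Gam; rewrite dE; set a := \dim _; set b := \dim _.
by lia.
Qed.

(** The list [s] only has to contain the support, and [pr] is defined on all of H, so taking
    homogeneous components is linear and free of membership conditions. *)
Definition gproj Gam s (pr : H -> 'End(V)) : Prop :=
  [/\ uniq s, forall g x, pr g x \in Gam g,
      forall g h x, x \in Gam g -> pr h x = if h == g then x else 0
    & forall x, x = \sum_(g <- s) pr g x].

Lemma gprojP mul Gam : is_grading mul Gam <->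
  (exists s pr, gproj Gam s pr) /\
  forall g h x y, x \in Gam g -> y \in Gam h -> mul x y \in Gam (g + h).
Proof.
split=> [[dx [s0 s0f] mulG]|[[s [pr [us prG prE prs]]] mulG]]; last first.
  split=> // [s' us'|].
    apply/directv_seqP => // u Gu u0 g gs'.
    have := congr1 (pr g) u0; rewrite linear_sum linear0 => <-.
    rewrite (bigD1_seq g) //= (prE _ _ _ (Gu g gs')) eqxx big_seq_cond big1.
      by rewrite addr0.
    by move=> h /andP[hs' hg]; rewrite (prE _ _ _ (Gu h hs')) eq_sym (negPf hg).
  exists s; apply/vspaceP => x; rewrite memvf (prs x).
  rewrite (big_tnth _ _ s _ Gam) (big_tnth _ _ s _ (fun g => pr g x)).
  by apply: memv_sumr => i _; apply: prG.
(* The spanning list of [is_grading] may repeat degrees. *)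
split=> //; pose s := undup s0; have us : uniq s by apply: undup_uniq.
have sf : (\sum_(g <- s) Gam g)%VS = fullv.
  apply/eqP; rewrite eqEsubv subvf -s0f /=.
  rewrite (big_tnth _ _ s0 _ Gam); apply/subv_sumP => i _.
  set g := tnth _ i; have gs : g \in s by rewrite mem_undup [g](tnth_nth 0) mem_nth.
  by rewrite (big_rem g) //= addvSl.
(* Directness on [g :: s] makes the component of g meet the sum over [s], which is the whole space,
   in 0. *)
have out g : g \notin s -> Gam g = 0%VS.
  move=> gs; have := dx (g :: s); rewrite /= gs us => /(_ isT).
  by move/directv_consP; rewrite sf capvf.
pose W g := (\sum_(h <- rem g s) Gam h)%VS.
have cap g : (Gam g :&: W g)%VS = 0%VS.
  have := dx (g :: rem g s); rewrite /= mem_rem_uniqF // rem_uniq // => /(_ isT).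
  exact: directv_consP.
have addW g : (Gam g + W g)%VS = fullv.
  have [gs|gs] := boolP (g \in s); first by rewrite -sf (big_rem g).
  by rewrite out // add0v /W -sf; congr bigop; rewrite rem_id.
pose pr g := daddv_pi (Gam g) (W g).
have prE g h x : x \in Gam g -> pr h x = if h == g then x else 0.
  move=> xG; case: eqVneq => [->|hg]; first by rewrite /pr daddv_pi_id.
  have [gs|/out gs] := boolP (g \in s); last first.
    by move: xG; rewrite gs memv0 => /eqP->; rewrite linear0.
  have xW : x \in W h.
    rewrite /W (big_rem g) /=; first exact: (subvP (addvSl _ _)).
    by rewrite mem_rem_uniq // !inE eq_sym hg.
  have := daddv_pi_add (cap h) (w := x); rewrite addW memvf => /(_ isT).
  rewrite (daddv_pi_id _ xW) 1?capvC // => /(canRL (addrK _)).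
  by rewrite subrr.
exists s, pr; split=> // [g x|x]; first exact: memv_pi.
have : x \in (\sum_(g <- s) Gam g)%VS by rewrite sf memvf.
rewrite (big_tnth _ _ s _ Gam) => /memv_sumP[v vG ->].
have vE i h : pr h (v i) = if h == tnth (in_tuple s) i then v i else 0.
  by apply: prE; apply: vG.
transitivity (\sum_(h <- s) \sum_(i < size s) pr h (v i)); last first.
  by apply: eq_bigr => h _; rewrite linear_sum.
rewrite exchange_big /=; apply: eq_bigr => i _.
have ti : tnth (in_tuple s) i \in s by rewrite (tnth_nth 0) mem_nth.
rewrite (bigD1_seq _ ti us) /= vE eqxx big1 ?addr0 // => h hn.
by rewrite vE (negPf hn).
Qed.

Section Theory.
Variables (Gam : H -> {vspace V}) (s : seq H) (pr : H -> 'End(V)).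
Hypothesis gG : gproj Gam s pr.

Lemma gproj_mem g x : (x \in Gam g) = (pr g x == x).
Proof.
case: gG => _ prG prE _; apply/idP/eqP => [/prE->|<-]; last exact: prG.
by rewrite eqxx.
Qed.

Lemma gproj_id g x : x \in Gam g -> pr g x = x.
Proof. by rewrite gproj_mem => /eqP. Qed.

Lemma gproj_in g x : pr g x \in Gam g.
Proof. by case: gG. Qed.

Lemma gproj_neq g h x : x \in Gam g -> h != g -> pr h x = 0.
Proof. by case: gG => _ _ prE _ /prE-> /negPf->. Qed.

Lemma gproj_sum x : x = \sum_(g <- s) pr g x.
Proof. by case: gG. Qed.

Lemma gproj_inj g h x : x \in Gam g -> x \in Gam h -> x != 0 -> g = h.
Proof.
move=> xg xh; apply: contra_neq_eq => gh.
by rewrite -(gproj_id xg) (gproj_neq xh gh).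
Qed.

Lemma gproj_supp g x : x \in Gam g -> x != 0 -> g \in s.
Proof.
move=> xg; apply: contraR => gs; rewrite [x]gproj_sum big_seq big1 // => h hs.
by rewrite (gproj_neq xg) //; apply: contraNneq gs => <-.
Qed.

Lemma gproj_neq0 x : x != 0 -> exists g, pr g x != 0.
Proof.
move=> x0; apply: contrapT => pr0; move/eqP: x0; apply.
rewrite [x]gproj_sum big1 // => g _; apply/eqP/negPn/negP => n0.
by apply: pr0; exists g.
Qed.

End Theory.
End DirectSums.

Lemma gproj_comm (F : fieldType) (H : zmodType) (V V' : vectType F)
    (Gam : H -> {vspace V}) s pr (Gam' : H -> {vspace V'}) s' pr'
    (f : {linear V -> V'}) :
  gproj Gam s pr -> gproj Gam' s' pr' ->
  (forall g x, x \in Gam g -> f x \in Gam' g) ->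
  forall g x, pr' g (f x) = f (pr g x).
Proof.
move=> gG gG' fG g x; rewrite {1}(gproj_sum gG x) !linear_sum.
have E h : pr' g (f (pr h x)) = if h == g then f (pr g x) else 0.
  case: eqVneq => [->|hg]; first by rewrite (gproj_id gG') // fG // (gproj_in gG).
  by rewrite (gproj_neq gG' (fG _ _ (gproj_in gG h x))) // eq_sym.
transitivity (\sum_(h <- s) if h == g then f (pr g x) else 0).
  by apply: eq_bigr => h _; apply: E.
have us : uniq s by case: gG.
have [gs|gs] := boolP (g \in s).
  by rewrite (bigD1_seq g) //= eqxx big1 ?addr0 // => h /negPf->.
rewrite big_seq big1 => [|h hs]; last first.
  by case: eqVneq => // hg; rewrite -hg hs in gs.
have [->|n0] := eqVneq (pr g x) 0; first by rewrite linear0.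
by rewrite (gproj_supp gG (gproj_in gG g x) n0) in gs.
Qed.

(** A degree-preserving map commutes with the projections, so x and [pr g x] have the same image as
    soon as f x has degree g. *)
Lemma gproj_onto (F : fieldType) (H : zmodType) (V V' : vectType F)
    (Gam : H -> {vspace V}) s pr (Gam' : H -> {vspace V'}) s' pr'
    (f : {linear V -> V'}) :
  gproj Gam s pr -> gproj Gam' s' pr' ->
  (forall g x, x \in Gam g -> f x \in Gam' g) -> injective f ->
  forall g x, f x \in Gam' g -> x \in Gam g.
Proof.
move=> gG gG' fG fI g x fx; rewrite (gproj_mem gG); apply/eqP/fI.
by rewrite -(gproj_comm gG gG' fG) (gproj_id gG').
Qed.

(** * Gradings of matrix algebras *)

Section MatrixGradings.
Variables (F : closedFieldType) (charF : [pchar F] =i pred0).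
Variables (m : nat) (H : zmodType).
Local Notation N := m.+1.
Local Notation M := 'M[F]_N.

Lemma natf_neq0 k : (k.+1%:R : F) != 0.
Proof. by rewrite (iffLR (pcharf0P F)). Qed.

Lemma natf_inj i j : i%:R = j%:R :> F -> i = j.
Proof.
wlog ij : i j / (i <= j)%N => [W|] E.
  by case: (leqP i j) => [|/ltnW] /W; [apply | move=> W'; apply/esym/W'].
have /eqP : (j - i)%:R = 0 :> F by rewrite natrB // E subrr.
rewrite (iffLR (pcharf0P F)) // subn_eq0 => ji.
by apply/eqP; rewrite eqn_leq ij.
Qed.

Lemma mx_neq0 p q (A : 'M[F]_(p, q)) : A != 0 -> exists i j, A i j != 0.
Proof.
move=> A0; apply: contrapT => nz; move/eqP: A0; apply; apply/matrixP => i j.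
by rewrite mxE; apply/eqP/negPn/negP => n0; apply: nz; exists i, j.
Qed.

Lemma mxprod_delta (A B : M) i j p q :
  (A *m delta_mx p q *m B) i j = A i p * B q j.
Proof.
rewrite -(mul_delta_mx (0 : 'I_1)) mulmxA -mulmxA -colE -rowE.
by rewrite mxE big_ord1 !mxE.
Qed.

Lemma mxtrace_delta_mul (A : M) i j : \tr (A *m delta_mx i j) = A j i.
Proof.
rewrite /mxtrace (bigD1 j) //= big1 => [|k kj].
  rewrite addr0 mxE (bigD1 i) //= big1 => [|l li].
    by rewrite mxE !eqxx mulr1 addr0.
  by rewrite mxE (negPf li) mulr0.
by rewrite mxE big1 // => l _; rewrite mxE (negPf kj) andbF mulr0.
Qed.

(** Write E_ij = E_i0 E_0j and exchange the factors: E_0j E_i0 is E_00 or 0. *)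
Lemma trace_functional (tau : M -> F) :
  (forall c x y, tau (c *: x + y) = c * tau x + tau y) ->
  (forall x y, tau (x *m y) = tau (y *m x)) ->
  forall x, tau x = \tr x * tau (delta_mx 0 0).
Proof.
move=> tauL tauC x.
have tau0 : tau 0 = 0.
  by have := tauL (-1) 0 0; rewrite scaler0 addr0 mulN1r addNr.
have tauD y z : tau (y + z) = tau y + tau z.
  by rewrite -[y]scale1r tauL mul1r scale1r.
have tauZ c y : tau (c *: y) = c * tau y by rewrite -[c *: y]addr0 tauL tau0 addr0.
have tauE i j : tau (delta_mx i j) = (i == j)%:R * tau (delta_mx 0 0).
  rewrite -(mul_delta_mx (0 : 'I_N)) tauC; case: eqVneq => [->|ij].
    by rewrite mul_delta_mx mul1r.
  by rewrite mul_delta_mx_0 1?eq_sym // tau0 mul0r.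
rewrite {1}[x]matrix_sum_delta (big_morph tau tauD tau0) /mxtrace mulr_suml.
apply: eq_bigr => i _; rewrite (big_morph tau tauD tau0) (bigD1 i) //= big1.
  by rewrite tauZ tauE eqxx mul1r addr0.
by move=> j ji; rewrite tauZ tauE eq_sym (negPf ji) mul0r mulr0.
Qed.

Lemma central_scalar (A : M) : (forall B, A *m B = B *m A) -> A = (A 0 0)%:M.
Proof.
move=> AC; have E (i j k l : 'I_N) :
    (l == j)%:R * A k i = (k == i)%:R * A j l.
  have := congr1 (fun B : M => B k l) (AC (delta_mx i j)); rewrite !mxE.
  rewrite (bigD1 i) //= big1 => [|q /negPf qi]; last by rewrite mxE qi mulr0.
  rewrite (bigD1 j) //= big1 => [|q /negPf qj]; last by rewrite mxE qj andbF mul0r.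
  by rewrite !mxE !eqxx /= !addr0 andbT mulrC => ->.
apply/matrixP => i j; rewrite mxE.
have := E j 0 i 0; rewrite eqxx mul1r => ->.
by case: eqVneq; rewrite ?mul1r ?mul0r.
Qed.

(** All eigenvalues vanish, so the characteristic polynomial is X^N, and its coefficient of degree N
    - 1 is minus the trace. *)
Lemma nilp_trace (A : M) k : A ^+ k = 0 -> \tr A = 0.
Proof.
move=> Ak0; have [rs rsE] := closed_field_poly_normal (char_poly A).
rewrite (monicP (char_poly_monic A)) scale1r in rsE.
have rs0 z : z \in rs -> z = 0.
  move=> zrs; have : root (char_poly A) z by rewrite rsE root_prod_XsubC.
  rewrite -eigenvalue_root_char => /eigenvalueP [v vA v0].
  have it j : v *m A ^+ j = z ^+ j *: v.
    elim: j => [|j IH]; first by rewrite !expr0 mulmx1 scale1r.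
    by rewrite !exprS -mulmxE mulmxA vA -scalemxAl IH scalerA.
  have /eqP := it k; rewrite Ak0 mulmx0 eq_sym scaler_eq0 (negPf v0) orbF.
  by rewrite expf_eq0 => /andP[_ /eqP].
have szrs : size rs = N.
  by have := size_char_poly A; rewrite rsE size_prod_XsubC => -[].
have : char_poly A = 'X^N.
  rewrite rsE -szrs; elim: (rs) rs0 => [|z r IH] z0; first by rewrite big_nil.
  rewrite big_cons (z0 z) ?mem_head // subr0 IH ?exprS // => y yr.
  by apply: z0; rewrite inE yr orbT.
move=> cE; have := char_poly_trace A (ltn0Sn m); rewrite cE coefXn /=.
by rewrite (ltn_eqF (ltnSn m)) => /eqP; rewrite eq_sym oppr_eq0 => /eqP.
Qed.

Section Graded.
Variables (Gam : H -> {vspace M}) (s : seq H) (pr : H -> 'End(M)).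
Hypothesis gG : gproj Gam s pr.
Hypothesis mulG : forall g h x y,
  x \in Gam g -> y \in Gam h -> x *m y \in Gam (g + h).

Lemma pr_mulr g h a x : x \in Gam h -> pr (g + h) (a *m x) = pr g a *m x.
Proof.
move=> xh; rewrite {1}(gproj_sum gG a) mulmx_suml linear_sum.
have E k : pr (g + h) (pr k a *m x) = if k == g then pr g a *m x else 0.
  have kh := mulG (gproj_in gG k a) xh.
  case: eqVneq => [<-|kg]; first by rewrite (gproj_id gG kh).
  by rewrite (gproj_neq gG kh) // (inj_eq (addIr _)) eq_sym.
transitivity (\sum_(k <- s) if k == g then pr g a *m x else 0).
  by apply: eq_bigr => k _; apply: E.
have us : uniq s by case: gG.
have [gs|gs] := boolP (g \in s).
  by rewrite (bigD1_seq g) //= eqxx big1 ?addr0 // => k /negPf->.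
rewrite big_seq big1 => [|k ks]; last first.
  by case: eqVneq => // hg; rewrite -hg ks in gs.
have [->|n0] := eqVneq (pr g a) 0; first by rewrite mul0mx.
by rewrite (gproj_supp gG (gproj_in gG g a) n0) in gs.
Qed.

Lemma pr_mull g h a x : x \in Gam h -> pr (h + g) (x *m a) = x *m pr g a.
Proof.
move=> xh; rewrite {1}(gproj_sum gG a) mulmx_sumr linear_sum.
have E k : pr (h + g) (x *m pr k a) = if k == g then x *m pr g a else 0.
  have kh := mulG xh (gproj_in gG k a).
  case: eqVneq => [<-|kg]; first by rewrite (gproj_id gG kh).
  by rewrite (gproj_neq gG kh) // (inj_eq (addrI _)) eq_sym.
transitivity (\sum_(k <- s) if k == g then x *m pr g a else 0).
  by apply: eq_bigr => k _; apply: E.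
have us : uniq s by case: gG.
have [gs|gs] := boolP (g \in s).
  by rewrite (bigD1_seq g) //= eqxx big1 ?addr0 // => k /negPf->.
rewrite big_seq big1 => [|k ks]; last first.
  by case: eqVneq => // hg; rewrite -hg ks in gs.
have [->|n0] := eqVneq (pr g a) 0; first by rewrite mulmx0.
by rewrite (gproj_supp gG (gproj_in gG g a) n0) in gs.
Qed.

(** The degree 0 component of the identity is a left identity on homogeneous elements, hence on
    everything. *)
Lemma gr1 : 1%:M \in Gam 0.
Proof.
have E (x : M) : x = pr 0 1%:M *m x.
  rewrite {1}(gproj_sum gG x) [in RHS](gproj_sum gG x) mulmx_sumr.
  apply: eq_bigr => g _.
  rewrite -(pr_mulr 0 1%:M (gproj_in gG g x)) mul1mx add0r.
  by rewrite (gproj_id gG (gproj_in gG g x)).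
by rewrite (E 1%:M) mulmx1 (gproj_in gG).
Qed.

(** The trace of the degree 0 component also vanishes on commutators, so it is a multiple of the
    trace; the two agree at the identity, where N is nonzero in F. *)
Lemma gr_trace g x : x \in Gam g -> g != 0 -> \tr x = 0.
Proof.
move=> xg g0; pose tau y : F := \tr (pr 0 y).
have tauE y : tau y = \tr y.
  have tauF : forall y, tau y = \tr y * tau (delta_mx 0 0).
    apply: trace_functional => [c a b|a b].
      by rewrite /tau linearP linearD linearZ.
    rewrite /tau (gproj_sum gG a) mulmx_suml mulmx_sumr !linear_sum.
    apply: eq_bigr => h _ /=; have ah := gproj_in gG h a.
    rewrite -(subrr h) (pr_mull _ _ ah) [in RHS]addrC (pr_mulr _ _ ah).
    by rewrite mxtrace_mulC.
  have := tauF 1%:M; rewrite /tau (gproj_id gG gr1) mxtrace1.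
  rewrite -[X in X = _]mulr1 => /(mulfI (natf_neq0 m)) tau1.
  by rewrite -/(tau y) tauF /tau -tau1 mulr1.
by rewrite -tauE /tau (gproj_neq gG xg) 1?eq_sym // mxtrace0.
Qed.

(** The trace form is nondegenerate, and among homogeneous y only those of degree - g can give x y a
    nonzero trace. *)
Lemma gr_pair g x : x \in Gam g -> x != 0 ->
  exists2 y, y \in Gam (- g) & \tr (x *m y) != 0.
Proof.
move=> xg /mx_neq0[i [j xij]].
apply: contrapT => N; move/eqP: xij; apply.
rewrite -mxtrace_delta_mul (gproj_sum gG (delta_mx j i)) mulmx_sumr linear_sum.
rewrite big1 // => h _ /=; have hh := gproj_in gG h (delta_mx j i).
have [->|hg] := eqVneq h (- g).
  apply/eqP/negPn/negP => n0; apply: N.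
  by exists (pr (- g) (delta_mx j i)) => //; apply: (gproj_in gG).
apply: gr_trace (mulG xg hh) _.
by apply: contra_neq hg => /eqP; rewrite addrC addr_eq0 => /eqP.
Qed.

End Graded.
End MatrixGradings.

(* M is the algebra of k x k matrices over e M e with matrix units x_i y_j; Y_t is
   the inverse of X_t in e M e. Nothing is required of X, Y and b off T. *)
Record frame (F : fieldType) (H : zmodType) (N : nat)
    (Gam : H -> {vspace 'M[F]_N}) (T : {pred H}) (b : H -> H -> F) (k : nat)
    (gam : 'I_k -> H) := Frame {
  fr_e : 'M[F]_N;
  fr_x : 'I_k -> 'M[F]_N;
  fr_y : 'I_k -> 'M[F]_N;
  fr_X : H -> 'M[F]_N;
  fr_Y : H -> 'M[F]_N;
  fr_sum : \sum_i fr_x i *m fr_y i = 1%:M;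
  fr_orth : forall i j, fr_y i *m fr_x j = if i == j then fr_e else 0;
  fr_degx : forall i, fr_x i \in Gam (gam i);
  fr_degy : forall i, fr_y i \in Gam (- gam i);
  fr_degX : {in T, forall t, fr_X t \in Gam t};
  fr_degY : {in T, forall t, fr_Y t \in Gam (- t)};
  fr_eXe : {in T, forall t, fr_e *m fr_X t *m fr_e = fr_X t};
  fr_eYe : {in T, forall t, fr_e *m fr_Y t *m fr_e = fr_Y t};
  fr_XY : {in T, forall t, fr_X t *m fr_Y t = fr_e};
  fr_YX : {in T, forall t, fr_Y t *m fr_X t = fr_e};
  fr_comm : {in T &, forall s t,
    fr_X s *m fr_X t = b s t *: (fr_X t *m fr_X s)};
  fr_line : forall h a, a \in Gam h -> fr_e *m a *m fr_e = a -> a != 0 ->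
    h \in T /\ exists c, a = c *: fr_X h }.

Arguments fr_line {F H N Gam T b k gam} f {h a}.

(** * Existence of frames: minimal idempotents of degree 0 and their corners *)

Section FrameExistence.
Variables (F : closedFieldType) (charF : [pchar F] =i pred0).
Variables (m : nat) (H : zmodType).
Local Notation N := m.+1.
Local Notation M := 'M[F]_N.
Variables (Gam : H -> {vspace M}) (s : seq H) (pr : H -> 'End(M)).
Hypothesis gG : gproj Gam s pr.
Hypothesis mulG : forall g h x y,
  x \in Gam g -> y \in Gam h -> x *m y \in Gam (g + h).

Lemma mul0G x y : x \in Gam 0 -> y \in Gam 0 -> x *m y \in Gam 0.
Proof. by move=> x0 y0; rewrite -[0]addr0 mulG. Qed.

Lemma mulG_0 g x y : x \in Gam g -> y \in Gam 0 -> x *m y \in Gam g.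
Proof. by move=> x0 y0; rewrite -[g]addr0 mulG. Qed.

Lemma mul0_G g x y : x \in Gam 0 -> y \in Gam g -> x *m y \in Gam g.
Proof. by move=> x0 y0; rewrite -[g]add0r mulG. Qed.

Lemma horner_G0 z (p : {poly F}) : z \in Gam 0 -> horner_mx z p \in Gam 0.
Proof.
move=> z0; have g1 := gr1 gG mulG; elim/poly_ind: p => [|p c IH].
  by rewrite rmorph0 mem0v.
rewrite rmorphD rmorphM /= horner_mx_X horner_mx_C memvD ?mul0G //.
by rewrite -[c]mulr1 -scale_scalar_mx memvZ.
Qed.

Section Corner.
Variable e : M.
Hypotheses (e0 : e \in Gam 0) (ee : e *m e = e) (en0 : e != 0).
Hypothesis emin : forall f, f \in Gam 0 -> f *m f = f -> f != 0 ->
  (\rank e <= \rank f)%N.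

Lemma cornerl z : e *m z *m e = z -> e *m z = z.
Proof. by move=> <-; rewrite !mulmxA ee. Qed.

Lemma cornerr z : e *m z *m e = z -> z *m e = z.
Proof. by move=> <-; rewrite -!mulmxA ee. Qed.

(* The Fitting idempotent of z is nonzero, so it is e by minimality. *)
Lemma corner0_inv z : z \in Gam 0 -> e *m z *m e = z -> \tr z != 0 ->
  exists w, [/\ w \in Gam 0, e *m w *m e = w & z *m w = e].
Proof.
move=> z0 eze trz.
have ez := cornerl eze; have ze := cornerr eze.
(* The characteristic polynomial is X^k q with q(0) nonzero, and a Bezout relation between q and
   X^(k+1) gives the idempotent [P] = d(z) z^(k+1). The exponent k + 1 leaves a factor z in [P] even
   when k = 0; [W] is [P] without that factor. *)
have [k [q nq chiE]] := multiplicity_XsubC (char_poly z) 0.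
rewrite monic_neq0 ?char_poly_monic //= in nq; rewrite subr0 in chiE.
have /Bezout_coprimepP[[u d] /= /eqpP[[c1 c2] /andP[/= c10 c20] bez]] :
    coprimep q ('X ^+ k.+1).
  have := coprimep_XsubC q 0; rewrite subr0 nq => cX.
  exact: coprimep_expr cX.
pose D := horner_mx z ((c2^-1 * c1) *: d); pose P := D *m z ^+ k.+1.
have zE i : horner_mx z ('X ^+ i) = z ^+ i by rewrite rmorphXn /= horner_mx_X.
have PE : P = horner_mx z ((c2^-1 * c1) *: d * 'X ^+ k.+1) by rewrite rmorphM /= zE.
have P1 : 1%:M - P = horner_mx z ((c2^-1 * c1) *: u * q).
  rewrite PE; have -> : (c2^-1 * c1) *: u * q = 1 - (c2^-1 * c1) *: d * 'X^(k.+1).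
    have := congr1 (fun p => c2^-1 *: p) bez.
    rewrite !scalerA mulVf // scale1r scalerDr !scalerAl => <-.
    by rewrite addrK.
  by rewrite rmorphB !rmorph1.
have zkP : z ^+ k *m P = z ^+ k.
  apply/eqP; rewrite eq_sym -subr_eq0 -{1}[z ^+ k]mulmx1 -mulmxBr P1 -zE mulmxE.
  rewrite -rmorphM /= mulrCA (mulrC 'X^k) -chiE rmorphM /= Cayley_Hamilton.
  by rewrite mulr0.
have CP i : P *m z ^+ i = z ^+ i *m P.
  by rewrite PE -zE mulmxE -!rmorphM mulrC.
have PP : P *m P = P.
  by rewrite {1}/P exprS -mulmxE -!mulmxA zkP mulmxE -exprS.
have eh p : e *m horner_mx z p = horner_mx z p *m e by apply: comm_mx_horner; rewrite /comm_mx ez ze.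
pose f := e *m P.
have eP : e *m P = P *m e by rewrite PE eh.
have ff : f *m f = f.
  by rewrite /f -mulmxA (mulmxA P) -eP -(mulmxA e P) PP mulmxA ee.
(* Otherwise z would be nilpotent, against its nonzero trace. *)
have fn0 : f != 0.
  apply: contraNneq trz => f0; rewrite (nilp_trace (k := k.+1)) //.
  rewrite exprS -mulmxE -zkP -CP; have f0' : e *m P = 0 by [].
  have E : z *m (P *m z ^+ k) = z *m (e *m P) *m z ^+ k by rewrite !mulmxA ze.
  by rewrite E f0' mulmx0 mul0mx.
have f0 : f \in Gam 0 by rewrite mul0G // PE horner_G0.
have fe : f *m e = f by rewrite /f -mulmxA -eP mulmxA ee.
have /submxP[a ea] : (e <= f)%MS.
  have fsub : (f <= e)%MS by rewrite -fe submxMl.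
  by rewrite -(mxrank_leqif_sup fsub) eqn_leq mxrankS // emin.
have ef : e *m f = f by rewrite /f mulmxA ee.
have {}fe : f = e by rewrite -ef [in LHS]ea -mulmxA ff -ea.
pose W := D *m z ^+ k; have eW : e *m W = W *m e.
  by rewrite /W /D -zE mulmxE -rmorphM /=; apply: eh.
have zW : z *m W = P.
  rewrite /P /W exprS -mulmxE !mulmxA; congr (_ *m _).
  exact: comm_mx_horner (erefl (z *m z)).
exists (e *m W); split.
- by rewrite mul0G // mul0G // -?zE horner_G0.
- by rewrite mulmxA ee -mulmxA -eW mulmxA ee.
by rewrite mulmxA ze -ez -mulmxA zW -/f fe.
Qed.

(** A trace partner of x, cut down to the corner, has a product with x of degree 0 and nonzero
    trace, which [corner0_inv] inverts. *)
Lemma corner_inv g x : x \in Gam g -> e *m x *m e = x -> x != 0 ->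
  exists y, [/\ y \in Gam (- g), e *m y *m e = y & x *m y = e].
Proof.
move=> xg exe x0; have [y0 y0g trn0] := gr_pair charF gG mulG xg x0.
have eyg : e *m y0 *m e \in Gam (- g) by rewrite mulG_0 // mul0_G.
have [|||w [w0 ewe zw]] := @corner0_inv (x *m (e *m y0 *m e)).
- by rewrite -(subrr g) mulG.
- by rewrite !mulmxA (cornerl exe) -!mulmxA ee.
- by rewrite !mulmxA (cornerr exe) mxtrace_mulC !mulmxA (cornerl exe).
exists (e *m y0 *m e *m w); split; first by rewrite mulG_0.
- by rewrite !mulmxA ee -!mulmxA (cornerr ewe).
by rewrite mulmxA.
Qed.

(** Otherwise every z - c e is nonzero of degree 0, hence invertible in the corner, and so is their
    product over the roots of the characteristic polynomial of z, contrary to Cayley-Hamilton. *)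
Lemma corner0_scalar z : z \in Gam 0 -> e *m z *m e = z -> exists c, z = c *: e.
Proof.
move=> z0 eze; apply: contrapT => nc.
have inv c : exists y, e *m y *m e = y /\ (z - c *: e) *m y = e.
  have [||| y [_ eye ye]] := @corner_inv 0 (z - c *: e); last by exists y.
  - by rewrite memvB ?memvZ.
  - by rewrite mulmxBr mulmxBl eze -scalemxAr -scalemxAl !ee.
  - by apply: contra_not_neq nc => /eqP; rewrite subr_eq0 => /eqP->; exists c.
have [rs chiE] := closed_field_poly_normal (char_poly z).
have [y []] : exists y, e *m y *m e = y /\
    horner_mx z (\prod_(c <- rs) ('X - c%:P)) *m y = e.
  elim: rs {chiE} => [|c r [y [eye IH]]].
    by exists e; rewrite big_nil rmorph1 mul1mx !ee.
  have [y' [ey'e IH']] := inv c; exists (y *m y'); split.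
    by rewrite mulmxA (cornerl eye) -mulmxA (cornerr ey'e).
  rewrite big_cons rmorphM rmorphB /= horner_mx_X horner_mx_C -mulmxE.
  rewrite -mulmxA (mulmxA _ y) IH (cornerl ey'e) -[RHS]IH' !mulmxBl.
  by rewrite mul_scalar_mx -scalemxAl (cornerl ey'e).
have : horner_mx z (char_poly z) = 0 by apply: Cayley_Hamilton.
rewrite chiE (monicP (char_poly_monic z)) scale1r => -> _.
by rewrite mul0mx => /eqP; rewrite eq_sym (negPf en0).
Qed.

(** The product of x' with an inverse of x has degree 0, hence is a scalar multiple of e. *)
Lemma corner_line g x x' : x \in Gam g -> e *m x *m e = x -> x != 0 ->
  x' \in Gam g -> e *m x' *m e = x' -> exists c, x' = c *: x.
Proof.
move=> xg exe x0 x'g ex'e.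
have [y [yg eye xy]] := corner_inv xg exe x0.
have y0 : y != 0 by apply: contraNneq en0 => y0; rewrite -xy y0 mulmx0.
have [y' [_ ey'e yy']] := corner_inv yg eye y0.
have [||c cE] := @corner0_scalar (x' *m y).
- by rewrite -(subrr g) mulG.
- by rewrite mulmxA (cornerl ex'e) -mulmxA (cornerr eye).
exists c; rewrite -(cornerr ex'e) -(cornerr exe) -yy' !mulmxA cE xy.
by rewrite -scalemxAl.
Qed.

(** The right inverse y has a right inverse in turn, which must be x. *)
Lemma corner_unit g x : x \in Gam g -> e *m x *m e = x -> x != 0 ->
  exists y, [/\ y \in Gam (- g), e *m y *m e = y, x *m y = e & y *m x = e].
Proof.
move=> xg exe x0; have [y [yg eye xy]] := corner_inv xg exe x0.
have y0 : y != 0 by apply: contraNneq en0 => y0; rewrite -xy y0 mulmx0.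
have [y' [_ ey'e yy']] := corner_inv yg eye y0.
exists y; split=> //; suff -> : x = y' by [].
by rewrite -(cornerl ey'e) -xy -mulmxA yy' (cornerr exe).
Qed.

(** Copies of e are peeled off f by induction on its rank: a nonzero homogeneous x in f M e has a
    partner y in e M f with y x = e, and x y is then an idempotent below f. *)
Lemma matrix_units (f : M) : f \in Gam 0 -> f *m f = f ->
  exists k (x y : 'I_k -> M) (gam : 'I_k -> H),
    [/\ \sum_i x i *m y i = f,
        forall i j, y i *m x j = if i == j then e else 0,
        forall i, x i \in Gam (gam i) /\ y i \in Gam (- gam i)
      & forall i, f *m x i = x i /\ y i *m f = y i].
Proof.
have [d] := ubnP (\rank f); elim: d f => // d IH f; rewrite ltnS => rf f0 ff.
have [fz|fn0] := eqVneq f 0.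
  exists 0, (fun=> 0), (fun=> 0), (fun=> 0).
  by split=> [|[] | [] | []] //; rewrite big_ord0.
have [z zn0] : exists z, f *m z *m e != 0.
  have [i [j fij]] := mx_neq0 fn0; have [i' [j' eij]] := mx_neq0 en0.
  exists (delta_mx j i'); apply: contraNneq (mulf_neq0 fij eij) => E.
  by rewrite -mxprod_delta E mxE.
have [g gz] := gproj_neq0 gG zn0.
pose x := pr g (f *m z *m e); have xg : x \in Gam g := gproj_in gG g _.
have fx : f *m x = x.
  by rewrite /x -(pr_mull gG mulG g _ f0) add0r !mulmxA ff.
have xe : x *m e = x.
  by rewrite /x -(pr_mulr gG mulG g _ e0) addr0 -!mulmxA ee.
have [y0 y0g trn0] := gr_pair charF gG mulG xg gz.
pose y1 := e *m y0 *m f.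
have y1g : y1 \in Gam (- g) by rewrite mulG_0 // mul0_G.
have ey1 : e *m y1 = y1 by rewrite /y1 !mulmxA ee.
have [||c cE] := @corner0_scalar (y1 *m x).
- by rewrite -(addNr g) mulG.
- by rewrite mulmxA ey1 -mulmxA xe.
(* [y1 *m x] has the trace of [x *m y0], which is nonzero. *)
have c0 : c != 0.
  apply: contraNneq trn0 => c0; move: cE; rewrite c0 scale0r => cE.
  rewrite mxtrace_mulC -fx mulmxA -xe [X in \tr X]mulmxA mxtrace_mulC.
  by rewrite !mulmxA cE mxtrace0.
pose y := c^-1 *: y1; have yg : y \in Gam (- g) by rewrite memvZ.
have ey : e *m y = y by rewrite -scalemxAr ey1.
have yf : y *m f = y by rewrite -scalemxAl -mulmxA ff.
have yx : y *m x = e by rewrite -scalemxAl cE scalerA mulVf // scale1r.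
pose f' := f - x *m y.
have ff' : f *m f' = f' by rewrite mulmxBr ff mulmxA fx.
have f'f : f' *m f = f' by rewrite mulmxBl ff -mulmxA yf.
have f'x : f' *m x = 0 by rewrite mulmxBl fx -mulmxA yx xe subrr.
have yf' : y *m f' = 0 by rewrite mulmxBr yf mulmxA yx ey subrr.
have f'f' : f' *m f' = f' by rewrite {2}/f' mulmxBr f'f mulmxA f'x mul0mx subr0.
have f'0 : f' \in Gam 0 by rewrite memvB // -(subrr g) mulG.
have rf' : (\rank f' < d)%N.
  apply: leq_trans rf; have fsub : (f' <= f)%MS by rewrite -f'f submxMl.
  rewrite ltn_neqAle mxrankS // andbT.
  rewrite (mxrank_leqif_sup fsub); apply: contraNN gz => /submxP[a fa].
  by rewrite -/x -fx fa -mulmxA f'x mulmx0.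
have [k [xs [ys [gam [sumE orth deg fix_]]]]] := IH f' rf' f'0 f'f'.
have fixx i : f' *m xs i = xs i by case: (fix_ i).
have fixy i : ys i *m f' = ys i by case: (fix_ i).
exists k.+1, (fun i => oapp xs x (unlift ord0 i)),
  (fun i => oapp ys y (unlift ord0 i)), (fun i => oapp gam g (unlift ord0 i)).
split.
- rewrite big_ord_recl unlift_none /=.
  under eq_bigr do rewrite liftK /=.
  by rewrite sumE addrC subrK.
- move=> i j; case: unliftP => [i' ->|->]; case: unliftP => [j' ->|->] /=.
  + by rewrite orth (inj_eq lift_inj).
  + by rewrite -fixy -mulmxA f'x mulmx0.
  + by rewrite -fixx mulmxA yf' mul0mx.
  exact: yx.
- by move=> i; case: unliftP => [i' _|_] /=.
move=> i; case: unliftP => [i' _|_] /=; last by rewrite fx yf.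
by rewrite -fixx mulmxA ff' -fixy -mulmxA f'f.
Qed.
End Corner.

Lemma frame_exists : exists k (gam : 'I_k -> H) (T : {pred H}) b,
  inhabited (frame Gam T b gam).
Proof.
have g1 := gr1 gG mulG.
pose idem f := [/\ f \in Gam 0, f *m f = f & f != 0].
pose hasr r := `[< exists f, idem f /\ \rank f = r >].
have ex : exists r, hasr r.
  exists (\rank (1%:M : M)); apply/asboolP; exists 1%:M; split=> //.
  by split; rewrite ?mul1mx // -mxrank_eq0 mxrank1.
case: (ex_minnP ex) => _ /asboolP[e [[e0 ee en0] <-]] emin0.
have emin f : f \in Gam 0 -> f *m f = f -> f != 0 -> (\rank e <= \rank f)%N.
  by move=> f0 ff fn0; apply: emin0; apply/asboolP; exists f.
have [k [x [y [gam [sumE orth deg _]]]]] :=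
  matrix_units e0 ee en0 emin g1 (mul1mx _).
pose P h a := [/\ a \in Gam h, e *m a *m e = a & a != 0].
pose T : {pred H} := fun h => `[< exists a, P h a >].
have /choice[X XP] : forall h, exists a, h \in T -> P h a.
  by move=> h; have [/asboolP[a Pa]|] := boolP (h \in T); [exists a | exists 0].
have /choice[Y YP] : forall h, exists a, h \in T ->
    [/\ a \in Gam (- h), e *m a *m e = a, X h *m a = e & a *m X h = e].
  move=> h; have [hT|] := boolP (h \in T); last by exists 0.
  have [Xg eXe X0] := XP h hT.
  by have [a aP] := corner_unit e0 ee en0 emin Xg eXe X0; exists a.
have prodn0 h h' : h \in T -> h' \in T -> X h *m X h' != 0.
  move=> hT h'T; apply: contraNneq en0 => E.
  have [_ _ XY _] := YP _ h'T; have [_ eYe' XY' _] := YP _ hT.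
  have [_ eXe _] := XP _ hT.
  by rewrite -XY' -[X h](cornerr ee eXe) -XY mulmxA E !mul0mx.
have prodP h h' : h \in T -> h' \in T ->
    X h *m X h' \in Gam (h + h') /\ e *m (X h *m X h') *m e = X h *m X h'.
  move=> hT h'T; have [Xg eXe _] := XP _ hT; have [Xg' eXe' _] := XP _ h'T.
  by rewrite mulG // !mulmxA (cornerl ee eXe) -mulmxA (cornerr ee eXe').
have /choice[b bP] : forall hh : H * H, exists c, hh.1 \in T -> hh.2 \in T ->
    X hh.1 *m X hh.2 = c *: (X hh.2 *m X hh.1).
  move=> [h h'] /=; have [hT|] := boolP (h \in T); last by exists 0.
  have [h'T|] := boolP (h' \in T); last by exists 0.
  have [p1 p2] := prodP _ _ h'T hT; have [q1 q2] := prodP _ _ hT h'T.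
  rewrite addrC in p1.
  have [c cE] := corner_line e0 ee en0 emin p1 p2 (prodn0 _ _ h'T hT) q1 q2.
  by exists c.
exists k, gam, T, (fun h h' => b (h, h')); apply: inhabits.
exists e x y X Y => //.
- by move=> i; case: (deg i).
- by move=> i; case: (deg i).
- by move=> t /XP[].
- by move=> t /YP[].
- by move=> t /XP[].
- by move=> t /YP[].
- by move=> t /YP[].
- by move=> t /YP[].
- by move=> h h' hT h'T; apply: (bP (h, h')).
move=> h a ag eae a0; have hT : h \in T by apply/asboolP; exists a.
split=> //; have [Xg eXe X0] := XP h hT.
have [c cE] := corner_line e0 ee en0 emin Xg eXe X0 ag eae.
by exists c.
Qed.
End FrameExistence.

(** * Consequences of a frame: support, commutation factor, Peirce decomposition *)

Section FrameTheory.
Variables (F : closedFieldType) (charF : [pchar F] =i pred0).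
Variables (m : nat) (H : zmodType).
Local Notation N := m.+1.
Local Notation M := 'M[F]_N.
Variables (Gam : H -> {vspace M}) (s : seq H) (pr : H -> 'End(M)).
Hypothesis gG : gproj Gam s pr.
Hypothesis mulG : forall g h x y,
  x \in Gam g -> y \in Gam h -> x *m y \in Gam (g + h).
Variables (T : {pred H}) (b : H -> H -> F) (k : nat) (gam : 'I_k -> H).
Variable fr : frame Gam T b gam.
Local Notation e := (fr_e fr).
Local Notation x := (fr_x fr).
Local Notation y := (fr_y fr).
Local Notation X := (fr_X fr).
Local Notation Y := (fr_Y fr).

Lemma fr_k_gt0 : (0 < k)%N.
Proof.
rewrite lt0n; apply/eqP => k0; have := fr_sum fr.
rewrite big1 => [/eqP|i _]; first by rewrite eq_sym oner_eq0.
by have := leq_trans (ltn_ord i) (eq_leq k0); rewrite ltn0.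
Qed.

Lemma fr_xe i : x i *m e = x i.
Proof.
rewrite -[RHS]mul1mx -(fr_sum fr) mulmx_suml (bigD1 i) //= big1 => [|j ji].
  by rewrite addr0 -mulmxA fr_orth eqxx.
by rewrite -mulmxA fr_orth (negPf ji) mulmx0.
Qed.

Lemma fr_ey i : e *m y i = y i.
Proof.
rewrite -[RHS]mulmx1 -(fr_sum fr) mulmx_sumr (bigD1 i) //= big1 => [|j ji].
  by rewrite addr0 mulmxA fr_orth eqxx.
by rewrite mulmxA fr_orth eq_sym (negPf ji) mul0mx.
Qed.

Lemma fr_ee : e *m e = e.
Proof.
pose i := Ordinal fr_k_gt0.
by have := fr_orth fr i i; rewrite eqxx => {1 3}<-; rewrite -mulmxA fr_xe.
Qed.

Lemma fr_eX t : t \in T -> e *m X t = X t.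
Proof. by move=> tT; rewrite -(fr_eXe fr tT) !mulmxA fr_ee. Qed.

Lemma fr_Xe t : t \in T -> X t *m e = X t.
Proof. by move=> tT; rewrite -(fr_eXe fr tT) -!mulmxA fr_ee. Qed.

Lemma fr_eY t : t \in T -> e *m Y t = Y t.
Proof. by move=> tT; rewrite -(fr_eYe fr tT) !mulmxA fr_ee. Qed.

Lemma fr_Ye t : t \in T -> Y t *m e = Y t.
Proof. by move=> tT; rewrite -(fr_eYe fr tT) -!mulmxA fr_ee. Qed.

(** Each x_i y_i has the trace of y_i x_i = e, and together they sum to the identity. *)
Lemma fr_tre : k%:R * \tr e = N%:R.
Proof.
transitivity (\sum_(i < k) \tr e); first by rewrite sumr_const card_ord mulr_natl.
rewrite -(mxtrace1 F N) -(fr_sum fr) linear_sum; apply: eq_bigr => i _ /=.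
by rewrite mxtrace_mulC fr_orth eqxx.
Qed.

Lemma fr_tre_neq0 : \tr e != 0.
Proof.
apply/eqP => t0; have /eqP := fr_tre.
by rewrite t0 mulr0 eq_sym (negPf (natf_neq0 charF _)).
Qed.

Lemma fr_e_neq0 : e != 0.
Proof. apply/eqP => e0; have /eqP := fr_sum fr; rewrite big1 => [|i _].
  by rewrite eq_sym oner_eq0.
by rewrite -fr_xe e0 mulmx0 mul0mx. Qed.

Lemma fr_e0 : e \in Gam 0.
Proof.
pose i := Ordinal fr_k_gt0; have := fr_orth fr i i; rewrite eqxx => <-.
by rewrite -(addNr (gam i)) mulG ?fr_degx ?fr_degy.
Qed.

Lemma fr_X_neq0 t : t \in T -> X t != 0.
Proof. by move=> tT; apply: contraNneq fr_e_neq0 => X0; rewrite -(fr_XY fr tT) X0 mul0mx. Qed.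

Lemma fr_prod_neq0 t t' : t \in T -> t' \in T -> X t *m X t' != 0.
Proof.
move=> tT t'T; apply: contraNneq fr_e_neq0 => E.
by rewrite -(fr_XY fr tT) -[X t](fr_Xe tT) -(fr_XY fr t'T) mulmxA E !mul0mx.
Qed.

Lemma fr_line_T h a : a \in Gam h -> e *m a = a -> a *m e = a -> a != 0 -> h \in T.
Proof. by move=> ag ea ae a0; have [] := fr_line fr ag _ a0; rewrite ?ea. Qed.

Lemma fr_line_X h a : a \in Gam h -> e *m a = a -> a *m e = a ->
  h \in T -> exists c, a = c *: X h.
Proof.
move=> ag ea ae hT; have [->|a0] := eqVneq a 0; first by exists 0; rewrite scale0r.
by have [|//] := fr_line fr ag _ a0; rewrite ea.
Qed.

Lemma fr_T0 : 0 \in T.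
Proof. by apply: fr_line_T fr_e0 _ _ fr_e_neq0; rewrite fr_ee. Qed.

Lemma fr_TD t t' : t \in T -> t' \in T -> t + t' \in T.
Proof.
move=> tT t'T; apply: fr_line_T (fr_prod_neq0 tT t'T).
- by rewrite mulG ?(fr_degX fr).
- by rewrite mulmxA fr_eX.
by rewrite -mulmxA fr_Xe.
Qed.

Lemma fr_TN t : t \in T -> - t \in T.
Proof.
move=> tT; have Y0 : Y t != 0.
  by apply: contraNneq fr_e_neq0 => Y0; rewrite -(fr_YX fr tT) Y0 mul0mx.
by apply: fr_line_T (fr_degY fr tT) _ _ Y0; rewrite ?fr_eY ?fr_Ye.
Qed.

Lemma fr_TB t t' : t \in T -> t' \in T -> t - t' \in T.
Proof. by move=> tT t'T; rewrite fr_TD ?fr_TN. Qed.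

Lemma fr_XX t t' : t \in T -> t' \in T ->
  exists2 c, c != 0 & X t *m X t' = c *: X (t + t').
Proof.
move=> tT t'T; have [|||| c cE] := @fr_line_X (t + t') (X t *m X t').
- by rewrite mulG ?(fr_degX fr).
- by rewrite mulmxA fr_eX.
- by rewrite -mulmxA fr_Xe.
- exact: fr_TD.
exists c => //; apply: contraNneq (fr_prod_neq0 tT t'T) => c0.
by rewrite cE c0 scale0r.
Qed.

Lemma fr_b_uniq t t' c : t \in T -> t' \in T ->
  X t *m X t' = c *: (X t' *m X t) -> c = b t t'.
Proof.
move=> tT t'T E; apply/eqP; rewrite -subr_eq0 -(scale1r (X t' *m X t)) in E *.
have := fr_prod_neq0 t'T tT; apply: contraNT => cb.
have : (c - b t t') *: (X t' *m X t) = 0.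
  by rewrite scalerBl -(fr_comm fr tT t'T) E scale1r subrr.
by move/eqP; rewrite scaler_eq0 (negPf cb).
Qed.

Lemma fr_b_neq0 t t' : t \in T -> t' \in T -> b t t' != 0.
Proof.
move=> tT t'T; apply: contraNneq (fr_prod_neq0 tT t'T) => b0.
by rewrite fr_comm // b0 scale0r.
Qed.

Lemma fr_bC t t' : t \in T -> t' \in T -> b t t' * b t' t = 1.
Proof.
move=> tT t'T; have E := fr_comm fr tT t'T.
rewrite (fr_comm fr t'T tT) scalerA in E.
have : (b t t' * b t' t - 1) *: (X t *m X t') = 0.
  by rewrite scalerBl scale1r -E subrr.
by move/eqP; rewrite scaler_eq0 subr_eq0 (negPf (fr_prod_neq0 tT t'T)) orbF => /eqP.
Qed.

Lemma fr_b_alt t : t \in T -> b t t = 1.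
Proof. by move=> tT; rewrite -(@fr_b_uniq t t 1) ?scale1r. Qed.

Lemma fr_bDr t u v : t \in T -> u \in T -> v \in T ->
  b t (u + v) = b t u * b t v.
Proof.
move=> tT uT vT; have [c c0 cE] := fr_XX uT vT.
apply/esym/fr_b_uniq => //; first exact: fr_TD.
apply: (scalerI c0); rewrite scalemxAr -cE mulmxA (fr_comm fr tT uT).
rewrite -scalemxAl -mulmxA (fr_comm fr tT vT) -scalemxAr mulmxA.
by rewrite cE -scalemxAl !scalerA mulrC.
Qed.

Lemma fr_bDl t u v : t \in T -> u \in T -> v \in T ->
  b (u + v) t = b u t * b v t.
Proof.
move=> tT uT vT; have uvT := fr_TD uT vT.
apply: (mulIf (fr_b_neq0 tT uvT)); rewrite fr_bC // fr_bDr //.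
by rewrite mulrACA (fr_bC uT tT) (fr_bC vT tT) mulr1.
Qed.

(** Peirce decomposition: y_i A x_j is a homogeneous element of the corner, hence a multiple of an
    X. *)
Lemma fr_span h A : A \in Gam h -> exists c : 'I_k -> 'I_k -> F,
  (forall i j, c i j != 0 -> h - gam i + gam j \in T) /\
  A = \sum_i \sum_j c i j *: (x i *m X (h - gam i + gam j) *m y j).
Proof.
move=> Ah.
have /choice[c cP] : forall ij : 'I_k * 'I_k, exists c,
    (c != 0 -> h - gam ij.1 + gam ij.2 \in T) /\
    y ij.1 *m A *m x ij.2 = c *: X (h - gam ij.1 + gam ij.2).
  move=> [i j] /=; have deg : y i *m A *m x j \in Gam (h - gam i + gam j).
    by rewrite mulG ?fr_degx // [h - _]addrC mulG ?fr_degy.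
  have [->|n0] := eqVneq (y i *m A *m x j) 0.
    by exists 0; rewrite eqxx scale0r.
  have [|hT [c cE]] := fr_line fr deg _ n0; last by exists c.
  by rewrite !mulmxA fr_ey -!mulmxA fr_xe.
exists (fun i j => c (i, j)); split=> [i j|]; first by case: (cP (i, j)).
rewrite -[LHS]mul1mx -[LHS]mulmx1 -(fr_sum fr) mulmx_suml mulmx_suml.
apply: eq_bigr => i _; rewrite mulmx_sumr; apply: eq_bigr => j _.
have [_ /= cE] := cP (i, j).
by rewrite -!mulmxA (mulmxA (y i)) (mulmxA _ (x j)) cE -scalemxAl -scalemxAr mulmxA.
Qed.

Lemma fr_ind (P : M -> Prop) :
  P 0 -> (forall c A B, P A -> P B -> P (c *: A + B)) ->
  (forall i j t, t \in T -> P (x i *m X t *m y j)) -> forall A, P A.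
Proof.
move=> P0 PL PX A.
have PD B C : P B -> P C -> P (B + C) by move=> PB PC; rewrite -[B]scale1r; apply: PL.
rewrite (gproj_sum gG A); elim/big_ind: _ => // g _.
have [c [cT ->]] := fr_span (gproj_in gG g A).
elim/big_ind: _ => // i _; elim/big_ind: _ => // j _.
have [->|c0] := eqVneq (c i j) 0; first by rewrite scale0r.
by rewrite -[_ *: _]addr0; apply: PL => //; apply: PX; apply: cT.
Qed.

Lemma fr_degE i j t : t \in T ->
  x i *m X t *m y j \in Gam (gam i - gam j + t).
Proof. by move=> tT; rewrite addrAC !mulG ?fr_degx ?fr_degy ?(fr_degX fr). Qed.

(** In terms of M_k(D) this is the scalar matrix with X_t along the diagonal. *)
Definition fr_hat (t : H) : M := \sum_i x i *m X t *m y i.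

Lemma fr_yhat i t : t \in T -> y i *m fr_hat t = X t *m y i.
Proof.
move=> tT; rewrite mulmx_sumr (bigD1 i) //= big1 => [|j ji].
  by rewrite addr0 !mulmxA fr_orth eqxx fr_eX.
by rewrite !mulmxA fr_orth eq_sym (negPf ji) !mul0mx.
Qed.

Lemma fr_hatx i t : t \in T -> fr_hat t *m x i = x i *m X t.
Proof.
move=> tT; rewrite mulmx_suml (bigD1 i) //= big1 => [|j ji].
  by rewrite addr0 -!mulmxA fr_orth eqxx fr_Xe.
by rewrite -!mulmxA fr_orth (negPf ji) !mulmx0.
Qed.

Lemma fr_hat_comm t u i j : t \in T -> u \in T ->
  fr_hat t *m (x i *m X u *m y j) = b t u *: ((x i *m X u *m y j) *m fr_hat t).
Proof.
move=> tT uT; rewrite !mulmxA fr_hatx // -(mulmxA _ (y j)) fr_yhat //.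
rewrite -(mulmxA (x i) (X t) (X u)) (fr_comm fr tT uT) -scalemxAr -scalemxAl.
by rewrite !mulmxA.
Qed.

Lemma fr_hat_deg t : t \in T -> fr_hat t \in Gam t.
Proof.
move=> tT; apply: memv_suml => i _; have := fr_degE i i tT.
by rewrite subrr add0r.
Qed.

Lemma fr_hat_neq0 t : t \in T -> fr_hat t != 0.
Proof.
move=> tT; pose i := Ordinal fr_k_gt0.
apply: contraNN (fr_X_neq0 tT) => /eqP h0; apply/eqP.
have := fr_yhat i tT; rewrite h0 mulmx0 => /(congr1 (mulmx^~ (x i))).
by rewrite mul0mx -mulmxA fr_orth eqxx fr_Xe // => ->.
Qed.

(** If b t _ is trivial, [fr_hat t] is central, so it is a scalar matrix and has degree 0; but it is
    nonzero of degree t. *)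
Lemma fr_nondeg t : t \in T -> {in T, forall u, b t u = 1} -> t = 0.
Proof.
move=> tT b1; have C A : fr_hat t *m A = A *m fr_hat t.
  elim/fr_ind: A => [|c A B AC BC|i j u uT]; first by rewrite mulmx0 mul0mx.
    by rewrite mulmxDr mulmxDl -scalemxAl -scalemxAr AC BC.
  by rewrite fr_hat_comm // b1 // scale1r.
apply/esym/(gproj_inj gG _ (fr_hat_deg tT)); last exact: fr_hat_neq0.
rewrite (central_scalar C) -[_ 0 0]mulr1 -scale_scalar_mx memvZ //.
exact: gr1 gG mulG.
Qed.

Lemma fr_T_finite : exists2 r : seq H, uniq r & T =i r.
Proof.
exists [seq t <- undup s | t \in T]; first by rewrite filter_uniq ?undup_uniq.
move=> t; rewrite mem_filter mem_undup; case: (boolP (t \in T)) => //= tT.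
by rewrite (gproj_supp gG (fr_degX fr tT) (fr_X_neq0 tT)).
Qed.

Lemma fr_nondeg_alt_bichar : nondeg_alt_bichar T b.
Proof.
split; last exact: fr_nondeg; last exact: fr_b_alt.
split=> t tT; split=> [u uT|u v uT vT]; by [apply: fr_b_neq0 | apply: fr_bDr | apply: fr_bDl].
Qed.

End FrameTheory.

(** Translation by s0 permutes S and multiplies the sum by f s0. *)
Lemma char_sum0 (F : fieldType) (H : zmodType) (S : {pred H}) (r : seq H)
    (f : H -> F) (s0 : H) :
  uniq r -> S =i r -> is_subgroup S ->
  {in S &, forall s t, f (s + t) = f s * f t} ->
  s0 \in S -> f s0 != 1 -> \sum_(s <- r) f s = 0.
Proof.
move=> ur Sr [S0 SB] fM s0S fs0.
have SN s : s \in S -> - s \in S by move=> sS; rewrite -sub0r SB.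
have SD s t : s \in S -> t \in S -> s + t \in S.
  by move=> sS tS; rewrite -[t]opprK SB // SN.
have pr : perm_eq r (map (+%R s0) r).
  apply: uniq_perm => //; first by rewrite map_inj_uniq // => a b /addrI.
  move=> s; rewrite -Sr; apply/idP/mapP => [sS|[t tr ->]].
    by exists (s - s0); rewrite -?Sr ?SB // addrC subrK.
  by rewrite SD // Sr.
have E : \sum_(s <- r) f s = f s0 * \sum_(s <- r) f s.
  rewrite {1}(perm_big _ pr) big_map mulr_sumr big_seq [RHS]big_seq.
  by apply: eq_bigr => s sr; rewrite fM // Sr.
apply/eqP; have /eqP : (f s0 - 1) * \sum_(s <- r) f s = 0.
  by rewrite mulrBl -E mul1r subrr.
by rewrite mulf_eq0 subr_eq0 (negPf fs0).
Qed.

(** * Common eigenvectors, and characters realised by the commutation factor *)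

Section Eigen.
Variables (F : closedFieldType) (m : nat).
Local Notation N := m.+1.
Local Notation M := 'M[F]_N.

(** The factors f - c of the characteristic polynomial, applied one after another to a nonzero
    vector of U, end in 0 by Cayley-Hamilton, so one of them kills a nonzero vector of U on the
    way. *)
Lemma eigen_stable (f : 'End(M)) (U : {vspace M}) :
  U != 0%VS -> (forall v, v \in U -> f v \in U) ->
  exists c v, [/\ v \in U, v != 0 & f v = c *: v].
Proof.
move=> U0 fU; pose A : 'M[F]_((m + m * m.+1).+1) := lin_mx f.
have fA v : (mxvec (f v) : 'rV_((m + m * m.+1).+1)) = mxvec v *m A.
  exact: esym (mul_vec_lin f v).
have [rs chiE] := closed_field_poly_normal (char_poly A).
have vU : vpick U \in U by apply: memv_pick.
have v0 : vpick U != 0 by rewrite vpick0.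
have : (mxvec (vpick U) : 'rV_((m + m * m.+1).+1))
    *m horner_mx A (\prod_(c <- rs) ('X - c%:P)) = 0.
  have := Cayley_Hamilton A; rewrite {1}chiE (monicP (char_poly_monic A)) scale1r.
  by move=> ->; rewrite mulmx0.
elim: rs {chiE} (vpick U) vU v0 => [|c r IH] v vU v0.
  rewrite big_nil rmorph1 mulmx1 => E; have /eqP : mxvec v = 0 := E.
  by rewrite mxvec_eq0 (negPf v0).
rewrite big_cons rmorphM rmorphB /= horner_mx_X horner_mx_C -mulmxE mulmxA.
have -> : (mxvec v : 'rV_((m + m * m.+1).+1)) *m (A - c%:M) = mxvec (f v - c *: v).
  rewrite mulmxBr -fA mul_mx_scalar.
  by rewrite [RHS]linearB [in RHS]linearZ.
move=> E.
have [/eqP|n0] := eqVneq (f v - c *: v) 0.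
  by rewrite subr_eq0 => /eqP fv; exists c, v.
by apply: IH E => //; rewrite memvB ?fU ?memvZ.
Qed.

(** Induction on dim U: either every operator is scalar on U, or some operator has a proper nonzero
    eigenspace in U, which commutation makes stable under the others. *)
Lemma common_eigen (I : Type) (D : I -> Prop) (f : I -> 'End(M)) (U : {vspace M}) :
  U != 0%VS -> (forall i, D i -> forall v, v \in U -> f i v \in U) ->
  (forall i j, D i -> D j -> forall v, v \in U -> f i (f j v) = f j (f i v)) ->
  exists v, [/\ v \in U, v != 0 & forall i, D i -> exists c, f i v = c *: v].
Proof.
have [d] := ubnP (\dim U); elim: d U => // d IH U; rewrite ltnS => dU U0 fU fC.
have [sc|] := pselect (forall i, D i -> exists c, forall v, v \in U -> f i v = c *: v).
  exists (vpick U); rewrite memv_pick vpick0; split=> // i /sc[c cE].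
  by exists c; rewrite cE ?memv_pick.
move/existsNP => [i /not_implyP[Di nsc]].
have [c [w [wU w0 fw]]] := eigen_stable U0 (fU i Di).
pose W := (U :&: lker (f i - c *: \1%VF))%VS.
have inW v : (v \in W) = (v \in U) && (f i v == c *: v).
  by rewrite memv_cap memv_ker !lfun_simp subr_eq0.
have [||||v [vW v0 vE]] := IH W.
- apply: leq_trans dU; rewrite ltn_neqAle dimvS ?capvSl // andbT.
  apply: contra_notN nsc => /eqP dW; exists c => v vU.
  have : W == U by rewrite eqEdim capvSl dW leqnn.
  by move/eqP => WU; move: vU; rewrite -WU inW => /andP[_ /eqP].
- by apply: contraNneq w0 => W0; rewrite -memv0 -W0 inW wU fw eqxx.
- move=> j Dj v; rewrite !inW => /andP[vU /eqP fv].
  by rewrite fU //= fC // fv linearZ.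
- move=> j l Dj Dl v; rewrite inW => /andP[vU _]; exact: fC.
by exists v; split=> //; move: vW; rewrite inW => /andP[].
Qed.
End Eigen.

Section Characters.
Variables (F : closedFieldType) (charF : [pchar F] =i pred0).
Variables (m : nat) (H : zmodType).
Local Notation N := m.+1.
Local Notation M := 'M[F]_N.
Variables (Gam : H -> {vspace M}) (s : seq H) (pr : H -> 'End(M)).
Hypothesis gG : gproj Gam s pr.
Hypothesis mulG : forall g h x y,
  x \in Gam g -> y \in Gam h -> x *m y \in Gam (g + h).
Variables (T : {pred H}) (b : H -> H -> F) (k : nat) (gam : 'I_k -> H).
Variable fr : frame Gam T b gam.

Lemma fr_T_subgroup : is_subgroup T.
Proof.
split; first exact: (fr_T0 mulG fr).
by move=> t u tT uT; apply: (fr_TB mulG fr).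
Qed.

(* If no t worked, both inner sums of \sum_t \sum_s chi(s)^-1 b(t,s) would give
   0 = |T|. *)
Lemma fr_char_ext (S : {pred H}) (chi : H -> F) :
  {subset S <= T} -> is_subgroup S -> is_char S chi ->
  exists2 t, t \in T & {in S, forall u, b t u = chi u}.
Proof.
move=> ST [S0 SB] [chi0 chiM]; have TG := fr_T_subgroup.
have [r ur Tr] := fr_T_finite gG fr.
pose rS := [seq u <- r | u \in S]; have urS : uniq rS by rewrite filter_uniq.
have SrS : S =i rS.
  by move=> u; rewrite mem_filter -Tr; case: (boolP (u \in S)) => // /ST ->.
have bDr := fr_bDr mulG fr; have bDl := fr_bDl mulG fr.
apply: contrapT => N.
have : \sum_(t <- r) \sum_(u <- rS) (chi u)^-1 * b t u = 0.
  rewrite big_seq big1 // => t; rewrite -Tr => tT.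
  have [u0 u0S u0n] : exists2 u, u \in S & b t u != chi u.
    apply: contrapT => N'; apply: N; exists t => // u uS.
    by apply/eqP/negPn/negP => n; apply: N'; exists u.
  apply: (char_sum0 urS SrS _ _ u0S) => //.
    move=> u v uS vS; have [uT vT] := (ST _ uS, ST _ vS).
    by rewrite chiM // bDr // invfM mulrACA.
  apply: contra_neq u0n => E; rewrite -[RHS]mulr1 -E mulVKf //.
  exact: chi0.
rewrite exchange_big /= (bigD1_seq 0) //=; last by rewrite -SrS.
rewrite [X in _ + X]big_seq_cond [X in _ + X]big1 ?addr0; last first.
  move=> u /andP[]; rewrite -SrS => /ST uT u0; rewrite -mulr_sumr.
  rewrite (_ : \sum_(t <- r) b t u = 0) ?mulr0 //.
  have [t0 t0T t0n] : exists2 t, t \in T & b u t != 1.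
    apply: contrapT => N'; move/eqP: u0; apply.
    apply: (fr_nondeg gG mulG fr uT) => t tT.
    by apply/eqP/negPn/negP => n; apply: N'; exists t.
  apply: (char_sum0 ur Tr TG (s0 := t0)) => //.
    by move=> t t' tT t'T; apply: bDl.
  apply: contra_neq t0n => E; have := fr_bC fr uT t0T.
  by rewrite E mulr1.
have chi1 : chi 0 = 1.
  by apply: (mulfI (chi0 0 S0)); rewrite -chiM // addr0 mulr1.
have T0 := TG.1; under eq_big_seq => t tr.
  rewrite chi1 invr1 mul1r (_ : b t 0 = 1).
  over.
  have tT : t \in T by rewrite Tr.
  have b0 := fr_b_neq0 fr tT T0.
  by apply: (mulfI b0); rewrite -bDr // addr0 mulr1.
rewrite big_const_seq count_predT iter_addr_0 => /eqP.
have : 0 \in r by rewrite -Tr.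
by case: (r) => // a r' _; rewrite (negPf (natf_neq0 charF _)).
Qed.
End Characters.

(** * Comparison of frames *)

Section TwoFrames.
Variables (F : closedFieldType) (charF : [pchar F] =i pred0).
Variables (m : nat) (H : zmodType).
Local Notation N := m.+1.
Local Notation M := 'M[F]_N.

(* The operators z |-> X'_t z Y_t commute on e' M e because both families of X's
   have the same commutation factor; a common eigenvector z intertwines X and X'
   up to scalars, and Z := \sum_i x'_i z y_i does the rest. *)
Lemma frames_conj (Gam Gam' : H -> {vspace M}) s s' pr pr'
    (gG : gproj Gam s pr) (gG' : gproj Gam' s' pr')
    (mulG : forall g h x y, x \in Gam g -> y \in Gam h -> x *m y \in Gam (g + h))
    (mulG' : forall g h x y,
      x \in Gam' g -> y \in Gam' h -> x *m y \in Gam' (g + h))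
    (T : {pred H}) (b : H -> H -> F) (k : nat) (gam gam' : 'I_k -> H)
    (fr : frame Gam T b gam) (fr' : frame Gam' T b gam') :
  (forall i j, gam i - gam j = gam' i - gam' j) ->
  exists2 Z : M, Z \in unitmx
    & forall h A, A \in Gam h -> Z *m A *m invmx Z \in Gam' h.
Proof.
move=> gamE; pose e := fr_e fr; pose e' := fr_e fr'.
pose x := fr_x fr; pose y := fr_y fr; pose X := fr_X fr; pose Y := fr_Y fr.
pose x' := fr_x fr'; pose y' := fr_y fr'; pose X' := fr_X fr'.
have ee : e *m e = e by apply: fr_ee.
have ee' : e' *m e' = e' by apply: fr_ee.
have cornerL : linear (fun z : M => e' *m z *m e).
  by move=> c z z'; rewrite mulmxDr mulmxDl -scalemxAr -scalemxAl.
pose corner : {linear M -> M} := HB.pack (fun z : M => e' *m z *m e)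
  (GRing.isLinear.Build F M M _ _ cornerL).
pose U := limg (linfun corner).
have inU z : (z \in U) = (e' *m z *m e == z).
  apply/memv_imgP/eqP => [[z0 _ ->]|<-]; last by exists z; rewrite ?memvf // lfunE.
  by rewrite lfunE /= !mulmxA ee' -!mulmxA ee.
have U0 : U != 0%VS.
  have [i [j eij]] := mx_neq0 (fr_e_neq0 fr).
  have [i' [j' eij']] := mx_neq0 (fr_e_neq0 fr').
  apply: contraNneq (mulf_neq0 eij' eij) => U0.
  have : corner (delta_mx j' i) \in U by rewrite -[corner _]lfunE memv_img ?memvf.
  rewrite U0 memv0 /= => /eqP/matrixP/(_ i' j).
  by rewrite mxprod_delta mxE => ->.
have fL t : linear (fun z : M => X' t *m z *m Y t).
  by move=> c z z'; rewrite mulmxDr mulmxDl -scalemxAr -scalemxAl.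
pose f t : 'End(M) := linfun (HB.pack (fun z : M => X' t *m z *m Y t)
  (GRing.isLinear.Build F M M _ _ (fL t)) : {linear M -> M}).
have fE t z : f t z = X' t *m z *m Y t by rewrite lfunE.
have [z [zU z0 zf]] : exists z, [/\ z \in U, z != 0
    & forall t, t \in T -> exists c, f t z = c *: z].
  apply: common_eigen => // [t tT z|t u tT uT z _].
    rewrite !inU fE => /eqP zE.
    rewrite !mulmxA (fr_eX fr' tT) -!mulmxA (fr_Ye fr tT) -/X' //.
  rewrite !fE.
  (* The Y are inverse to the X in the corner, so exchanging [Y u] and [Y t] absorbs exactly the
     factor produced by exchanging [X' t] and [X' u]. *)
  have YY : b t u *: (Y u *m Y t) = Y t *m Y u.
    have E1 : Y u *m Y t *m (X t *m X u) = e.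
      by rewrite -mulmxA (mulmxA (Y t)) (fr_YX fr tT) (fr_eX fr uT) (fr_YX fr uT).
    have E2 : (X u *m X t) *m (Y t *m Y u) = e.
      by rewrite -mulmxA (mulmxA (X t)) (fr_XY fr tT) (fr_eY fr uT) (fr_XY fr uT).
    rewrite -[RHS](fr_eY fr tT) || idtac.
    have -> : Y t *m Y u = e *m (Y t *m Y u) by rewrite mulmxA (fr_eY fr tT).
    rewrite -E1 (fr_comm fr tT uT) -scalemxAr -scalemxAl -mulmxA E2.
    by rewrite -mulmxA (fr_Ye fr tT).
  have -> : X' t *m (X' u *m z *m Y u) *m Y t = X' t *m X' u *m z *m (Y u *m Y t).
    by rewrite !mulmxA.
  rewrite (fr_comm fr' tT uT) -!scalemxAl scalemxAr YY.
  by rewrite !mulmxA.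
have {zU} zE : e' *m z *m e = z by apply/eqP; rewrite -inU.
have ez : e' *m z = z by rewrite -zE !mulmxA ee'.
have ze : z *m e = z by rewrite -zE -!mulmxA ee.
have {}zf t : t \in T -> exists2 c, c != 0 & X' t *m z = c *: (z *m X t).
  move=> tT; have [c cE] := zf t tT; rewrite fE in cE.
  have E : X' t *m z = c *: (z *m X t).
    by rewrite -{1}ze [e](esym (fr_YX fr tT)) !mulmxA cE scalemxAl.
  exists c => //; apply: contraNneq z0 => c0.
  by rewrite -ez [e'](esym (fr_YX fr' tT)) -mulmxA E c0 scale0r mulmx0.
pose Z := \sum_i x' i *m z *m y i.
have Zx i : Z *m x i = x' i *m z.
  rewrite mulmx_suml (bigD1 i) //= big1 => [|j ji].
    by rewrite addr0 -!mulmxA fr_orth eqxx ze.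
  by rewrite -!mulmxA fr_orth (negPf ji) !mulmx0.
have yZ i : y' i *m Z = z *m y i.
  rewrite mulmx_sumr (bigD1 i) //= big1 => [|j ji].
    by rewrite addr0 !mulmxA fr_orth eqxx ez.
  by rewrite !mulmxA fr_orth eq_sym (negPf ji) !mul0mx.
have ZX i j t : t \in T -> exists2 c, c != 0 &
    x' i *m X' t *m y' j *m Z = c *: (Z *m (x i *m X t *m y j)).
  move=> tT; have [c c0 cE] := zf t tT; exists c => //.
  rewrite -(mulmxA _ (y' j)) yZ !mulmxA Zx -(mulmxA (x' i)) cE.
  by rewrite -scalemxAr -scalemxAl !mulmxA.
have Z0 : Z != 0.
  pose i := Ordinal (fr_k_gt0 fr); apply: contraNneq z0 => Z0.
  have := Zx i; rewrite Z0 mul0mx => /(congr1 (mulmx (y' i))).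
  by rewrite mulmx0 mulmxA fr_orth eqxx ez => <-.
have ZM A : exists B, A *m Z = Z *m B.
  elim/(fr_ind gG' mulG' (fr := fr')): A => [|c A B [A' AE] [B' BE]|i j t tT].
  - by exists 0; rewrite mul0mx mulmx0.
  - exists (c *: A' + B'); rewrite mulmxDl mulmxDr -scalemxAl -scalemxAr.
    by rewrite AE BE.
  have [c _ cE] := ZX i j t tT; exists (c *: (x i *m X t *m y j)).
  by rewrite cE scalemxAr.
(* As every A Z is of the form Z B, the left kernel of [Z] is stable under right multiplication by
   all matrices; if nonzero, it is everything and [Z] = 0. *)
have Zu : Z \in unitmx.
  rewrite -row_free_unit -kermx_eq0; apply: contraNT Z0 => K0.
  have [i [j vij]] := mx_neq0 K0; pose v := row i (kermx Z).
  have vZ : v *m Z = 0.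
    by apply/eqP; rewrite -sub_kermx row_sub.
  apply/eqP/row_matrixP => l; rewrite row0 rowE.
  have -> : delta_mx 0 l = v *m ((v 0 j)^-1 *: delta_mx j l).
    have vij' : v 0 j != 0 by rewrite mxE.
    rewrite -scalemxAr -[delta_mx j l](mul_delta_mx (0 : 'I_1)) mulmxA -colE.
    rewrite [col j v]mx11_scalar mul_scalar_mx [col j v 0 0]mxE.
    by rewrite scalerA mulVf // scale1r.
  have [B BE] := ZM ((v 0 j)^-1 *: delta_mx j l).
  by rewrite -mulmxA BE mulmxA vZ mul0mx.
exists Z => // h A Ah; have [c [cT ->]] := fr_span mulG fr Ah.
rewrite mulmx_sumr mulmx_suml memv_suml // => i _.
rewrite mulmx_sumr mulmx_suml memv_suml // => j _.
rewrite -scalemxAr -scalemxAl.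
have [->|/cT hT] := eqVneq (c i j) 0; first by rewrite scale0r mem0v.
have [d d0 dE] := ZX i j _ hT.
rewrite memvZ // -[_ *m invmx Z]scale1r -(mulVf d0) -scalerA scalemxAl -dE.
rewrite mulmxK // memvZ //.
have -> : Gam' h = Gam' (gam' i - gam' j + (h - gam i + gam j)).
  congr (Gam' _); rewrite -gamE [RHS]addrC [_ + gam j]addrAC -[_ - gam i]addrA -[gam j - gam i]opprB.
  by rewrite subrK.
exact: (fr_degE mulG' fr').
Qed.

Section OneGrading.
Variables (Gam : H -> {vspace M}) (s : seq H) (pr : H -> 'End(M)).
Hypothesis gG : gproj Gam s pr.
Hypothesis mulG : forall g h x y,
  x \in Gam g -> y \in Gam h -> x *m y \in Gam (g + h).

(** M is simple, so e' M e is nonzero; a homogeneous z in it and a trace partner w, suitably scaled,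
    make e and e' equivalent. Conjugation by z and w then identifies the two corners without
    changing degrees. *)
Lemma frames_link (T T' : {pred H}) b b' k k' gam gam'
    (fr : frame Gam T b (k := k) gam) (fr' : frame Gam T' b' (k := k') gam') :
  exists d z w, [/\ z \in Gam d, w \in Gam (- d), w *m z = fr_e fr,
    z *m w = fr_e fr' & [/\ fr_e fr' *m z = z, z *m fr_e fr = z,
    fr_e fr *m w = w & w *m fr_e fr' = w]].
Proof.
set e := fr_e fr; set e' := fr_e fr'.
have ee : e *m e = e by apply: fr_ee.
have ee' : e' *m e' = e' by apply: fr_ee.
have e0 : e \in Gam 0 by apply: fr_e0.
have e'0 : e' \in Gam 0 by apply: fr_e0.
have [i [j eij]] := mx_neq0 (fr_e_neq0 fr).
have [i' [j' eij']] := mx_neq0 (fr_e_neq0 fr').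
have zn0 : e' *m delta_mx j' i *m e != 0.
  apply: contraNneq (mulf_neq0 eij' eij) => E.
  by rewrite -mxprod_delta -/e -/e' E mxE.
have [d prz] := gproj_neq0 gG zn0.
set z0 := _ *m _ *m _ in prz; pose z := pr d z0.
have zd : z \in Gam d by apply: gproj_in gG d _.
have ez : e' *m z = z.
  by rewrite /z -(pr_mull gG mulG d _ e'0) add0r /z0 !mulmxA ee'.
have ze : z *m e = z.
  by rewrite /z -(pr_mulr gG mulG d _ e0) addr0 /z0 -!mulmxA ee.
have [w0 w0d trn0] := gr_pair charF gG mulG zd prz.
pose w1 := e *m w0 *m e'.
have w1d : w1 \in Gam (- d) by rewrite (mulG_0 mulG) // (mul0_G mulG).
have ew1 : e *m w1 = w1 by rewrite /w1 !mulmxA ee.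
have w1e : w1 *m e' = w1 by rewrite /w1 -!mulmxA ee'.
have T0 := fr_T0 mulG fr; have T'0 := fr_T0 mulG fr'.
have scal (a : M) : a \in Gam 0 -> e *m a = a -> a *m e = a -> exists c, a = c *: e.
  move=> a0 ea ae; have [c1 ->] := fr_line_X a0 ea ae T0.
  have [c2 c2E] := fr_line_X e0 ee ee T0.
  have c20 : c2 != 0.
    by apply: contraNneq (fr_e_neq0 fr) => c20; rewrite -/e c2E c20 scale0r.
  by exists (c1 / c2); rewrite c2E scalerA divfK.
have scal' (a : M) : a \in Gam 0 -> e' *m a = a -> a *m e' = a -> exists c, a = c *: e'.
  move=> a0 ea ae; have [c1 ->] := fr_line_X a0 ea ae T'0.
  have [c2 c2E] := fr_line_X e'0 ee' ee' T'0.
  have c20 : c2 != 0.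
    by apply: contraNneq (fr_e_neq0 fr') => c20; rewrite -/e' c2E c20 scale0r.
  by exists (c1 / c2); rewrite c2E scalerA divfK.
have [||| c cE] := scal (w1 *m z).
- by rewrite -(addNr d) mulG.
- by rewrite mulmxA ew1.
- by rewrite -mulmxA ze.
have c0 : c != 0.
  apply: contraNneq trn0 => c0; rewrite c0 scale0r in cE.
  have <- : \tr (w1 *m z) = \tr (z *m w0).
    by rewrite /w1 -!mulmxA ez mxtrace_mulC -mulmxA ze mxtrace_mulC.
  by rewrite cE mxtrace0.
pose w := c^-1 *: w1.
have wz : w *m z = e by rewrite -scalemxAl cE scalerA mulVf // scale1r.
have wd : w \in Gam (- d) by rewrite memvZ.
have ew : e *m w = w by rewrite -scalemxAr ew1.
have we : w *m e' = w by rewrite -scalemxAl w1e.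
have [||| c' c'E] := scal' (z *m w).
- by rewrite -(subrr d) mulG.
- by rewrite mulmxA ez.
- by rewrite -mulmxA we.
exists d, z, w; split=> //.
suff : (c' - 1) *: (w *m z) = 0.
  move/eqP; rewrite scaler_eq0 wz (negPf (fr_e_neq0 fr)) orbF subr_eq0 => /eqP c'1.
  by rewrite c'E c'1 scale1r.
have zE : c' *: z = z by rewrite -{1}ez scalemxAl -c'E -mulmxA wz ze.
by rewrite scalerBl scale1r scalemxAr zE subrr.
Qed.

Lemma frames_sub (T T' : {pred H}) b b' k k' gam gam'
    (fr : frame Gam T b (k := k) gam) (fr' : frame Gam T' b' (k := k') gam') t :
  t \in T -> t \in T'.
Proof.
have [d [z [w [zd wd wz zw [ez ze ew we]]]]] := frames_link fr fr'.
move=> tT; have tg : z *m fr_X fr t *m w \in Gam t.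
  by have := mulG (mulG zd (fr_degX fr tT)) wd; rewrite addrAC subrr add0r.
apply: (fr_line_T (fr := fr') tg); rewrite ?mulmxA ?ez -?mulmxA ?we //.
apply: contraNneq (fr_X_neq0 fr tT) => E.
have -> : fr_X fr t = w *m (z *m (fr_X fr t *m w)) *m z.
  by rewrite !mulmxA wz -mulmxA wz (fr_eX fr tT) (fr_Xe fr tT).
by rewrite E mulmx0 mul0mx.
Qed.

Lemma frames_b (T T' : {pred H}) b b' k k' gam gam'
    (fr : frame Gam T b (k := k) gam) (fr' : frame Gam T' b' (k := k') gam') :
  {in T &, forall t u, b t u = b' t u}.
Proof.
have [d [z [w [zd wd wz zw [ez ze ew we]]]]] := frames_link fr fr'.
pose X' t := z *m fr_X fr t *m w.
have XX t u : u \in T -> X' t *m X' u = z *m (fr_X fr t *m fr_X fr u) *m w.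
  move=> uT; rewrite /X' !mulmxA -(mulmxA _ w z) wz -(mulmxA _ (fr_e fr)).
  by rewrite (fr_eX fr uT).
have XE t : t \in T -> exists c, X' t = c *: fr_X fr' t.
  move=> tT; apply: fr_line_X; last exact: frames_sub fr fr' _ tT.
  - by have := mulG (mulG zd (fr_degX fr tT)) wd; rewrite addrAC subrr add0r.
  - by rewrite /X' !mulmxA ez.
  by rewrite /X' -!mulmxA we.
move=> t u tT uT; have X'0 : X' u *m X' t != 0.
  rewrite (XX u t tT); apply: contraNneq (fr_prod_neq0 fr uT tT) => E.
  have -> : fr_X fr u *m fr_X fr t =
      w *m (z *m (fr_X fr u *m fr_X fr t) *m w) *m z.
    rewrite !mulmxA wz -!mulmxA wz (fr_Xe fr tT) !mulmxA.
    by rewrite (fr_eX fr uT).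
  by rewrite E mulmx0 mul0mx.
have [c cE] := XE t tT; have [c' c'E] := XE u uT.
have E1 : X' t *m X' u = b t u *: (X' u *m X' t).
  by rewrite (XX _ _ tT) (XX _ _ uT) (fr_comm fr tT uT) -scalemxAr -scalemxAl.
have E2 : X' t *m X' u = b' t u *: (X' u *m X' t).
  have tT' := frames_sub fr fr' tT; have uT' := frames_sub fr fr' uT.
  rewrite cE c'E -!scalemxAl -!scalemxAr (fr_comm fr' tT' uT').
  by rewrite !scalerA; congr (_ *: _); ring.
apply/eqP; rewrite -subr_eq0; apply: contraNT X'0 => n0.
have : (b t u - b' t u) *: (X' u *m X' t) == 0 by rewrite scalerBl -E1 -E2 subrr.
by rewrite scaler_eq0 (negPf n0).
Qed.

(* With z, w linking the two frames, the idempotents collecting the x_i y_i over a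
   coset of T coincide up to translation by deg z; compare traces. *)
Lemma frames_coset (T T' : {pred H}) b b' k k' gam gam'
    (fr : frame Gam T b (k := k) gam) (fr' : frame Gam T' b' (k := k') gam') :
  exists d, forall h,
    #|[pred i | gam i - h \in T]| = #|[pred j | gam' j - h + d \in T]|.
Proof.
have [d [z [w [zd wd wz zw [ez ze ew we]]]]] := frames_link fr fr'.
have TD := fr_TD mulG fr; have TN := fr_TN fr.
exists d => h.
pose x := fr_x fr; pose y := fr_y fr; pose x' := fr_x fr'; pose y' := fr_y fr'.
(* Multiplied by z, a nonzero y_i x'_j becomes a nonzero homogeneous element of the corner of e. *)
have link i j : y i *m x' j != 0 -> - gam i + gam' j + d \in T.
  move=> n0; have n1 : y i *m x' j *m z != 0.
    apply: contraNneq n0 => E.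
    by rewrite /x' -(fr_xe fr') -zw !mulmxA E mul0mx.
  apply: (fr_line_T (fr := fr)) n1.
  - by rewrite !mulG ?fr_degx ?fr_degy.
  - by rewrite !mulmxA fr_ey.
  by rewrite -!mulmxA ze.
have degE i j : gam i - h + (- gam i + gam' j + d) = gam' j - h + d.
  rewrite -[- gam i + _ + d]addrA [gam i - h]addrC -addrA addNKr addrA.
  by rewrite [- h + _]addrC.
have yx'0 i j : (gam i - h \in T) != (gam' j - h + d \in T) -> y i *m x' j = 0.
  apply: contraNeq => /link dT; rewrite -(degE i j).
  apply/eqP; apply/idP/idP => [iT|iT]; first exact: TD.
  by rewrite -[gam i - h](addrK (- gam i + gam' j + d)) TD ?TN.
pose P := \sum_(i | gam i - h \in T) x i *m y i.
pose P' := \sum_(j | gam' j - h + d \in T) x' j *m y' j.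
have E1 : P = P *m P'.
  rewrite -[LHS]mulmx1 -(fr_sum fr') (bigID (fun j => gam' j - h + d \in T)) /=.
  rewrite mulmxDr [X in _ + X](_ : _ = 0) ?addr0 //.
  rewrite mulmx_suml big1 // => i iT; rewrite mulmx_sumr big1 // => j jT.
  by rewrite mulmxA -(mulmxA _ (y i)) yx'0 ?iT ?(negPf jT) // mulmx0 mul0mx.
have E2 : P' = P *m P'.
  rewrite -[LHS]mul1mx -(fr_sum fr) (bigID (fun i => gam i - h \in T)) /=.
  rewrite mulmxDl [X in _ + X](_ : _ = 0) ?addr0 //.
  rewrite mulmx_suml big1 // => i iT; rewrite mulmx_sumr big1 // => j jT.
  by rewrite mulmxA -(mulmxA _ (y i)) yx'0 ?jT ?(negPf iT) // mulmx0 mul0mx.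
have tr1 : \tr P = #|[pred i | gam i - h \in T]|%:R * \tr (fr_e fr).
  rewrite linear_sum /= mulr_natl -sumr_const; apply: eq_bigr => i _.
  by rewrite mxtrace_mulC fr_orth eqxx.
have tr2 : \tr P' = #|[pred j | gam' j - h + d \in T]|%:R * \tr (fr_e fr).
  rewrite linear_sum /= mulr_natl -sumr_const; apply: eq_bigr => i _.
  by rewrite mxtrace_mulC fr_orth eqxx -zw mxtrace_mulC wz.
have : \tr P = \tr P' by rewrite E1 -E2.
by rewrite tr1 tr2 => /(mulIf (fr_tre_neq0 charF fr)) /(natf_inj charF).
Qed.

End OneGrading.
End TwoFrames.

(** * From superautomorphisms to (anti)automorphisms of the matrix algebra *)

Section Parity.
Variables (F : closedFieldType) (charF : [pchar F] =i pred0).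
Variables (n : nat).
Local Notation r := n.+1.
Local Notation N := (r + r)%N.
Local Notation M := 'M[F]_N.

Definition par (i : 'I_N) : bool := (i < r)%N.
Definition sgn (i : 'I_N) : F := if par i then 1 else -1.
Definition E0 : M := diag_mx (\row_i sgn i).
(** An odd involution: multiplication by it exchanges even and odd matrices. *)
Definition J : M := block_mx 0 1%:M 1%:M 0.

Definition ev (A : M) : Prop := E0 *m A = A *m E0.
Definition od (A : M) : Prop := E0 *m A = - (A *m E0).
(** Both diagonal blocks have trace 0. These are the trace-zero representatives of the even part of
    psl, one in each class modulo the identity. *)
Definition S0 (A : M) : Prop := [/\ ev A, \tr A = 0 & \tr (E0 *m A) = 0].

Lemma two_neq0 : (2%:R : F) != 0.
Proof. exact: natf_neq0. Qed.

Lemma sgn2 i : sgn i * sgn i = 1.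
Proof. by rewrite /sgn; case: ifP; rewrite ?mulrNN mulr1. Qed.

Lemma sgn_eq i j : (sgn i == sgn j) = (par i == par j).
Proof.
rewrite /sgn; case: (par i); case: (par j); rewrite ?eqxx //=.
  rewrite -subr_eq0 opprK -[1 + 1]/(2%:R); exact/negbTE/two_neq0.
rewrite eq_sym -subr_eq0 opprK -[1 + 1]/(2%:R); exact/negbTE/two_neq0.
Qed.

Lemma sgn_opp i j : par i != par j -> sgn i = - sgn j.
Proof. by rewrite /sgn; case: (par i); case: (par j); rewrite ?opprK. Qed.

Lemma E0l (A : M) i j : (E0 *m A) i j = sgn i * A i j.
Proof. by rewrite mul_diag_mx !mxE. Qed.

Lemma E0r (A : M) i j : (A *m E0) i j = A i j * sgn j.
Proof. by rewrite mul_mx_diag !mxE. Qed.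

Lemma E02 : E0 *m E0 = 1%:M.
Proof.
apply/matrixP => i j; rewrite E0l !mxE; case: eqVneq => [->|_].
  by rewrite mulr1n sgn2.
by rewrite mulr0n mulr0.
Qed.

Lemma E0E0 p (A : 'M[F]_(N, p)) : E0 *m (E0 *m A) = A.
Proof. by rewrite mulmxA E02 mul1mx. Qed.

Lemma eqN0 (x : F) : x = - x -> x = 0.
Proof.
move/eqP; rewrite -addr_eq0 -mulr2n -mulr_natl mulf_eq0 (negPf two_neq0).
by move/eqP.
Qed.

Lemma evP A : ev A <-> forall i j, par i != par j -> A i j = 0.
Proof.
split=> [Ae i j ij|A0].
  have := congr1 (fun B : M => B i j) Ae; rewrite E0l E0r mulrC (sgn_opp ij) mulrN.
  move/esym/eqN0/eqP; rewrite mulf_eq0 => /orP[/eqP //|/eqP s0].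
  by have := sgn2 j; rewrite s0 mulr0 => /eqP; rewrite eq_sym oner_eq0.
apply/matrixP => i j; rewrite E0l E0r mulrC.
have [ij|/A0->] := boolP (par i == par j); last by rewrite !mul0r.
by move: ij; rewrite -sgn_eq => /eqP->.
Qed.

Lemma odP A : od A <-> forall i j, par i == par j -> A i j = 0.
Proof.
split=> [Ae i j ij|A0].
  have := congr1 (fun B : M => B i j) Ae.
  rewrite E0l mxE E0r mulrC (eqP (etrans (sgn_eq i j) ij)).
  move/eqN0/eqP; rewrite mulf_eq0 => /orP[/eqP //|/eqP s0].
  by have := sgn2 j; rewrite s0 mulr0 => /eqP; rewrite eq_sym oner_eq0.
apply/matrixP => i j; rewrite [RHS]mxE E0l E0r mulrC.
have [/A0->|ij] := boolP (par i == par j); first by rewrite !mul0r oppr0.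
by rewrite (sgn_opp ij) mulrN.
Qed.

Lemma par_lshift (i : 'I_r) : par (lshift r i).
Proof. by rewrite /par /= ltn_ord. Qed.

Lemma par_rshift (i : 'I_r) : par (rshift r i) = false.
Proof. by rewrite /par /= ltnNge leq_addr. Qed.

Lemma mx_partE p (A : M) i j :
  mx_part p A i j = if (par i == par j) == (p == 0) then A i j else 0.
Proof.
rewrite /mx_part; case: (p == 0);
  case: (split_ordP i) => i' ->; case: (split_ordP j) => j' ->;
  by rewrite ?par_lshift ?par_rshift ?block_mxEul ?block_mxEur ?block_mxEdl
    ?block_mxEdr ?mxE.
Qed.

Lemma Mpart0P A : A \in Mpart F r 0 <-> ev A.
Proof.
rewrite mem_Mpart; split=> [/eqP <-|/evP A0].
  by apply/evP => i j ij; rewrite mx_partE (negPf ij).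
apply/eqP/matrixP => i j; rewrite mx_partE eqxx eqb_id.
by case: ifP => // /negbT /A0.
Qed.

Lemma Mpart1P A : A \in Mpart F r 1 <-> od A.
Proof.
rewrite mem_Mpart; split=> [/eqP <-|/odP A0].
  by apply/odP => i j ij; rewrite mx_partE ij.
apply/eqP/matrixP => i j; rewrite mx_partE.
by case: ifP => //; case: (boolP (par i == par j)) => // /A0.
Qed.

Lemma supertraceE (A : M) : supertrace A = \tr (E0 *m A).
Proof.
rewrite /supertrace /mxtrace big_split_ord /=; congr (_ + _).
  by apply: eq_bigr => i _; rewrite E0l /sgn par_lshift mul1r !mxE.
rewrite -sumrN; apply: eq_bigr => i _.
by rewrite E0l /sgn par_rshift /= mulN1r !mxE.
Qed.

Lemma ev1 : ev 1%:M. Proof. by rewrite /ev mulmx1 mul1mx. Qed.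
Lemma evM A B : ev A -> ev B -> ev (A *m B).
Proof. by rewrite /ev => eA eB; rewrite mulmxA eA -mulmxA eB mulmxA. Qed.
Lemma evod A B : ev A -> od B -> od (A *m B).
Proof. by rewrite /ev /od => eA oB; rewrite mulmxA eA -mulmxA oB mulmxN mulmxA. Qed.
Lemma odev A B : od A -> ev B -> od (A *m B).
Proof. by rewrite /ev /od => oA eB; rewrite mulmxA oA mulNmx -(mulmxA A E0) eB mulmxA. Qed.
Lemma odod A B : od A -> od B -> ev (A *m B).
Proof.
rewrite /ev /od => oA oB.
by rewrite mulmxA oA mulNmx -(mulmxA A E0) oB mulmxN opprK mulmxA.
Qed.
Lemma ev0 : ev 0. Proof. by rewrite /ev mulmx0 mul0mx. Qed.
Lemma od0 : od 0. Proof. by rewrite /od mulmx0 mul0mx oppr0. Qed.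
Lemma evL c A B : ev A -> ev B -> ev (c *: A + B).
Proof.
by rewrite /ev => eA eB; rewrite mulmxDr mulmxDl -scalemxAr -scalemxAl eA eB.
Qed.
Lemma odL c A B : od A -> od B -> od (c *: A + B).
Proof.
rewrite /od => eA eB.
by rewrite mulmxDr mulmxDl -scalemxAr -scalemxAl eA eB scalerN opprD.
Qed.
Lemma evZ c A : ev A -> ev (c *: A).
Proof. by move=> eA; rewrite -[_ *: _]addr0; apply: evL => //; apply: ev0. Qed.
Lemma odZ c A : od A -> od (c *: A).
Proof. by move=> eA; rewrite -[_ *: _]addr0; apply: odL => //; apply: od0. Qed.
Lemma evT A : ev A -> ev A^T.
Proof.
move/evP => eA; apply/evP => i j ij; rewrite mxE eA // eq_sym //.
Qed.
Lemma odT A : od A -> od A^T.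
Proof. by move/odP => eA; apply/odP => i j ij; rewrite mxE eA // eq_sym. Qed.

Lemma JJ : J *m J = 1%:M.
Proof.
by rewrite mulmx_block !mul0mx !mulmx0 !mul1mx !addr0 add0r -scalar_mx_block.
Qed.

Lemma odJ : od J.
Proof.
apply/odP => i j; case: (split_ordP i) => i' ->; case: (split_ordP j) => j' ->;
  by rewrite ?par_lshift ?par_rshift ?block_mxEul ?block_mxEdr ?mxE.
Qed.

Definition evpart (A : M) : M := 2%:R^-1 *: (A + E0 *m A *m E0).
Definition odpart (A : M) : M := 2%:R^-1 *: (A - E0 *m A *m E0).

Lemma parts_add A : evpart A + odpart A = A.
Proof.
rewrite -scalerDr addrACA subrr addr0 -mulr2n -scaler_nat scalerA mulVf ?scale1r //.
exact: two_neq0.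
Qed.

Lemma ev_evpart A : ev (evpart A).
Proof.
rewrite -[evpart A]addr0; apply: evL; last exact: ev0.
by rewrite /ev mulmxDr mulmxDl -!mulmxA E02 mulmx1 !E0E0 addrC.
Qed.

Lemma od_odpart A : od (odpart A).
Proof.
rewrite -[odpart A]addr0; apply: odL; last exact: od0.
by rewrite /od mulmxBr mulmxBl -!mulmxA E02 mulmx1 !E0E0 opprB.
Qed.

Lemma evpart_ev A : ev A -> evpart A = A.
Proof.
move=> eA; rewrite /evpart eA -mulmxA E02 mulmx1 -mulr2n -scaler_nat scalerA.
by rewrite mulVf ?scale1r // two_neq0.
Qed.

Lemma evpart_od A : od A -> evpart A = 0.
Proof. by move=> oA; rewrite /evpart oA mulNmx -mulmxA E02 mulmx1 subrr scaler0. Qed.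

Lemma odpart_ev A : ev A -> odpart A = 0.
Proof. by move=> eA; rewrite /odpart eA -mulmxA E02 mulmx1 subrr scaler0. Qed.

Lemma odpart_od A : od A -> odpart A = A.
Proof.
move=> oA; rewrite /odpart oA mulNmx -mulmxA E02 mulmx1 opprK.
by rewrite -mulr2n -scaler_nat scalerA mulVf ?scale1r // two_neq0.
Qed.

Lemma evpart_linear : linear evpart.
Proof.
move=> c A B; rewrite /evpart mulmxDr mulmxDl -scalemxAr -scalemxAl addrACA.
by rewrite scalerDr -[c *: A + _]scalerDr !scalerA mulrC.
Qed.

Lemma odpart_linear : linear odpart.
Proof.
move=> c A B; rewrite /odpart mulmxDr mulmxDl -scalemxAr -scalemxAl.
by rewrite opprD addrACA scalerDr -[c *: A - _]scalerBr !scalerA mulrC.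
Qed.

Lemma evpartD A B : evpart (A + B) = evpart A + evpart B.
Proof. by rewrite -[A]scale1r evpart_linear !scale1r. Qed.

Lemma odpartD A B : odpart (A + B) = odpart A + odpart B.
Proof. by rewrite -[A]scale1r odpart_linear !scale1r. Qed.

Lemma ev_odd0 A : ev A -> od A -> A = 0.
Proof. by move=> eA oA; rewrite -(evpart_ev eA) evpart_od. Qed.

Hypothesis n_gt0 : (0 < n)%N.

Lemma ord_other (i : 'I_r) : exists j : 'I_r, j != i.
Proof.
have [->|i0] := eqVneq i ord0; last by exists ord0; rewrite eq_sym.
by exists ord_max; rewrite -val_eqE /= -lt0n.
Qed.

Lemma par_other i : exists2 j, j != i & par j = par i.
Proof.
case: (split_ordP i) => i' ->; have [j ji] := ord_other i'.
  by exists (lshift r j); rewrite ?par_lshift // (inj_eq (@lshift_inj _ _)).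
by exists (rshift r j); rewrite ?par_rshift // (inj_eq (@rshift_inj _ _)).
Qed.

Lemma S0_delta i j : i != j -> par i = par j -> S0 (delta_mx i j).
Proof.
move=> ij pij; have D0 k : delta_mx i j k k = 0 :> F.
  by rewrite mxE; case: eqVneq => // ->; rewrite (negPf ij).
split; last 2 first.
- by rewrite /mxtrace big1.
- by rewrite /mxtrace big1 // => k _; rewrite E0l D0 mulr0.
apply/evP => k l kl; rewrite mxE; case: eqVneq => //= ki; case: eqVneq => //= lj.
by rewrite ki lj pij eqxx in kl.
Qed.

(** Off-diagonal even units lie in [S0], and a diagonal unit is E_ii = E_il E_li with l another
    index of the same block, which exists because n > 0. *)
Lemma ev_ind (P : M -> Prop) :
  P 0 -> (forall c A B, P A -> P B -> P (c *: A + B)) ->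
  (forall A, S0 A -> P A) -> (forall A B, S0 A -> S0 B -> P (A *m B)) ->
  forall A, ev A -> P A.
Proof.
move=> P0 PL PS PSS A /evP Ae.
have PD B C : P B -> P C -> P (B + C) by move=> PB PC; rewrite -[B]scale1r; apply: PL.
rewrite [A]matrix_sum_delta; elim/big_ind: _ => // i _; elim/big_ind: _ => // j _.
have [ij|/Ae->] := boolP (par i == par j); last by rewrite scale0r.
rewrite -[_ *: _]addr0; apply: PL => //.
have [<-|nij] := eqVneq i j; last by apply: PS; apply: S0_delta (eqP ij).
have [l li pl] := par_other i.
rewrite -(mul_delta_mx l); apply: PSS; apply: S0_delta => //.
by rewrite eq_sym.
Qed.
End Parity.

(** * Extending a map on odd matrices to an algebra endomorphism *)

Section Extension.
Variables (F : closedFieldType) (charF : [pchar F] =i pred0).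
Variables (n : nat) (n_gt0 : (0 < n)%N).
Local Notation r := n.+1.
Local Notation N := (r + r)%N.
Local Notation M := 'M[F]_N.
Local Notation E0 := (E0 F n).
Local Notation J := (J F n).

(* Since even matrices are sums of products of elements of S0, phi0 extends to an
   algebra endomorphism of the even part; then (Phi1 J)^2 is central, and a
   rescaling of Phi1 makes it a square root of the identity. *)
Lemma extend_aut (phi0 : M -> M) (Phi1 : 'End(M)) :
  (forall A, S0 A -> ev (phi0 A)) -> (forall v, od v -> od (Phi1 v)) ->
  (forall v, od v -> Phi1 v = 0 -> v = 0) ->
  (forall w, od w -> exists2 v, od v & Phi1 v = w) ->
  (forall A v, S0 A -> od v -> Phi1 (A *m v) = phi0 A *m Phi1 v) ->
  (forall A v, S0 A -> od v -> Phi1 (v *m A) = Phi1 v *m phi0 A) ->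
  exists (mu : F) (Phi : 'End(M)),
    [/\ mu != 0, forall x y, Phi (x *m y) = Phi x *m Phi y,
        forall v, od v -> Phi v = mu *: Phi1 v,
        forall x, Phi x = 0 -> x = 0
      & forall x, ev x -> ev (Phi x)].
Proof.
move=> phi0e Phi1o Phi1I Phi1S PhiL PhiR.
have oJ : od J := odJ charF n; have JJ := JJ F n.
have oL A v : S0 A -> od v -> od (A *m v) by move=> [eA _ _]; apply: evod.
have oR A v : S0 A -> od v -> od (v *m A) by move=> [eA _ _] ov; apply: odev.
pose U := Phi1 J; have oU : od U by apply: Phi1o.
(* [Phi1] turns left and right multiplication by [Z] into left and right multiplication by [W]. *)
pose Q Z W := ev W /\ forall v, od v ->
  Phi1 (Z *m v) = W *m Phi1 v /\ Phi1 (v *m Z) = Phi1 v *m W.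
have Qex Z : ev Z -> exists W, Q Z W.
  move: Z; apply: (ev_ind charF n_gt0) => [|c A B [A' [eA' QA]] [B' [eB' QB]]|A SA|A B SA SB].
  - by exists 0; split=> [|v _]; rewrite ?mul0mx ?mulmx0 ?linear0 //; apply: ev0.
  - exists (c *: A' + B'); split=> [|v ov]; first exact: evL.
    have [-> ->] : (c *: A + B) *m v = c *: (A *m v) + B *m v /\
        v *m (c *: A + B) = c *: (v *m A) + v *m B.
      by rewrite mulmxDl mulmxDr -scalemxAl -scalemxAr.
    have [a1 a2] := QA v ov; have [b1 b2] := QB v ov.
    by rewrite !linearP /= a1 a2 b1 b2 mulmxDl -scalemxAl.
  - by exists (phi0 A); split=> [|v ov]; [apply: phi0e | rewrite PhiL ?PhiR].
  exists (phi0 A *m phi0 B); split=> [|v ov]; first by apply: evM; apply: phi0e.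
  split.
    by rewrite -mulmxA PhiL ?(PhiL B) ?mulmxA //; apply: oL.
  by rewrite mulmxA PhiR ?(PhiR A) ?mulmxA //; apply: oR.
(* If Phi1 v = J, then v = (v J) J with v J even exhibits J as W U for some W. *)
have Uu : U \in unitmx.
  have [v ov vJ] := Phi1S J oJ.
  have [W [_ /(_ J oJ)[QW _]]] := Qex (v *m J) (odod ov oJ).
  have : (J *m W) *m U = 1%:M.
    by rewrite -mulmxA -QW -mulmxA JJ mulmx1 vJ.
  by case/mulmx1_unit.
have oUi : od (invmx U).
  rewrite /od; apply: (can_inj (mulmxK Uu)); rewrite mulmxKV //.
  have oU' : E0 *m U = - (U *m E0) := oU.
  by rewrite mulNmx -mulmxA oU' mulmxN opprK mulmxA mulVmx // mul1mx.
pose Phi0 Z := Phi1 (Z *m J) *m invmx U.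
have Phi0P Z W : Q Z W -> W = Phi0 Z.
  by move=> [_ /(_ J oJ)[QW _]]; rewrite /Phi0 QW mulmxK.
have Q0 Z : ev Z -> Q Z (Phi0 Z).
  by move=> eZ; have [W QW] := Qex Z eZ; rewrite -(Phi0P _ _ QW).
have e0 Z : ev Z -> ev (Phi0 Z) by case/Q0.
have L0 Z v : ev Z -> od v -> Phi1 (Z *m v) = Phi0 Z *m Phi1 v.
  by move=> eZ ov; case: (Q0 Z eZ) => _ /(_ v ov)[].
have R0 Z v : ev Z -> od v -> Phi1 (v *m Z) = Phi1 v *m Phi0 Z.
  by move=> eZ ov; case: (Q0 Z eZ) => _ /(_ v ov)[].
have M0 Z Z' : ev Z -> ev Z' -> Phi0 (Z *m Z') = Phi0 Z *m Phi0 Z'.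
  move=> eZ eZ'; rewrite {1}/Phi0 -mulmxA L0 //; last exact: evod.
  by rewrite -mulmxA.
have evJJ Z : ev Z -> ev (J *m Z *m J).
  by move=> eZ; apply: odod => //; apply: odev.
have UZ Z : ev Z -> U *m Phi0 Z = Phi0 (J *m Z *m J) *m U.
  move=> eZ; rewrite -R0 // -L0 //; last exact: evJJ.
  by rewrite -mulmxA JJ mulmx1.
have UUZ Z : ev Z -> (U *m U) *m Phi0 Z = Phi0 Z *m (U *m U).
  move=> eZ; rewrite -mulmxA UZ // mulmxA UZ; last exact: evJJ.
  by rewrite !mulmxA JJ mul1mx -mulmxA || idtac; rewrite -!mulmxA JJ mulmx1.
have S0w w : ev w -> exists2 Z, ev Z & Phi0 Z = w.
  move=> ew; have [v ov vE] := Phi1S (w *m U) (evod ew oU).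
  exists (v *m J); first exact: odod.
  by rewrite /Phi0 -mulmxA JJ mulmx1 vE mulmxK.
have UUe w : ev w -> (U *m U) *m w = w *m (U *m U).
  by move=> /S0w[Z eZ <-]; apply: UUZ.
(* An odd v is (v U^-1) U with v U^-1 even, and U U commutes with both factors. *)
have UUc w : (U *m U) *m w = w *m (U *m U).
  rewrite -[w](parts_add charF) mulmxDr mulmxDl UUe; last exact: ev_evpart.
  congr (_ + _); have := od_odpart w; set v := odpart w => ov.
  have ew' : ev (v *m invmx U) by apply: odod.
  by rewrite -(mulmxKV Uu v) (mulmxA (U *m U)) UUe // -!mulmxA.
have UUs := central_scalar (m := n + n.+1) UUc; set lam := (U *m U) _ _ in UUs.
have lam0 : lam != 0.
  apply/eqP => l0; have : U *m U = 0 by rewrite UUs l0 raddf0.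
  move=> UU0; have : U *m U \in unitmx by rewrite unitmx_mul Uu.
  by rewrite UU0 unitr0.
(* This makes mu U, the future image of the involution [J], an involution. *)
have [mu muE] : exists mu, mu ^+ 2 = lam^-1.
  have [mu] := @solve_monicpoly F 2 (fun i => if i == 0%N then lam^-1 else 0) isT.
  by rewrite big_ord_recl big_ord1 /= expr0 mulr1 mul0r addr0 => <-; exists mu.
have mu0 : mu != 0.
  by apply: contraNneq lam0 => m0; rewrite -invr_eq0 -muE m0 expr0n.
have PhiLin : linear (fun x : M => Phi0 (evpart x) + mu *: Phi1 (odpart x)).
  move=> c x y; rewrite /Phi0 evpart_linear odpart_linear mulmxDl -scalemxAl.
  by rewrite !linearP mulmxDl -scalemxAl /= scalerDr addrACA.
pose Phi : 'End(M) := linfun (HB.pack (fun x : M =>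
  Phi0 (evpart x) + mu *: Phi1 (odpart x))
  (GRing.isLinear.Build F M M _ _ PhiLin) : {linear M -> M}).
have PhiE x : Phi x = Phi0 (evpart x) + mu *: Phi1 (odpart x) by rewrite lfunE.
have Phie x : ev x -> Phi x = Phi0 x.
  by move=> ex; rewrite PhiE (evpart_ev charF ex) (odpart_ev ex) linear0 scaler0 addr0.
have Phio v : od v -> Phi v = mu *: Phi1 v.
  move=> ov; rewrite PhiE (evpart_od ov) (odpart_od charF ov).
  by rewrite /Phi0 mul0mx linear0 mul0mx add0r.
have Mee x y : ev x -> ev y -> Phi (x *m y) = Phi x *m Phi y.
  by move=> ex ey; rewrite !Phie ?M0 //; apply: evM.
have Meo x y : ev x -> od y -> Phi (x *m y) = Phi x *m Phi y.
  move=> ex oy; rewrite (Phio (x *m y)); last exact: evod.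
  by rewrite Phie // Phio // L0 // scalemxAr.
have Moe x y : od x -> ev y -> Phi (x *m y) = Phi x *m Phi y.
  move=> ox ey; rewrite (Phio (x *m y)); last exact: odev.
  by rewrite (Phie y) // Phio // R0 // scalemxAl.
(* Inserting J J = 1 between the factors reduces this to even x J and J y, since the image of [J]
   also squares to 1. *)
have Moo x y : od x -> od y -> Phi (x *m y) = Phi x *m Phi y.
  move=> ox oy; have exJ := odod ox oJ; have eJy := odod oJ oy.
  have xE : x = (x *m J) *m J by rewrite -mulmxA JJ mulmx1.
  have yE : y = J *m (J *m y) by rewrite mulmxA JJ mul1mx.
  have xyE : x *m y = (x *m J) *m (J *m y) by rewrite -mulmxA (mulmxA J) JJ mul1mx.
  have -> : Phi x = Phi (x *m J) *m Phi J by rewrite {1}xE Meo.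
  have -> : Phi y = Phi J *m Phi (J *m y) by rewrite {1}yE Moe.
  have PJJ : Phi J *m Phi J = 1%:M.
    rewrite Phio // -/U -scalemxAl -scalemxAr scalerA -expr2 muE UUs.
    by rewrite scale_scalar_mx mulVf.
  by rewrite xyE Mee // -mulmxA (mulmxA (Phi J)) PJJ mul1mx.
exists mu, Phi; split=> // [x y|x|x ex]; last by rewrite Phie //; apply: e0.
  rewrite -[x](parts_add charF) -[y](parts_add charF).
  have := ev_evpart x; have := od_odpart x; set x0 := evpart x; set x1 := odpart x.
  have := ev_evpart y; have := od_odpart y; set y0 := evpart y; set y1 := odpart y.
  move=> oy ey ox ex; rewrite mulmxDr !mulmxDl !(linearD Phi) /=.
  by rewrite Mee // Moe // Meo // Moo // mulmxDr !mulmxDl.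
move=> Px0.
have P0 : Phi0 (evpart x) = - (mu *: Phi1 (odpart x)).
  by apply/eqP; rewrite -addr_eq0 -PhiE Px0.
have P00 : Phi0 (evpart x) = 0.
  apply: (ev_odd0 charF); first exact/e0/ev_evpart.
  rewrite P0 -scaleNr; apply: odZ; exact/Phi1o/od_odpart.
have x1 : odpart x = 0.
  apply: Phi1I; first exact: od_odpart.
  by move/eqP: P0; rewrite P00 eq_sym oppr_eq0 scaler_eq0 (negPf mu0) => /eqP.
have x0 : evpart x *m J = 0.
  apply: Phi1I; first by apply: evod => //; apply: ev_evpart.
  by rewrite -[LHS](mulmxKV Uu) -/(Phi0 _) P00 mul0mx.
rewrite -(parts_add charF x) x1 addr0.
by rewrite -[LHS]mulmx1 -JJ mulmxA x0 mul0mx.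
Qed.
End Extension.

(** * Lie automorphisms of the even part *)

Section LieAutomorphisms.
Variables (F : closedFieldType) (charF : [pchar F] =i pred0).
Variables (n : nat) (n_gt0 : (0 < n)%N).
Local Notation r := n.+1.
Local Notation N := (r + r)%N.
Local Notation M := 'M[F]_N.
Local Notation E0 := (E0 F n).
Local Notation J := (J F n).

Implicit Types A B D : M.

Definition br (A B : M) : M := A *m B - B *m A.

Lemma S0L c A B : S0 A -> S0 B -> S0 (c *: A + B).
Proof.
move=> [eA tA sA] [eB tB sB]; split; first exact: evL.
  by rewrite mxtraceD mxtraceZ tA tB mulr0 addr0.
by rewrite mulmxDr -scalemxAr mxtraceD mxtraceZ sA sB mulr0 addr0.
Qed.

Lemma br_ev A B : ev A -> ev B -> ev (br A B).
Proof.
move=> eA eB; rewrite /br addrC -scaleN1r.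
by apply: evL; apply: evM.
Qed.

Lemma br_od A B : ev A -> od B -> od (br A B).
Proof.
move=> eA oB; rewrite /br addrC -scaleN1r.
by apply: odL; [apply: odev | apply: evod].
Qed.

Lemma S0_br A B : S0 A -> S0 B -> S0 (br A B).
Proof.
move=> [eA _ _] [eB _ _]; split; first exact: br_ev.
  by rewrite linearB /= mxtrace_mulC subrr.
rewrite mulmxBr linearB /= !mulmxA (mxtrace_mulC (E0 *m B)) mulmxA -eA.
by rewrite subrr.
Qed.

Lemma S0_E0 A : S0 A -> S0 (E0 *m A).
Proof. by case=> eA tA sA; split; rewrite ?E0E0 //; apply: evM. Qed.

Lemma E0_br A B : ev A -> E0 *m br A B = br A (E0 *m B).
Proof. by move=> eA; rewrite /br mulmxBr !mulmxA eA. Qed.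

Lemma E0_brl A B : ev B -> br (E0 *m A) B = E0 *m br A B.
Proof. by move=> eB; rewrite /br mulmxBr !mulmxA eB. Qed.

Lemma brDl A B C : br (A + B) C = br A C + br B C.
Proof. by rewrite /br mulmxDl mulmxDr opprD addrACA. Qed.

Lemma brZl c A C : br (c *: A) C = c *: br A C.
Proof. by rewrite /br -scalemxAl -scalemxAr scalerBr. Qed.

Lemma brDr A B C : br C (A + B) = br C A + br C B.
Proof. by rewrite /br mulmxDl mulmxDr opprD addrACA. Qed.

Lemma brZr c A C : br C (c *: A) = c *: br C A.
Proof. by rewrite /br -scalemxAl -scalemxAr scalerBr. Qed.

(** Commuting with the off-diagonal units of a block makes D scalar on it, and the two trace
    conditions force both scalars to vanish in characteristic 0. *)
Lemma S0_center D : S0 D ->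
  (forall i j, i != j -> par i = par j ->
     D *m delta_mx i j = delta_mx i j *m D) -> D = 0.
Proof.
move=> [eD tD sD] DC.
have ent i j k : i != j -> par i = par j -> D k i = (k == i)%:R * D j j.
  move=> ij pij; have := congr1 (fun B : M => B k j) (DC i j ij pij).
  rewrite !mxE (bigD1 i) //= big1 => [|l /negPf li]; last by rewrite mxE li mulr0.
  rewrite (bigD1 j) //= big1 => [|l /negPf lj]; last by rewrite mxE lj andbF mul0r.
  by rewrite !mxE !eqxx !addr0 /= andbT mulr1.
have off k i : k != i -> D k i = 0.
  move=> /negPf ki; have [j ji pj] := par_other n_gt0 i.
  by rewrite (ent i j k) ?ki ?mul0r // eq_sym.
have diag i j : par i = par j -> D i i = D j j.
  by move=> pij; have [->//|ij] := eqVneq i j; rewrite (ent i j i) // eqxx mul1r.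
pose d1 := D (lshift r ord0) (lshift r ord0).
pose d2 := D (rshift r ord0) (rshift r ord0).
have trD : \tr D = d1 *+ r + d2 *+ r.
  rewrite /mxtrace big_split_ord /=; congr (_ + _).
    rewrite -[r in RHS]card_ord -sumr_const; apply: eq_bigr => i _.
    by apply: diag; rewrite !par_lshift.
  rewrite -[r in RHS]card_ord -sumr_const; apply: eq_bigr => i _.
  by apply: diag; rewrite !par_rshift.
have trED : \tr (E0 *m D) = d1 *+ r - d2 *+ r.
  rewrite /mxtrace big_split_ord /= -mulNrn; congr (_ + _).
    rewrite -[r in RHS]card_ord -sumr_const; apply: eq_bigr => i _.
    rewrite E0l /sgn par_lshift mul1r; apply: diag; by rewrite !par_lshift.
  rewrite -[r in RHS]card_ord -sumr_const; apply: eq_bigr => i _.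
  rewrite E0l /sgn par_rshift mulN1r; congr (- _); apply: diag.
  by rewrite !par_rshift.
have d2r : d2 *+ r = 0.
  apply: (eqN0 charF); apply/eqP; rewrite -subr_eq0 opprK.
  by move: sD tD; rewrite trED trD => /subr0_eq ->  /eqP.
have d1r : d1 *+ r = 0 by move: tD; rewrite trD d2r addr0.
have r0 (x : F) : x *+ r = 0 -> x = 0.
  by rewrite -mulr_natr => /eqP; rewrite mulf_eq0 (negPf (natf_neq0 charF _)) orbF => /eqP.
apply/matrixP => k i; rewrite [RHS]mxE; have [->|/off//] := eqVneq k i.
case: (boolP (par i)) => pi.
  by rewrite (diag i (lshift r ord0)) ?par_lshift //; apply: r0.
by rewrite (diag i (rshift r ord0)) ?par_rshift ?(negPf pi) //; apply: r0.
Qed.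

(* [E, [E, W]] = -2 W_ji E for E = E_ij makes every E_ij an eigenvector. *)
Lemma centroid (th : 'End(M)) :
  (forall A, S0 A -> S0 (th A)) ->
  (forall A B, S0 A -> S0 B -> th (br A B) = br A (th B)) ->
  exists p q : F, forall A, S0 A -> th A = p *: A + q *: (E0 *m A).
Proof.
move=> thS thB.
have thB' A B : S0 A -> S0 B -> br (th A) B = br A (th B).
  move=> SA SB; rewrite -thB // -[br A B]opprB linearN /= (thB B A) //.
  by rewrite opprB.
(* The eigenvalue of [th] on E_ij, which will turn out to depend only on the block of i. *)
pose al i j := th (delta_mx i j) i j.
have thE i j : i != j -> par i = par j ->
    th (delta_mx i j) = al i j *: delta_mx i j.
  move=> ij pij; pose E : M := delta_mx i j.
  have ji : j != i by rewrite eq_sym.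
  have SE : S0 E by apply: S0_delta.
  have SE' : S0 (delta_mx j i : M) by apply: S0_delta.
  have EE : E *m E = 0 by rewrite mul_delta_mx_0.
  have bb W : br E (br E W) = - (2%:R * W j i) *: E.
    have EWE : E *m W *m E = W j i *: E.
      apply/matrixP => k l.
      rewrite /E -(mul_delta_mx (0 : 'I_1)) -!mulmxA (mulmxA W) (mulmxA _ (W *m _)).
      rewrite -colE -rowE [row j _]mx11_scalar mul_scalar_mx -scalemxAr.
      by rewrite !mxE.
    rewrite /br mulmxBr mulmxBl !mulmxA EE mul0mx sub0r -[W *m E *m E]mulmxA EE mulmx0.
    by rewrite subr0 EWE -opprD -scalerDl -mulr2n mulr_natl scaleNr.
  have two0 := two_neq0 charF.
  have c : th E = th (delta_mx j i) j i *: E.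
    have := bb (delta_mx j i); rewrite mxE !eqxx mulr1 => b1.
    have := congr1 th b1; rewrite !thB //; last by apply: S0_br.
    rewrite bb linearZ /= => /(congr1 (fun X => - 2%:R^-1 *: X)).
    by rewrite !scalerA !mulrNN mulrA mulVf // mul1r scale1r => ->.
  have : al i j = th (delta_mx j i) j i.
    by rewrite /al -/E c !mxE !eqxx mulr1.
  by move=> ->.
(* Moving [th] from one factor of [E_ij, E_jl] to the other compares the two eigenvalues. *)
have al_step i j l : i != j -> j != l -> par i = par j -> par j = par l ->
    al i j = al j l.
  move=> ij jl pij pjl.
  have := thB' _ _ (S0_delta charF ij pij) (S0_delta charF jl pjl).
  rewrite (thE i j) // (thE j l) // /br -!scalemxAl -!scalemxAr.
  move/(congr1 (fun B : M => B i l)); rewrite mul_delta_mx !mxE !eqxx /=.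
  rewrite big1 => [|k _]; first by rewrite !mulr1 !mulr0 !subr0.
  by rewrite mxE (negPf ij) mul0r.
have al_const i j k l : i != j -> k != l -> par i = par j -> par k = par l ->
    par i = par k -> al i j = al k l.
  move=> ij kl pij pkl pik; have [jk|jk] := eqVneq j k.
    by rewrite -jk in kl pkl *; apply: al_step.
  rewrite (al_step i j k) // -?pij //.
  by apply: al_step; rewrite // -?pij // eq_sym.
pose i1 : 'I_N := lshift r ord0; pose i2 : 'I_N := rshift r ord0.
have [j1 j1i pj1] := par_other n_gt0 i1; have [j2 j2i pj2] := par_other n_gt0 i2.
rewrite eq_sym in j1i; rewrite eq_sym in j2i.
have pi1 : par i1 = true by apply: par_lshift.
have pi2 : par i2 = false by apply: par_rshift.
pose a1 := al i1 j1; pose a2 := al i2 j2; have two0 := two_neq0 charF.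
(* The eigenvalues on the two blocks must be p + q = a1 and p - q = a2. *)
exists (2%:R^-1 * (a1 + a2)), (2%:R^-1 * (a1 - a2)) => A SA.
set p := _ * (a1 + a2); set q := _ * (a1 - a2).
have pqE i j : i != j -> par i = par j -> al i j = p + q * sgn F i.
  move=> ij pij; rewrite /sgn; case: ifP => pi.
    rewrite (al_const i j i1 j1) ?pj1 ?pi1 // -/a1 mulr1 -mulrDr.
    by rewrite addrACA subrr addr0 -mulr2n -[a1 *+ 2]mulr_natl mulrA mulVf // mul1r.
  rewrite (al_const i j i2 j2) ?pj2 ?pi2 // -/a2 mulrN1 -mulrBr.
  rewrite opprB addrC addrA subrK -mulr2n -[a2 *+ 2]mulr_natl mulrA mulVf //.
  by rewrite mul1r.
(* The difference of the two sides lies in [S0] and commutes with every off-diagonal unit of either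
   block. *)
apply/eqP; rewrite -subr_eq0; apply/eqP/S0_center => [|i j ij pij].
  rewrite -scaleN1r addrC; apply: S0L; last exact: thS.
  by apply: S0L => //; rewrite -[_ *: _]addr0; apply: S0L; [apply: S0_E0 | split; rewrite ?mulmx0 ?mxtrace0 //; apply: ev0].
pose E : M := delta_mx i j; have SE : S0 E := S0_delta charF ij pij.
have [eA _ _] := SA; have [eE _ _] := SE.
have E0E : E0 *m E = sgn F i *: E.
  apply/matrixP => k l; rewrite E0l !mxE; case: eqVneq => [->|_] //=.
  by rewrite !mulr0.
apply/eqP; rewrite -subr_eq0 -/E -/(br _ E); apply/eqP.
rewrite -scaleN1r brDl brZl brDl !brZl E0_brl // thB' // thE // -/E brZr.
have -> : E0 *m br A E = sgn F i *: br A E by rewrite E0_br // E0E brZr.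
by rewrite (pqE i j) // scalerA -scalerDl scaleN1r subrr.
Qed.

Variables phi0 psi0 phi1 : 'End(M).
Hypothesis phi0S : forall A, S0 A -> S0 (phi0 A).
Hypothesis psi0S : forall A, S0 A -> S0 (psi0 A).
Hypothesis phi0K : forall A, S0 A -> psi0 (phi0 A) = A.
Hypothesis psi0K : forall A, S0 A -> phi0 (psi0 A) = A.
Hypothesis phi0B : forall A B, S0 A -> S0 B -> phi0 (br A B) = br (phi0 A) (phi0 B).

(* Transporting multiplication by E0 along phi0 gives a square root of the
   identity in the centroid, which consists of the maps A |-> c A + d E0 A. *)
Lemma phi0_sign : exists2 sg : F, sg * sg = 1
  & forall A, S0 A -> phi0 (E0 *m A) = sg *: (E0 *m phi0 A).
Proof.
pose thf (A : M) := phi0 (E0 *m psi0 A).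
have thL : linear thf.
  by move=> c A B; rewrite /thf linearP mulmxDr -scalemxAr linearP.
pose th : 'End(M) := linfun (HB.pack thf
  (GRing.isLinear.Build F M M _ _ thL) : {linear M -> M}).
have thE A : th A = phi0 (E0 *m psi0 A) by rewrite lfunE.
have psi0B A B : S0 A -> S0 B -> psi0 (br A B) = br (psi0 A) (psi0 B).
  move=> SA SB; rewrite -[RHS]phi0K; last by apply: S0_br; apply: psi0S.
  by rewrite phi0B ?psi0K //; apply: psi0S.
have [|A B SA SB|p [q pqE]] := centroid (th := th).
- by move=> A SA; rewrite thE; apply/phi0S/S0_E0/psi0S.
- rewrite !thE psi0B // E0_br; last by case: (psi0S SA).
  by rewrite phi0B ?psi0K //; [apply: psi0S | apply/S0_E0/psi0S].
have E A : S0 A -> phi0 (E0 *m A) = p *: phi0 A + q *: (E0 *m phi0 A).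
  by move=> SA; rewrite -pqE ?thE ?phi0K //; apply: phi0S.
pose i1 : 'I_N := lshift r ord0; pose i2 : 'I_N := rshift r ord0.
have pi1 : par i1 = true by apply: par_lshift.
have pi2 : par i2 = false by apply: par_rshift.
have [j1 j1i pj1] := par_other n_gt0 i1; have [j2 j2i pj2] := par_other n_gt0 i2.
rewrite eq_sym in j1i; rewrite eq_sym in j2i.
(* The formula for [phi0 (E0 *m A)] is applied twice; on the two blocks this reads (p + q)^2 = 1 and
   (p - q)^2 = 1, whence p q = 0. *)
have E2 A : S0 A -> A = (p * p + q * q) *: A + (2%:R * (p * q)) *: (E0 *m A).
  move=> SA; have Sp := psi0S SA; have SEp := S0_E0 Sp.
  have := E _ SEp; rewrite E0E0 // (E _ Sp) psi0K // mulmxDr -!scalemxAr E0E0.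
  move=> {1}->; rewrite !scalerDr !scalerA [X in _ + X]addrC addrACA -!scalerDl.
  by congr (_ *: _ + _ *: _); rewrite mulr_natl mulr2n [q * p]mulrC.
have q1 (i j : 'I_N) : i != j -> par i = par j ->
    p * p + q * q + 2%:R * (p * q) * sgn F i = 1.
  move=> ij pij; have := E2 _ (S0_delta charF ij pij).
  move/(congr1 (fun B : M => B i j)); rewrite mxE !(mxE, E0l) !eqxx /=.
  by rewrite !mulr1 => <-.
have := q1 _ _ j1i (esym pj1); have := q1 _ _ j2i (esym pj2).
rewrite /sgn pi1 pi2 mulr1 mulrN1 => h2 h1.
have pq0 : p * q = 0.
  have : 2%:R * (p * q) = 0.
    apply: (eqN0 charF); apply: (addrI (p * p + q * q)).
    by rewrite h1 h2.
  by move/eqP; rewrite mulf_eq0 (negPf (two_neq0 charF)) => /eqP.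
rewrite pq0 mulr0 addr0 in h1.
have [q0|qn0] := eqVneq q 0; last first.
  have p0 : p = 0 by move/eqP: pq0; rewrite mulf_eq0 (negPf qn0) orbF => /eqP.
  exists q; first by rewrite -h1 p0 mulr0 add0r.
  by move=> A SA; rewrite E // p0 scale0r add0r.
(* The case q = 0 is impossible: [E0] would act on [S0] as one scalar, but it has opposite signs on
   the two blocks. *)
have Ep A : S0 A -> E0 *m A = p *: A.
  move=> SA; have SEA := S0_E0 SA.
  by rewrite -[LHS]phi0K // E // q0 scale0r addr0 linearZ /= phi0K.
have sp (i j : 'I_N) : i != j -> par i = par j -> sgn F i = p.
  move=> ij pij; have := Ep _ (S0_delta charF ij pij).
  move/(congr1 (fun B : M => B i j)); rewrite E0l !mxE !eqxx /=.
  by rewrite !mulr1.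
have := sp _ _ j1i (esym pj1); rewrite -(sp _ _ j2i (esym pj2)) /sgn pi1 pi2.
by move/eqN0 => /(_ charF) /eqP; rewrite oner_eq0.
Qed.
End LieAutomorphisms.

(** * Lifting a superautomorphism to the matrix algebra *)

Section Lift.
Variables (F : closedFieldType) (charF : [pchar F] =i pred0).
Variables (n : nat) (n_gt0 : (0 < n)%N).
Local Notation r := n.+1.
Local Notation N := (r + r)%N.
Local Notation M := 'M[F]_N.
Local Notation E0 := (E0 F n).
Local Notation J := (J F n).

Variables (phi0 phi1 : 'End(M)) (sg : F).
Hypothesis phi0S : forall A : M, S0 A -> S0 (phi0 A).
Hypothesis sg2 : sg * sg = 1.
Hypothesis phi0E : forall A, S0 A -> phi0 (E0 *m A) = sg *: (E0 *m phi0 A).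
Hypothesis phi1o : forall v : M, od v -> od (phi1 v).
Hypothesis phi1I : forall v : M, od v -> phi1 v = 0 -> v = 0.
Hypothesis phi1S : forall w : M, od w -> exists2 v, od v & phi1 v = w.
Hypothesis phi1B : forall A v, S0 A -> od v ->
  phi1 (br A v) = br (phi0 A) (phi1 v).

(** Twice the projection of [phi1] to the maps that commute (rho = 1) or anticommute (rho = -1) with
    left multiplication by [E0]; [phi1] itself need do neither. *)
Let Pf rho (v : M) : M := phi1 v + rho *: (E0 *m phi1 (E0 *m v)).

Lemma Pf_linear rho : linear (Pf rho).
Proof.
move=> c A B; rewrite /Pf mulmxDr -scalemxAr !linearP /= scalerDr addrACA.
congr (_ + _).
Qed.

Definition twisted_part rho : 'End(M) := linfun (HB.pack (Pf rho)
  (GRing.isLinear.Build F M M _ _ (Pf_linear rho)) : {linear M -> M}).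
Local Notation P := twisted_part.

Lemma twisted_partE rho v : P rho v = phi1 v + rho *: (E0 *m phi1 (E0 *m v)).
Proof. by rewrite lfunE. Qed.

Lemma od_E0 (v : M) : od v -> od (E0 *m v).
Proof. by move=> ov; apply: evod. Qed.

Lemma twisted_od rho v : od v -> od (P rho v).
Proof.
move=> ov; rewrite twisted_partE addrC; apply: odL; last exact: phi1o.
by apply/od_E0/phi1o/od_E0.
Qed.

Lemma twisted_E0 rho v : rho * rho = 1 -> P rho (E0 *m v) = rho *: (E0 *m P rho v).
Proof.
move=> rr; rewrite !twisted_partE E0E0 mulmxDr scalerDr -scalemxAr scalerA rr.
by rewrite scale1r E0E0 addrC.
Qed.

Lemma twisted_br rho A v : S0 A -> od v -> P rho (br A v) = br (phi0 A) (P rho v).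
Proof.
move=> SA ov; have [eA _ _] := SA; have [eA' _ _] := phi0S SA.
rewrite !twisted_partE E0_br // !phi1B //; last exact: od_E0.
by rewrite E0_br // brDr brZr.
Qed.

(** E0 [E0 A, v] = A v + v A because [E0] anticommutes with v; together with [A, v] this recovers
    both associative products from brackets. *)
Lemma mul_br (A v : M) : od v ->
  A *m v = 2%:R^-1 *: (br A v + E0 *m br (E0 *m A) v) /\
  v *m A = 2%:R^-1 *: (E0 *m br (E0 *m A) v - br A v).
Proof.
move=> ov; have -> : E0 *m br (E0 *m A) v = A *m v + v *m A.
  by rewrite /br mulmxBr -mulmxA E0E0 !mulmxA ov mulNmx -(mulmxA v) E02 mulNmx mulmx1 opprK.
have half (x : M) : 2%:R^-1 *: (x + x) = x.
  by rewrite -mulr2n -scaler_nat scalerA mulVf ?scale1r // two_neq0.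
split; rewrite /br.
  by rewrite addrACA addNr addr0 half.
by rewrite opprB addrC addrA subrK half.
Qed.

(** Commutators of A and v are preserved, while moving [E0] through P rho and [phi0] multiplies
    anticommutators by rho sg. The sign 1 preserves the two products; the sign -1 exchanges them up
    to a minus. *)
Lemma twisted_mul rho A v : rho * rho = 1 -> S0 A -> od v ->
  if rho == sg then P rho (A *m v) = phi0 A *m P rho v /\
                    P rho (v *m A) = P rho v *m phi0 A
  else P rho (A *m v) = - (P rho v *m phi0 A) /\
       P rho (v *m A) = - (phi0 A *m P rho v).
Proof.
move=> rr SA ov; have SEA := S0_E0 SA; have oP := twisted_od rho ov.
have rsE : rho * sg = if rho == sg then 1 else -1.
  case: eqVneq => [->//|rs]; apply/eqP.
  have : (rho - sg) * (rho + sg) = 0 by rewrite -subr_sqr !expr2 rr sg2 subrr.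
  move/eqP; rewrite mulf_eq0 subr_eq0 (negPf rs) addr_eq0 => /eqP->.
  by rewrite mulNr sg2.
have [AvE vAE] := mul_br A ov.
have Y : P rho (E0 *m br (E0 *m A) v)
    = (rho * sg) *: (E0 *m br (E0 *m phi0 A) (P rho v)).
  by rewrite twisted_E0 // twisted_br // phi0E // brZl -scalemxAr scalerA.
have [E1 E2] := mul_br (phi0 A) oP.
rewrite AvE vAE !linearZ /= (linearB (P rho)) (linearD (P rho)) /= Y twisted_br // rsE.
case: (rho == sg); first by rewrite !scale1r -E1 -E2.
rewrite !scaleN1r E1 E2 -!scalerN.
by split; congr (_ *: _); [rewrite opprB | rewrite -opprD addrC].
Qed.

Lemma twisted_mul_ev rho : rho * rho = 1 -> forall A, ev A ->
  forall v, od v -> P rho v = 0 -> P rho (A *m v) = 0 /\ P rho (v *m A) = 0.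
Proof.
move=> rr; have PS A v : S0 A -> od v -> P rho v = 0 ->
    P rho (A *m v) = 0 /\ P rho (v *m A) = 0.
  move=> SA ov Pv; have := twisted_mul rr SA ov; rewrite Pv !(mul0mx, mulmx0) oppr0.
  by case: ifP.
apply: (ev_ind charF n_gt0) => [|c A B HA HB|A SA|A B SA SB] v ov Pv.
- by rewrite mul0mx mulmx0 linear0.
- have [a1 a2] := HA v ov Pv; have [b1 b2] := HB v ov Pv.
  rewrite mulmxDl mulmxDr -scalemxAl -scalemxAr !linearP /= a1 a2 b1 b2.
  by rewrite scaler0 addr0.
- exact: PS.
have [eA _ _] := SA; have [eB _ _] := SB; split.
  rewrite -mulmxA; apply: (PS _ _ SA _ (PS _ _ SB ov Pv).1).1.
  exact: evod.
rewrite mulmxA; apply: (PS _ _ SB _ (PS _ _ SA ov Pv).2).2.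
exact: odev.
Qed.

(** The kernel on odd matrices is a bimodule over the even matrices, so a nonzero entry of v puts
    its whole off-diagonal block into the kernel; s is the eigenvalue of [E0] on that block. *)
Lemma twisted_ker rho v : rho * rho = 1 -> od v -> v != 0 -> P rho v = 0 ->
  exists2 s : F, s * s = 1
    & forall w, od w -> E0 *m w = s *: w -> P rho w = 0.
Proof.
move=> rr ov /mx_neq0[i [j vij]] Pv.
have pij : par i != par j.
  by apply/negP => pij; move/odP: ov => /(_ charF _ _ pij) v0; rewrite v0 eqxx in vij.
have eD (k l : 'I_N) : par k = par l -> ev (delta_mx k l : M).
  move=> kl; apply/(evP charF) => p q pq; rewrite mxE.
  by case: eqVneq => //= pk; case: eqVneq => //= ql; rewrite pk ql kl eqxx in pq.
have PD (k l : 'I_N) : par k = par i -> par l = par j -> P rho (delta_mx k l) = 0.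
  move=> ki lj; have eki := eD _ _ ki; have ejl := eD _ _ (esym lj).
  have [Pkv _] := twisted_mul_ev rr eki ov Pv.
  have [_ Pkvl] := twisted_mul_ev rr ejl (evod eki ov) Pkv.
  have DD : delta_mx k i *m v *m delta_mx j l = v i j *: delta_mx k l.
    apply/matrixP => p q.
    rewrite -(mul_delta_mx (0 : 'I_1) k i) -(mul_delta_mx (0 : 'I_1) j l) -!mulmxA (mulmxA v) (mulmxA _ (v *m _)).
    rewrite -colE -rowE [row i _]mx11_scalar mul_scalar_mx -scalemxAr.
    by rewrite mul_delta_mx !mxE.
  move: Pkvl; rewrite DD linearZ /= => /eqP.
  by rewrite scaler_eq0 (negPf vij) => /eqP.
exists (sgn F i); first exact: sgn2.
move=> w ow wE; rewrite [w]matrix_sum_delta linear_sum big1 // => k _.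
rewrite linear_sum big1 // => l _; rewrite linearZ /=.
have [ki|ki] := eqVneq (par k) (par i); last first.
  have := congr1 (fun B : M => B k l) wE; rewrite E0l mxE (sgn_opp F ki) mulNr.
  move/esym/(eqN0 charF)/eqP; rewrite mulf_eq0 => /orP[/eqP s0|/eqP->].
    by have := sgn2 F i; rewrite s0 mulr0 => /eqP; rewrite eq_sym oner_eq0.
  by rewrite scale0r.
have [kl|kl] := eqVneq (par k) (par l).
  by move/(odP charF): ow => /(_ k l); rewrite kl eqxx => ->; rewrite ?scale0r.
rewrite PD ?scaler0 //; move: kl pij; rewrite ki.
by case: (par l); case: (par i); case: (par j).
Qed.

Lemma E0J_scalar (c : F) : E0 *m J <> c *: J.
Proof.
move=> E; have {}E : E0 = c%:M.
  by rewrite -[LHS]mulmx1 -(JJ F n) mulmxA E -scalemxAl JJ scalemx1.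
have Ei (i : 'I_N) : sgn F i = c.
  have := congr1 (fun B : M => B i i) E.
  by rewrite /E0 !mxE eqxx !mulr1n.
have : (1 : F) = - 1.
  have := Ei (lshift r ord0); rewrite -(Ei (rshift r ord0)) /sgn.
  by rewrite par_lshift par_rshift.
by move/(eqN0 charF)/eqP; rewrite oner_eq0.
Qed.

(** If both signs failed, P 1 and P (-1) would each vanish on an off-diagonal block. If the blocks
    agree, [phi1] vanishes there; if not, the image of [phi1] lies in a single eigenspace of [E0]
    and misses [J]. *)
Lemma twisted_inj : exists2 rho, rho * rho = 1 & forall v, od v -> P rho v = 0 -> v = 0.
Proof.
have pm (s : F) : s * s = 1 -> s = 1 \/ s = -1.
  move=> ss; have /eqP : (s - 1) * (s + 1) = 0.
    by rewrite -subr_sqr !expr2 ss mulr1 subrr.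
  by rewrite mulf_eq0 subr_eq0 addr_eq0 => /orP[] /eqP; [left | right].
have ker rho : rho * rho = 1 -> ~ (forall v, od v -> P rho v = 0 -> v = 0) ->
    exists2 s : F, s * s = 1 & forall w, od w -> E0 *m w = s *: w -> P rho w = 0.
  move=> rr /existsNP[v /not_implyP[ov /not_implyP[Pv /eqP v0]]].
  exact: twisted_ker rr ov v0 Pv.
apply: contrapT => N.
have [s1 s11 P1] := ker 1 (mulr1 1) (fun I => N (ex_intro2 _ _ 1 (mulr1 1) I)).
have m11 : (-1 : F) * -1 = 1 by rewrite mulrNN mulr1.
have [s2 s22 P2] := ker (-1) m11 (fun I => N (ex_intro2 _ _ (-1) m11 I)).
have eig (s : F) (v : M) : s * s = 1 -> E0 *m (v + s *: (E0 *m v)) = s *: (v + s *: (E0 *m v)).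
  by move=> ss; rewrite mulmxDr -scalemxAr E0E0 scalerDr scalerA ss scale1r addrC.
have oeig (s : F) (v : M) : od v -> od (v + s *: (E0 *m v)).
  by move=> ov; rewrite addrC; apply: odL => //; apply: od_E0.
have [s12|ns12] := eqVneq s1 s2.
  pose w := J + s1 *: (E0 *m J); have ow : od w := oeig s1 _ (odJ charF n).
  have wE : E0 *m w = s1 *: w := eig _ _ s11.
  have := P1 w ow wE; rewrite s12 in wE; have := P2 w ow wE.
  rewrite !twisted_partE scaleN1r scale1r => e1 e2.
  have /eqP : phi1 w *+ 2 = 0.
    by rewrite mulr2n -[RHS](addr0 0) -{1}e1 -e2 addrACA addNr addr0.
  rewrite -scaler_nat scaler_eq0 (negPf (two_neq0 charF)) => /eqP /(phi1I ow) w0.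
  apply: (@E0J_scalar (- s1)); have : s1 *: w = 0 by rewrite w0 scaler0.
  rewrite scalerDr scalerA s11 scale1r addrC => /eqP.
  by rewrite addr_eq0 scaleNr => /eqP.
have {ns12} s2E : s2 = - s1.
  by case: (pm _ s11) (pm _ s22) ns12 => -> [] ->; rewrite ?opprK ?eqxx.
have [v ov vJ] := phi1S (odJ charF n).
have phi1E (w : M) : od w -> E0 *m w = s1 *: w -> E0 *m phi1 w = - s1 *: phi1 w.
  move=> ow wE; have := P1 w ow wE.
  rewrite twisted_partE scale1r wE linearZ /= -scalemxAr => /(congr1 (fun X => s1 *: X)).
  by rewrite scalerDr scalerA s11 scale1r scaler0 => /eqP; rewrite addrC addr_eq0 scaleNr => /eqP.
have phi1E' (w : M) : od w -> E0 *m w = - s1 *: w -> E0 *m phi1 w = - s1 *: phi1 w.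
  rewrite -s2E => ow wE; have := P2 w ow wE.
  rewrite twisted_partE scaleN1r wE linearZ /= -scalemxAr => /(congr1 (fun X => s2 *: X)).
  rewrite scalerBr scalerA s22 scale1r scaler0 => /eqP.
  by rewrite subr_eq0 => /eqP.
apply: (@E0J_scalar (- s1)); rewrite -vJ.
have vE : v = 2%:R^-1 *: (v + s1 *: (E0 *m v)) + 2%:R^-1 *: (v - s1 *: (E0 *m v)).
  rewrite -scalerDr addrACA subrr addr0 -mulr2n -scaler_nat scalerA mulVf ?scale1r //.
  exact: two_neq0.
have e2 : E0 *m (v - s1 *: (E0 *m v)) = - s1 *: (v - s1 *: (E0 *m v)).
  by have := eig (- s1) v; rewrite mulrNN s11 !scaleNr; apply.
have o2 : od (v - s1 *: (E0 *m v)) by rewrite -scaleNr; apply: oeig.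
have half c (w : M) : E0 *m w = c *: w -> E0 *m (2%:R^-1 *: w) = c *: (2%:R^-1 *: w).
  by move=> wE; rewrite -scalemxAr wE !scalerA mulrC.
rewrite vE linearD /= mulmxDr phi1E ?phi1E' //.
- by rewrite -scalerDr.
- exact: odZ.
- exact: half.
- by apply: odZ; apply: oeig.
by apply: half; apply: eig.

Qed.

(** Completed by the identity on even matrices, P rho is an injective endomorphism of a
    finite-dimensional space. *)
Lemma twisted_surj rho : (forall v, od v -> P rho v = 0 -> v = 0) ->
  forall w, od w -> exists2 v, od v & P rho v = w.
Proof.
move=> PI w ow.
have fL : linear (fun x : M => evpart x + P rho (odpart x)).
  move=> c A B; rewrite evpart_linear odpart_linear linearP /= scalerDr.
  by rewrite addrACA.
pose f : 'End(M) := linfun (HB.pack (fun x : M => evpart x + P rho (odpart x))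
  (GRing.isLinear.Build F M M _ _ fL) : {linear M -> M}).
have fE x : f x = evpart x + P rho (odpart x) by rewrite lfunE.
have oP x : od (P rho (odpart x)) by apply/twisted_od/od_odpart.
have odf x : odpart (f x) = P rho (odpart x).
  rewrite fE -[evpart x]scale1r odpart_linear (odpart_od charF (oP x)).
  by rewrite odpart_ev ?scaler0 ?add0r //; apply: ev_evpart.
have kf : lker f == 0%VS.
  rewrite -subv0; apply/subvP => x; rewrite memv_ker memv0 => /eqP fx.
  have x1 : odpart x = 0.
    by apply: PI; [apply: od_odpart | rewrite -odf fx odpart_ev //; apply: ev0].
  move: fx; rewrite fE x1 linear0 addr0 => x0.
  by rewrite -(parts_add charF x) x0 x1 addr0.
exists (odpart (f^-1%VF w)); first exact: od_odpart.
by rewrite -odf lker0_lfunVK // odpart_od.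
Qed.

Lemma lie_lift : exists rho mu (Phi : 'End(M)),
  [/\ rho * rho = 1 /\ mu != 0,
      forall v, od v -> Phi v = mu *: (phi1 v + rho *: (E0 *m phi1 (E0 *m v))),
      forall x, Phi x = 0 -> x = 0, forall x, ev x -> ev (Phi x)
    & (forall x y, Phi (x *m y) = Phi x *m Phi y) \/
      (forall x y, Phi (x *m y) = Phi y *m Phi x)].
Proof.
have [rho rr PI] := twisted_inj; have PS := twisted_surj PI.
have PM A v SA ov := @twisted_mul rho A v rr SA ov.
have [rs|rs] := boolP (rho == sg).
  have [||||| |mu [Phi [mu0 PhiM Phio PhiI Phie]]] :=
      @extend_aut F charF n n_gt0 phi0 (P rho) => //.
  - by move=> A /phi0S[].
  - exact: twisted_od.
  - by move=> A v SA ov; have := PM A v SA ov; rewrite rs => -[].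
  - by move=> A v SA ov; have := PM A v SA ov; rewrite rs => -[].
  exists rho, mu, Phi; split=> //; last by left.
  by move=> v ov; rewrite Phio // twisted_partE.
(* For rho different from sg, transposing P rho and replacing [phi0] by its negative transpose
   restores the order of the factors; transposing the extension back gives an antiautomorphism. *)
have TL : linear (fun v : M => (P rho v)^T).
  by move=> c A B; rewrite !linearP.
pose Q : 'End(M) := linfun (HB.pack (fun v : M => (P rho v)^T)
  (GRing.isLinear.Build F M M _ _ TL) : {linear M -> M}).
have QE v : Q v = (P rho v)^T by rewrite lfunE.
have [||||| |mu [Phi [mu0 PhiM Phio PhiI Phie]]] :=
    @extend_aut F charF n n_gt0 (fun A => - (phi0 A)^T) Q.
- by move=> A /phi0S[eA _ _]; rewrite -scaleN1r; apply/evZ/evT.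
- by move=> v ov; rewrite QE; apply/odT/twisted_od.
- move=> v ov; rewrite QE => /(congr1 trmx); rewrite trmxK trmx0; exact: PI.
- move=> w ow; have [v ov vE] := PS _ (odT charF ow).
  by exists v; rewrite // QE vE trmxK.
- move=> A v SA ov; have := PM A v SA ov; rewrite (negPf rs) !QE => -[-> _].
  by rewrite linearN /= trmx_mul mulNmx.
- move=> A v SA ov; have := PM A v SA ov; rewrite (negPf rs) !QE => -[_ ->].
  by rewrite linearN /= trmx_mul mulmxN.
have PhiTL : linear (fun v : M => (Phi v)^T).
  by move=> c A B; rewrite !linearP.
pose Psi : 'End(M) := linfun (HB.pack (fun v : M => (Phi v)^T)
  (GRing.isLinear.Build F M M _ _ PhiTL) : {linear M -> M}).
have PsiE v : Psi v = (Phi v)^T by rewrite lfunE.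
exists rho, mu, Psi; split=> //.
- by move=> v ov; rewrite PsiE Phio // linearZ /= QE trmxK twisted_partE.
- by move=> x; rewrite PsiE => /(congr1 trmx); rewrite trmxK trmx0; apply: PhiI.
- by move=> x ex; rewrite PsiE; apply/evT/Phie.
by right=> x y; rewrite !PsiE PhiM trmx_mul.
Qed.

End Lift.

(** * Gradings by degree and parity, and lifts from psl to matrices *)

Section SuperGradings.
Variables (F : closedFieldType) (charF : [pchar F] =i pred0).
Variables (G : zmodType) (n : nat).
Local Notation r := n.+1.
Local Notation N := (r + r)%N.
Local Notation M := 'M[F]_N.
Local Notation E0 := (E0 F n).
Local Notation J := (J F n).
Implicit Types (A B : M).

Lemma Z2P (p : 'Z_2) : p = 0 \/ p = 1.
Proof. by case: p => [[|[|//]] ?]; [left | right]; apply/val_inj. Qed.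

Definition sharp (Del : G -> {vspace M}) (h : Gsharp G) : {vspace M} :=
  (Del h.1 :&: Mpart F r h.2)%VS.

Lemma sharp0 Del (g : G) A : (A \in sharp Del (g, 0)) <-> A \in Del g /\ ev A.
Proof.
rewrite memv_cap /=; split=> [/andP[-> /(Mpart0P charF)]|[-> eA]] //.
exact/(Mpart0P charF).
Qed.

Lemma sharp1 Del (g : G) A : (A \in sharp Del (g, 1)) <-> A \in Del g /\ od A.
Proof.
rewrite memv_cap /=; split=> [/andP[-> /(Mpart1P charF)]|[-> oA]] //.
exact/(Mpart1P charF).
Qed.

Lemma mx_part0E A : mx_part 0 A = evpart A.
Proof.
rewrite -{1}(parts_add charF A) linearD /=.
have /(Mpart0P charF) e := ev_evpart A; have /(Mpart1P charF) o := od_odpart A.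
by rewrite (mx_part_other o) // addr0; move: e; rewrite mem_Mpart => /eqP.
Qed.

Lemma mx_part1E A : mx_part 1 A = odpart A.
Proof.
rewrite -{1}(parts_add charF A) linearD /=.
have /(Mpart0P charF) e := ev_evpart A; have /(Mpart1P charF) o := od_odpart A.
by rewrite (mx_part_other e) // add0r; move: o; rewrite mem_Mpart => /eqP.
Qed.

Section One.
Variable Del : G -> {vspace Mss F r}.
Hypothesis DelG : is_super_grading Del.

Lemma super_parts g A : A \in Del g -> evpart A \in Del g /\ odpart A \in Del g.
Proof.
case: DelG => _ /(_ g) ->; case/memv_addP => a /memv_capP[ag /(Mpart0P charF) ea].
case=> b /memv_capP[bg /(Mpart1P charF) ob] ->.
have -> : evpart (a + b) = a.
  by rewrite evpartD (evpart_od ob) addr0 (evpart_ev charF ea).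
have -> : odpart (a + b) = b.
  by rewrite odpartD (odpart_ev ea) add0r (odpart_od charF ob).
split.
  by apply: (subvP (addvSl _ _)); rewrite memv_cap ag; apply/(Mpart0P charF).
by apply: (subvP (addvSr _ _)); rewrite memv_cap bg; apply/(Mpart1P charF).
Qed.

Lemma super_gproj : exists s pr, gproj (sharp Del) s pr.
Proof.
case: DelG => /gprojP[[s [pr gG]] _] _.
have [us prG prE prs] := gG.
have prL (h : Gsharp G) : linear (fun x : M => mx_part h.2 (pr h.1 x)).
  by move=> c A B; rewrite !linearP.
pose pr' (h : Gsharp G) : 'End(M) := linfun (HB.pack
  (fun x : M => mx_part h.2 (pr h.1 x))
  (GRing.isLinear.Build F M M _ _ (prL h)) : {linear M -> M}).
have pr'E h x : pr' h x = mx_part h.2 (pr h.1 x) by rewrite lfunE.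
exists [seq (g, p) | g <- s, p <- [:: 0; 1]], pr'; split.
- by apply: allpairs_uniq => // -[? ?] [? ?] _ _ [-> ->].
- move=> [g p] x; rewrite pr'E /= memv_cap.
  have [e o] := super_parts (prG g x).
  case: (Z2P p) => ->.
    rewrite mx_part0E e; apply/(Mpart0P charF); exact: ev_evpart.
  rewrite mx_part1E o; apply/(Mpart1P charF); exact: od_odpart.
- move=> [g p] [h q] x /memv_capP[/= xg xp]; rewrite pr'E /= (prE _ _ _ xg).
  rewrite xpair_eqE; case: eqVneq => _ /=; last by rewrite linear0.
  case: eqVneq => [->|qp]; last exact: mx_part_other xp qp.
  by move: xp; rewrite mem_Mpart => /eqP.
move=> x; rewrite big_allpairs_dep {1}(prs x); apply: eq_bigr => g _.
rewrite !big_cons big_nil /= addr0 !pr'E /= mx_part0E mx_part1E.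
by rewrite (parts_add charF).
Qed.

Lemma super_mul h h' A B : A \in sharp Del h -> B \in sharp Del h' ->
  A *m B \in sharp Del (h + h').
Proof.
case: DelG => -[_ _ mulG] _; case: h h' => [g p] [g' p'].
have pE a b c : a + b = c -> ((g, a) : Gsharp G) + (g', b) = (g + g', c).
  by move=> <-.
case: (Z2P p) => ->; case: (Z2P p') => ->.
- move/sharp0 => [Ag eA] /sharp0[Bg eB]; rewrite (pE _ _ 0); last exact/val_inj.
  by apply/sharp0; split; [apply: mulG | apply: evM].
- move/sharp0 => [Ag eA] /sharp1[Bg oB]; rewrite (pE _ _ 1); last exact/val_inj.
  by apply/sharp1; split; [apply: mulG | apply: evod].
- move/sharp1 => [Ag oA] /sharp0[Bg eB]; rewrite (pE _ _ 1); last exact/val_inj.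
  by apply/sharp1; split; [apply: mulG | apply: odev].
move/sharp1 => [Ag oA] /sharp1[Bg oB]; rewrite (pE _ _ 0); last exact/val_inj.
by apply/sharp0; split; [apply: mulG | apply: odod].
Qed.
End One.

Lemma supercommE A B : supercomm A B =
  br (evpart A) (evpart B) + br (evpart A) (odpart B)
  + (br (odpart A) (evpart B)
     + (odpart A *m odpart B + odpart B *m odpart A)).
Proof.
have sumZ2 (f : 'Z_2 -> M) : \sum_p f p = f 0 + f 1.
  rewrite big_ord_recl big_ord1; congr (f _ + f _); exact/val_inj.
rewrite /supercomm !sumZ2 !mx_part0E !mx_part1E /br /=.
by rewrite !(mul0n, muln0, muln1, expr0, expr1) !scale1r scaleN1r opprK.
Qed.

Lemma supercomm_ev A B : ev A -> ev B -> supercomm A B = br A B.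
Proof.
move=> eA eB; rewrite supercommE (evpart_ev charF eA) (evpart_ev charF eB).
rewrite (odpart_ev eA) (odpart_ev eB) /br.
by rewrite !(mul0mx, mulmx0, addr0, subrr).
Qed.

Lemma supercomm_evod A B : ev A -> od B -> supercomm A B = br A B.
Proof.
move=> eA oB; rewrite supercommE (evpart_ev charF eA) (odpart_od charF oB).
rewrite (odpart_ev eA) (evpart_od oB) /br.
by rewrite !(mul0mx, mulmx0, addr0, subrr, oppr0, add0r).
Qed.

Lemma in_sl A : (A \in sl F r) = (\tr (E0 *m A) == 0).
Proof. by rewrite mem_sl supertraceE. Qed.

Lemma od_tr A : od A -> \tr A = 0.
Proof. by move/(odP charF) => oA; rewrite /mxtrace big1 // => i _; rewrite oA. Qed.

Lemma od_sl A : od A -> A \in sl F r.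
Proof.
move=> oA; rewrite in_sl; apply/eqP/od_tr.
exact: evod.
Qed.

Lemma S0_sl A : S0 A -> A \in sl F r.
Proof. by case=> _ _ sA; rewrite in_sl sA. Qed.

Local Notation proj := (psl_proj F r).

Lemma proj_lift A : A \in sl F r -> exists c, vsval (proj A) = A + c%:M.
Proof.
move/psl_projE/vlineP => [c E]; exists c.
by apply/eqP; rewrite addrC -subr_eq E scalemx1.
Qed.

Lemma proj_eq A B : A \in sl F r -> B \in sl F r -> proj A = proj B ->
  exists c, A = B + c%:M.
Proof.
move=> Asl Bsl E; have : proj (A - B) == 0 by rewrite linearB /= E subrr.
rewrite (psl_proj_eq0 (memvB Asl Bsl)) => /vlineP[c cE]; exists c.
by apply/eqP; rewrite addrC -subr_eq cE scalemx1.
Qed.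

Lemma proj_scalar c : proj c%:M = 0.
Proof.
apply/eqP; rewrite -scalemx1 psl_proj_eq0; first by rewrite memvZ ?memv_line.
by rewrite memvZ // id_sl.
Qed.

Lemma trN c : \tr (c%:M : M) = c * N%:R.
Proof. by rewrite mxtrace_scalar mulr_natr. Qed.

Lemma N_neq0 : (N%:R : F) != 0.
Proof. exact: (natf_neq0 charF (n + n.+1)). Qed.

Lemma scalar_ev (c : F) : ev (c%:M : M).
Proof. by rewrite -scalemx1; apply/evZ/ev1. Qed.

Lemma S0_proj_inj A B : S0 A -> S0 B -> proj A = proj B -> A = B.
Proof.
move=> SA SB /(proj_eq (S0_sl SA) (S0_sl SB))[c cE].
have [_ tA _] := SA; have [_ tB _] := SB.
move: tA; rewrite cE linearD /= tB add0r trN => /eqP.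
by rewrite mulf_eq0 (negPf N_neq0) orbF => /eqP->; rewrite raddf0 addr0.
Qed.

Lemma od_proj_inj A B : od A -> od B -> proj A = proj B -> A = B.
Proof.
move=> oA oB /(proj_eq (od_sl oA) (od_sl oB))[c cE].
have := odpart_od charF oA; rewrite {1}cE odpartD.
by rewrite (odpart_ev (scalar_ev c)) addr0 (odpart_od charF oB).
Qed.

(** [vsval] picks representatives in an arbitrary complement of the identity line. The trace
    correction moves an even one into [S0]; in [lift1], [odpart] drops the stray scalar. *)
Definition lift0 (xi : 'End(psl F r)) A : M :=
  evpart (vsval (xi (proj A))) - (\tr (vsval (xi (proj A))) / N%:R)%:M.
Definition lift1 (xi : 'End(psl F r)) A : M := odpart (vsval (xi (proj A))).

Lemma lift0_linear xi : linear (lift0 xi).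
Proof.
move=> c A B; rewrite /lift0.
have -> : vsval (xi (proj (c *: A + B))) = c *: vsval (xi (proj A)) + vsval (xi (proj B)).
  by rewrite !linearP.
rewrite evpart_linear mxtraceD mxtraceZ mulrDl -mulrA raddfD /= -scale_scalar_mx.
by rewrite opprD addrACA -scalerBr.
Qed.

Lemma lift1_linear xi : linear (lift1 xi).
Proof. by move=> c A B; rewrite /lift1 !linearP /= odpart_linear. Qed.

Section Lifts.
Variable xi : 'End(psl F r).
Hypothesis xiP : forall p x, x \in sa_part (psl F r) p -> xi x \in sa_part (psl F r) p.

Lemma lift0P A : S0 A -> S0 (lift0 xi A) /\ proj (lift0 xi A) = xi (proj A).
Proof.
move=> SA; have [eA _ _] := SA.
have : xi (proj A) \in sa_part (psl F r) 0.
  apply: xiP; apply: memv_img; rewrite memv_cap (S0_sl SA).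
  exact/(Mpart0P charF).
case/memv_imgP => B /memv_capP[Bsl /(Mpart0P charF) eB] E.
have [c cE] := proj_lift Bsl.
have -> : lift0 xi A = B - (\tr B / N%:R)%:M.
  rewrite /lift0 E cE evpartD (evpart_ev charF eB).
  rewrite (evpart_ev charF (scalar_ev c)) linearD /= trN mulrDl mulfK ?N_neq0 //.
  by rewrite raddfD opprD /= addrACA subrr addr0.
split; last first.
  rewrite E linearB /= proj_scalar subr0.
  by [].
have sB : \tr (E0 *m B) = 0 by move: Bsl; rewrite in_sl => /eqP.
split.
- by rewrite addrC -raddfN -[B]scale1r addrC; apply: evL => //; apply: scalar_ev.
- by rewrite linearB /= trN divfK ?N_neq0 // subrr.
rewrite mulmxBr linearB /= sB mul_mx_scalar linearZ /= sub0r.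
have := id_sl F r; rewrite in_sl mulmx1 => /eqP->.
by rewrite mulr0 oppr0.
Qed.

Lemma lift1P A : od A -> od (lift1 xi A) /\ proj (lift1 xi A) = xi (proj A).
Proof.
move=> oA; split; first exact: od_odpart.
have : xi (proj A) \in sa_part (psl F r) 1.
  apply: xiP; apply: memv_img; rewrite memv_cap (od_sl oA).
  exact/(Mpart1P charF).
case/memv_imgP => B /memv_capP[Bsl /(Mpart1P charF) oB] E.
have [c cE] := proj_lift Bsl.
rewrite /lift1 E cE odpartD (odpart_od charF oB).
by rewrite (odpart_ev (scalar_ev c)) addr0.
Qed.

(** The lift differs by a scalar from the even part of a representative of degree g. For g = 0
    scalars have that degree too; otherwise a nonzero scalar would contradict the vanishing of
    traces. *)
Lemma lift0_graded (Del Del' : G -> {vspace Mss F r}) g A :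
  is_super_grading Del' ->
  (forall x, x \in induced Del g -> xi x \in induced Del' g) ->
  S0 A -> A \in Del g -> lift0 xi A \in Del' g.
Proof.
move=> DelG' xig SA Ag; have [SL projL] := lift0P SA.
have : xi (proj A) \in induced Del' g.
  by apply: xig; apply: memv_img; rewrite memv_cap (S0_sl SA).
case/memv_imgP => B /memv_capP[Bsl Bg]; rewrite -projL => /esym E.
have [c cE] := proj_eq Bsl (S0_sl SL) E; have [eL tL _] := SL.
have [ + _] := super_parts DelG' Bg.
have -> : evpart B = lift0 xi A + c%:M.
  rewrite cE evpartD (evpart_ev charF eL).
  by rewrite (evpart_ev charF (scalar_ev c)).
have [->|c0] := eqVneq c 0; first by rewrite raddf0 addr0.
case: DelG' => /gprojP[[s [pr gG]] mulG] _.
have g1 := gr1 gG mulG.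
have [-> LB|g0 LB] := eqVneq g 0.
  rewrite -[lift0 xi A](addrK c%:M) memvB // -scalemx1.
  exact: memvZ.
have := gr_trace charF gG mulG LB g0; rewrite linearD /= tL add0r trN => /eqP.
by rewrite mulf_eq0 (negPf c0) (negPf N_neq0).
Qed.

Lemma lift1_graded (Del Del' : G -> {vspace Mss F r}) g A :
  is_super_grading Del' ->
  (forall x, x \in induced Del g -> xi x \in induced Del' g) ->
  od A -> A \in Del g -> lift1 xi A \in Del' g.
Proof.
move=> DelG' xig oA Ag; have [oL projL] := lift1P oA.
have : xi (proj A) \in induced Del' g.
  by apply: xig; apply: memv_img; rewrite memv_cap (od_sl oA).
case/memv_imgP => B /memv_capP[Bsl Bg]; rewrite -projL => /esym E.
have [c cE] := proj_eq Bsl (od_sl oL) E.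
have [_] := super_parts DelG' Bg.
rewrite cE odpartD (odpart_od charF oL).
by rewrite (odpart_ev (scalar_ev c)) addr0.
Qed.
End Lifts.

End SuperGradings.

(** * From automorphisms and antiautomorphisms of M to isomorphisms on psl *)

Section Induce.
Variables (F : closedFieldType) (charF : [pchar F] =i pred0).
Variables (G : zmodType) (n : nat).
Local Notation r := n.+1.
Local Notation N := (r + r)%N.
Local Notation M := 'M[F]_N.
Local Notation E0 := (E0 F n).
Local Notation J := (J F n).
Local Notation proj := (psl_proj F r).
Implicit Types (A B : M).

Lemma supercomm_sl A B : supercomm A B \in sl F r.
Proof.
have tr4 (a b c d e : M) : \tr (E0 *m (a + b + (c + (d + e)))) =
    \tr (E0 *m a) + \tr (E0 *m b) + (\tr (E0 *m c) + (\tr (E0 *m d) + \tr (E0 *m e))).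
  by rewrite !mulmxDr !mxtraceD.
rewrite in_sl (supercommE charF) tr4.
have eA := ev_evpart A; have eB := ev_evpart B.
have oA := od_odpart A; have oB := od_odpart B.
have [_ _ ->] : S0 (br (evpart A) (evpart B)).
  split; [exact: br_ev | by rewrite linearB /= mxtrace_mulC subrr | ].
  rewrite mulmxBr linearB /= !mulmxA (mxtrace_mulC (E0 *m evpart B)) mulmxA -eA.
  by rewrite subrr.
have -> : \tr (E0 *m br (evpart A) (odpart B)) = 0.
  by apply: (od_tr charF); apply: evod => //; apply: br_od.
have -> : \tr (E0 *m br (odpart A) (evpart B)) = 0.
  apply: (od_tr charF); apply: evod => //.
  rewrite /br -opprB -scaleN1r; apply/odZ; exact: br_od.
rewrite !add0r !mulmxA (mxtrace_mulC (E0 *m odpart B)) mulmxA oA mulNmx.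
by rewrite linearN /= addNr.
Qed.

Lemma psl_super_aut (Psi : 'End(M)) :
  (forall A, Psi A = 0 -> A = 0) -> (forall A, ev A -> ev (Psi A)) ->
  (forall A, od A -> od (Psi A)) ->
  (forall A B, Psi (supercomm A B) = supercomm (Psi A) (Psi B)) ->
  (forall A, (Psi A \in sl F r) = (A \in sl F r)) ->
  Psi 1%:M \in idline F r ->
  exists2 phi : 'End(psl F r), is_super_aut phi
    & forall A, A \in sl F r -> phi (proj A) = proj (Psi A).
Proof.
move=> PsiI Psie Psio PsiB Psisl Psi1.
have [c0 c0E] := vlineP _ _ Psi1.
have Psic c : exists c', Psi c%:M = c'%:M.
  exists (c * c0); rewrite -scalemx1 linearZ /= c0E scalerA.
  by rewrite scalemx1.
have phiL : linear (fun x : psl F r => proj (Psi (vsval x))).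
  by move=> c x y; rewrite !linearP.
pose phi : 'End(psl F r) := linfun (HB.pack
  (fun x : psl F r => proj (Psi (vsval x)))
  (GRing.isLinear.Build F (psl F r) (psl F r) _ _ phiL)
  : {linear psl F r -> psl F r}).
have phiE A : A \in sl F r -> phi (proj A) = proj (Psi A).
  move=> Asl; rewrite lfunE /=; have [c ->] := proj_lift Asl.
  have [c' c'E] := Psic c.
  by rewrite linearD /= c'E linearD /= proj_scalar addr0.
have phi0 : lker phi = 0%VS.
  apply/eqP; rewrite -subv0; apply/subvP => x; rewrite memv_ker memv0.
  have [A Asl <-] := psl_proj_surj x; rewrite phiE // psl_proj_eq0 ?Psisl //.
  case/vlineP => c cE.
  have c00 : c0 != 0.
    apply/eqP => c0z; have /PsiI/eqP : Psi 1%:M = 0 by rewrite c0E c0z scale0r.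
    by rewrite oner_eq0.
  have : Psi (A - (c / c0)%:M) = 0.
    by rewrite -scalemx1 linearB linearZ /= c0E cE scalerA divfK // subrr.
  by move/PsiI/eqP; rewrite subr_eq0 => /eqP->; rewrite proj_scalar.
exists phi => //; split=> // [p|x y].
  apply/eqP; rewrite eqEdim limg_dim_eq ?leqnn ?andbT; last first.
    by rewrite phi0 capv0.
  apply/subvP => _ /memv_imgP[_ /memv_imgP[A /memv_capP[Asl Ap] ->] ->].
  rewrite phiE //; apply: memv_img; rewrite memv_cap Psisl Asl.
  case: (Z2P p) Ap => -> Ap.
    by apply/(Mpart0P charF)/Psie/(Mpart0P charF).
  by apply/(Mpart1P charF)/Psio/(Mpart1P charF).
have [A Asl <-] := psl_proj_surj x; have [B Bsl <-] := psl_proj_surj y.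
rewrite psl_bracket_proj // phiE.
  by rewrite !phiE // psl_bracket_proj ?Psisl // PsiB.
exact: supercomm_sl.
Qed.

(** The product E0 A commutes with even and with odd matrices, hence is scalar. *)
Lemma E0_line A : (forall B, ev B -> A *m B = B *m A) ->
  (forall B, od B -> A *m B = - (B *m A)) -> exists c, A = c *: E0.
Proof.
move=> Ae Ao; have C B : (E0 *m A) *m B = B *m (E0 *m A).
  rewrite -[B](parts_add charF) mulmxDr mulmxDl.
  have eB := ev_evpart B; have oB := od_odpart B.
  congr (_ + _); first by rewrite -mulmxA Ae // !mulmxA eB.
  by rewrite -mulmxA Ao // mulmxN !mulmxA oB mulNmx opprK.
have E := central_scalar (m := n + n.+1) C.
exists ((E0 *m A) 0 0); rewrite -[LHS](E0E0 (p := N)) {1}E.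
by rewrite mul_mx_scalar.
Qed.

Section FromAlgebra.
Variables (Del Del' : G -> {vspace Mss F r}).
Hypotheses (DelG : is_super_grading Del) (DelG' : is_super_grading Del').
Variable Phi : 'End(M).
Hypothesis PhiI : forall A, Phi A = 0 -> A = 0.
Hypothesis PhiD : forall h A, A \in sharp Del h -> Phi A \in sharp Del' h.

Lemma Phi_inj : injective Phi.
Proof.
move=> A B E; apply/eqP; rewrite -subr_eq0; apply/eqP/PhiI.
by rewrite linearB /= E subrr.
Qed.

Lemma Phi_surj A : exists B, A = Phi B.
Proof.
have k0 : lker Phi == 0%VS by apply/lker0P/Phi_inj.
by exists (Phi^-1%VF A); rewrite lker0_lfunVK.
Qed.

Lemma Phi_parity : (forall A, ev A -> ev (Phi A)) /\ (forall A, od A -> od (Phi A)).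
Proof.
have [s [pr gG]] := super_gproj charF DelG.
have ep h A : evpart (pr h A) = if h.2 == 0 then pr h A else 0.
  case: h (gproj_in gG h A) => g p; case: (Z2P p) => -> /=.
    by move/(sharp0 charF) => [_ e]; rewrite evpart_ev.
  by move/(sharp1 charF) => [_ o]; rewrite evpart_od.
have op h A : odpart (pr h A) = if h.2 == 0 then 0 else pr h A.
  case: h (gproj_in gG h A) => g p; case: (Z2P p) => -> /=.
    by move/(sharp0 charF) => [_ e]; rewrite odpart_ev.
  by move/(sharp1 charF) => [_ o]; rewrite odpart_od.
have evD : {morph @evpart F n : A B / A + B} by move=> A B; apply: evpartD.
have odD : {morph @odpart F n : A B / A + B} by move=> A B; apply: odpartD.
have ev00 : evpart 0 = 0 :> M by apply/evpart_ev/ev0.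
have od00 : odpart 0 = 0 :> M by apply/odpart_od/od0.
split=> A eA.
  rewrite -(evpart_ev charF eA) [A](gproj_sum gG) (big_morph _ evD ev00) linear_sum.
  elim/big_ind: _ => [|B C eB eC|h _]; first exact: ev0.
    by rewrite -[B]scale1r; apply: evL.
  rewrite ep; case: eqP => h2 /=; last by rewrite linear0; apply: ev0.
  have := PhiD (gproj_in gG h A); case: h h2 => g p /= ->.
  by move/(sharp0 charF) => [].
rewrite -(odpart_od charF eA) [A](gproj_sum gG) (big_morph _ odD od00) linear_sum.
elim/big_ind: _ => [|B C eB eC|h _]; first exact: od0.
  by rewrite -[B]scale1r; apply: odL.
rewrite op; case: eqP => h2 /=; first by rewrite linear0; apply: od0.
have := PhiD (gproj_in gG h A); case: h h2 => g p /= p0.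
by case: (Z2P p) p0 => -> // _ /(sharp1 charF)[].
Qed.

Lemma Phi_Del g A : Phi A \in Del' g <-> A \in Del g.
Proof.
have [s [pr gG]] := super_gproj charF DelG.
have [s' [pr' gG']] := super_gproj charF DelG'.
have [Phie Phio] := Phi_parity.
have sh h B : Phi B \in sharp Del' h -> B \in sharp Del h.
  exact: (gproj_onto gG gG' PhiD Phi_inj).
have dec (D : G -> {vspace Mss F r}) B : is_super_grading D ->
    B \in D g <-> evpart B \in sharp D (g, 0) /\ odpart B \in sharp D (g, 1).
  move=> DG; split=> [/(super_parts charF DG)[Be Bo]|].
    split; [apply/(sharp0 charF) | apply/(sharp1 charF)]; split=> //.
      exact: ev_evpart.
    exact: od_odpart.
  move=> [/(sharp0 charF)[Be _] /(sharp1 charF)[Bo _]].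
  by rewrite -(parts_add charF B) memvD.
have ePhi : evpart (Phi A) = Phi (evpart A).
  rewrite -{1}(parts_add charF A) linearD /= evpartD.
  rewrite (evpart_ev charF (Phie _ (ev_evpart A))).
  by rewrite (evpart_od (Phio _ (od_odpart A))) addr0.
have oPhi : odpart (Phi A) = Phi (odpart A).
  rewrite -{1}(parts_add charF A) linearD /= odpartD.
  rewrite (odpart_ev (Phie _ (ev_evpart A))).
  by rewrite (odpart_od charF (Phio _ (od_odpart A))) add0r.
rewrite (dec Del') // (dec Del) // ePhi oPhi.
by split=> -[e o]; split; [apply: sh | apply: sh | apply: PhiD | apply: PhiD].
Qed.

(** The separate factors for the two parities make room for antiautomorphisms, which respect the
    superbracket only after rescaling. *)
Lemma iso_of_super_aut (Psi : 'End(M)) (al be : F) : al != 0 -> be != 0 ->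
  (forall A, Psi A = al *: Phi (evpart A) + be *: Phi (odpart A)) ->
  (forall A B, Psi (supercomm A B) = supercomm (Psi A) (Psi B)) ->
  (forall A, (Psi A \in sl F r) = (A \in sl F r)) ->
  Psi 1%:M \in idline F r ->
  iso_gradings (A := psl F r) (induced Del) (induced Del').
Proof.
move=> al0 be0 PsiE PsiB Psisl Psi1.
have [Phie Phio] := Phi_parity.
have Psie A : ev A -> Psi A = al *: Phi A.
  by move=> eA; rewrite PsiE (evpart_ev charF eA) (odpart_ev eA) linear0 scaler0 addr0.
have Psio A : od A -> Psi A = be *: Phi A.
  by move=> oA; rewrite PsiE (odpart_od charF oA) (evpart_od oA) linear0 scaler0 add0r.
have [|||||| phi phiA phiE] := @psl_super_aut Psi => //.
- move=> A; rewrite -{1}(parts_add charF A) linearD /=.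
  rewrite Psie ?Psio; [|exact: od_odpart|exact: ev_evpart].
  move=> PA0; have E : al *: evpart A + be *: odpart A = 0.
    have PZ c X : Phi (c *: X) = c *: Phi X by rewrite linearZ.
    by apply: PhiI; rewrite linearD /= (PZ al) (PZ be).
  have e0 : al *: evpart A = 0.
    have := congr1 (@evpart F n) E.
    rewrite evpartD (evpart_ev charF (evZ al (ev_evpart A))).
    by rewrite (evpart_od (odZ be (od_odpart A))) addr0 (evpart_ev charF (ev0 F n)).
  move: E; rewrite e0 add0r => o0.
  rewrite -(parts_add charF A).
  move/eqP: e0; rewrite scaler_eq0 (negPf al0) => /eqP->.
  by move/eqP: o0; rewrite scaler_eq0 (negPf be0) => /eqP->; rewrite addr0.
- by move=> A eA; rewrite Psie //; apply/evZ/Phie.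
- by move=> A oA; rewrite Psio //; apply/odZ/Phio.
exists phi => // g.
have PsiD A : A \in Del g -> Psi A \in Del' g.
  move=> Ag; have [Ae Ao] := super_parts charF DelG Ag.
  by rewrite PsiE memvD // memvZ //; apply/Phi_Del.
apply/eqP; rewrite eqEsubv; apply/andP; split; apply/subvP => x.
  case/memv_imgP => _ /memv_imgP[A /memv_capP[Asl Ag] ->] ->.
  by rewrite phiE //; apply: memv_img; rewrite memv_cap Psisl Asl PsiD.
case/memv_imgP => A /memv_capP[Asl Ag] ->.
have [Ae Ao] := super_parts charF DelG' Ag.
have [Be BeE] := Phi_surj (evpart A); have [Bo BoE] := Phi_surj (odpart A).
have Beg : Be \in Del g by apply/Phi_Del; rewrite -BeE.
have Bog : Bo \in Del g by apply/Phi_Del; rewrite -BoE.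
pose B := al^-1 *: Be + be^-1 *: Bo.
have eBe : ev Be.
  have E : Phi (odpart Be) = 0.
    have : odpart (Phi Be) = 0 by rewrite -BeE (odpart_ev (ev_evpart A)).
    rewrite -{1}(parts_add charF Be) linearD /= odpartD.
    rewrite (odpart_ev (Phie _ (ev_evpart Be))).
    by rewrite (odpart_od charF (Phio _ (od_odpart Be))) add0r.
  by rewrite -(parts_add charF Be) (PhiI E) addr0; apply: ev_evpart.
have oBo : od Bo.
  have E : Phi (evpart Bo) = 0.
    have : evpart (Phi Bo) = 0 by rewrite -BoE (evpart_od (od_odpart A)).
    rewrite -{1}(parts_add charF Bo) linearD /= evpartD.
    rewrite (evpart_ev charF (Phie _ (ev_evpart Bo))).
    by rewrite (evpart_od (Phio _ (od_odpart Bo))) addr0.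
  by rewrite -(parts_add charF Bo) (PhiI E) add0r; apply: od_odpart.
have BE : Psi B = A.
  rewrite linearD !linearZ /= (Psie _ eBe) (Psio _ oBo) !scalerA !mulVf // !scale1r.
  by rewrite -BeE -BoE parts_add.
have Bsl : B \in sl F r by rewrite -Psisl BE.
rewrite -BE -phiE //; do 2!apply: memv_img.
by rewrite memv_cap Bsl memvD ?memvZ.
Qed.

(** The trace after [Phi] again vanishes on commutators, and it agrees with the trace at the
    identity. *)
Lemma Phi_tr A : (forall x y, Phi (x *m y) = Phi x *m Phi y) \/
    (forall x y, Phi (x *m y) = Phi y *m Phi x) -> Phi 1%:M = 1%:M ->
  \tr (Phi A) = \tr A.
Proof.
move=> PM P1; pose tau (A : M) : F := \tr (Phi A).
have tauF B : tau B = \tr B * tau (delta_mx 0 0).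
  apply: (@trace_functional F (n + n.+1)) => [c x y|x y].
    by rewrite /tau linearP mxtraceD mxtraceZ.
  by rewrite /tau; case: PM => PM; rewrite !PM mxtrace_mulC.
have := tauF 1%:M; rewrite /tau P1 mxtrace1 -[X in X = _]mulr1.
by move/(mulfI (N_neq0 charF n)) => t1; rewrite -/(tau A) tauF /tau -t1 mulr1.
Qed.

Lemma iso_of_algebra_map :
  (forall x y, Phi (x *m y) = Phi x *m Phi y) \/
    (forall x y, Phi (x *m y) = Phi y *m Phi x) ->
  iso_gradings (A := psl F r) (induced Del) (induced Del').
Proof.
move=> PM; have [Phie Phio] := Phi_parity.
have P1 : Phi 1%:M = 1%:M.
  have [B BE] := Phi_surj 1%:M.
  by case: PM => PM; rewrite -[LHS]mulmx1 {2}BE -PM ?mul1mx ?mulmx1 -BE.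
have onto_ev B : ev B -> exists2 C, ev C & B = Phi C.
  have [C ->] := Phi_surj B; move=> eC; exists C => //.
  have E : Phi (odpart C) = 0.
    have : odpart (Phi C) = 0 by rewrite odpart_ev.
    rewrite -{1}(parts_add charF C) linearD /= odpartD.
    rewrite (odpart_ev (Phie _ (ev_evpart C))).
    by rewrite (odpart_od charF (Phio _ (od_odpart C))) add0r.
  by rewrite -(parts_add charF C) (PhiI E) addr0; apply: ev_evpart.
have onto_od B : od B -> exists2 C, od C & B = Phi C.
  have [C ->] := Phi_surj B; move=> eC; exists C => //.
  have E : Phi (evpart C) = 0.
    have : evpart (Phi C) = 0 by rewrite evpart_od.
    rewrite -{1}(parts_add charF C) linearD /= evpartD.
    rewrite (evpart_ev charF (Phie _ (ev_evpart C))).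
    by rewrite (evpart_od (Phio _ (od_odpart C))) addr0.
  by rewrite -(parts_add charF C) (PhiI E) add0r; apply: od_odpart.
(* [Phi E0] commutes with even and anticommutes with odd matrices. Consequently [Phi] only rescales
   supertraces and preserves [sl]. *)
have [c cE] : exists c, Phi E0 = c *: E0.
  apply: E0_line => B.
    by move/onto_ev => [C eC ->]; case: PM => PM; rewrite -!PM eC.
  by move/onto_od => [C oC ->]; case: PM => PM; rewrite -!PM oC linearN /= ?opprK.
have c0 : c != 0.
  apply/eqP => c0; have /PhiI E00 : Phi E0 = 0 by rewrite cE c0 scale0r.
  have /eqP := E02 F n; rewrite E00 mul0mx eq_sym -mxrank_eq0 mxrank1.
  by [].
have str A : \tr (E0 *m Phi A) = c^-1 * \tr (E0 *m A).
  have : c * \tr (E0 *m Phi A) = \tr (E0 *m A).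
    rewrite -mxtraceZ scalemxAl -cE -(Phi_tr (E0 *m A) PM P1).
    by case: PM => PM; rewrite PM // mxtrace_mulC.
  by move=> <-; rewrite mulKf.
have ev11 : ev 1%:M := ev1 F n.
have od1 : odpart 1%:M = 0 :> M by apply: odpart_ev.
have P1id : (1%:M : M) \in idline F r by apply: memv_line.
have evP A : evpart (Phi A) = Phi (evpart A).
  rewrite -{1}(parts_add charF A) linearD /= evpartD.
  rewrite (evpart_ev charF (Phie _ (ev_evpart A))).
  by rewrite (evpart_od (Phio _ (od_odpart A))) addr0.
have odP A : odpart (Phi A) = Phi (odpart A).
  rewrite -{1}(parts_add charF A) linearD /= odpartD.
  rewrite (odpart_ev (Phie _ (ev_evpart A))).
  by rewrite (odpart_od charF (Phio _ (od_odpart A))) add0r.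
have PB x y : Phi (x - y) = Phi x - Phi y by rewrite linearB.
have PD x y : Phi (x + y) = Phi x + Phi y by rewrite linearD.
case: PM => PM.
  apply: (@iso_of_super_aut Phi 1 1); rewrite ?oner_neq0 //.
  - by move=> A; rewrite !scale1r -PD parts_add.
  - move=> A B; rewrite !(supercommE charF) !evP !odP /br.
    by rewrite !(PB, PD) !PM.
  - by move=> A; rewrite !in_sl str mulf_eq0 invr_eq0 (negPf c0).
  by rewrite P1.
(* The negative of an antiautomorphism preserves commutators. Anticommutators of odd matrices have
   to change sign instead, hence the factor i with i^2 = -1 on the odd part. *)
have [i iE] : exists i : F, i ^+ 2 = -1.
  have [i] := @solve_monicpoly F 2 (fun i => if i == 0%N then -1 else 0) isT.
  by rewrite big_ord_recl big_ord1 /= expr0 mulr1 mul0r addr0 => <-; exists i.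
have i0 : i != 0.
  apply/eqP => i0; move/eqP: iE.
  by rewrite i0 expr0n /= eq_sym oppr_eq0 oner_eq0.
have PsiL : linear (fun A : M => - Phi (evpart A) + i *: Phi (odpart A)).
  move=> a A B; rewrite evpart_linear odpart_linear !PD.
  have PZ X : Phi (a *: X) = a *: Phi X by rewrite linearZ.
  by rewrite !PZ opprD !scalerDr addrACA scalerN !scalerA [i * a]mulrC.
pose Psi : 'End(M) := linfun (HB.pack
  (fun A : M => - Phi (evpart A) + i *: Phi (odpart A))
  (GRing.isLinear.Build F M M _ _ PsiL) : {linear M -> M}).
have PsiE A : Psi A = - Phi (evpart A) + i *: Phi (odpart A) by rewrite lfunE.
have evPsi A : evpart (Psi A) = - Phi (evpart A).
  rewrite PsiE evpartD -scaleN1r (evpart_ev charF (evZ _ (Phie _ (ev_evpart A)))).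
  by rewrite (evpart_od (odZ _ (Phio _ (od_odpart A)))) addr0.
have odPsi A : odpart (Psi A) = i *: Phi (odpart A).
  rewrite PsiE odpartD -scaleN1r (odpart_ev (evZ _ (Phie _ (ev_evpart A)))).
  by rewrite (odpart_od charF (odZ _ (Phio _ (od_odpart A)))) add0r.
have m10 : (-1 : F) != 0 by rewrite oppr_eq0 oner_eq0.
apply: (iso_of_super_aut m10 i0 (Psi := Psi)).
- by move=> A; rewrite PsiE scaleN1r.
- move=> A B; rewrite PsiE !(supercommE charF) !evPsi !odPsi.
  have := ev_evpart A; have := od_odpart A; have := ev_evpart B; have := od_odpart B.
  move: (evpart A) (odpart A) (evpart B) (odpart B) => a0 a1 b0 b1 ob eb oa ea.
  have e1 : ev (br a0 b0) by apply: br_ev.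
  have e2 : ev (a1 *m b1 + b1 *m a1).
    by rewrite -[a1 *m b1]scale1r; apply: evL; apply: odod.
  have o1 : od (br a0 b1) by apply: br_od.
  have o2 : od (br a1 b0) by rewrite /br -opprB -scaleN1r; apply/odZ; apply: br_od.
  have key (p q u t : M) : ev p -> od q -> od u -> ev t ->
      evpart (p + q + (u + t)) = p + t /\ odpart (p + q + (u + t)) = q + u.
    move=> ep oq ou et; rewrite !evpartD !odpartD (evpart_ev charF ep) (evpart_ev charF et).
    rewrite (odpart_ev ep) (odpart_ev et) (odpart_od charF oq) (odpart_od charF ou).
    by rewrite (evpart_od oq) (evpart_od ou) !(addr0, add0r).
  have [-> ->] := key _ _ _ _ e1 o1 o2 e2.
  rewrite (PD (br a0 b0)) (PD (br a0 b1)).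
  have -> : br (- Phi a0) (- Phi b0) = - Phi (br a0 b0).
    by rewrite /br PB !PM !mulmxN !mulNmx !opprK opprB.
  have -> : br (- Phi a0) (i *: Phi b1) = i *: Phi (br a0 b1).
    rewrite /br PB !PM mulNmx mulmxN -!scalemxAr -!scalemxAl opprK scalerBr.
    by rewrite addrC.
  have -> : br (i *: Phi a1) (- Phi b0) = i *: Phi (br a1 b0).
    rewrite /br PB !PM mulNmx mulmxN -!scalemxAr -!scalemxAl opprK scalerBr.
    by rewrite addrC.
  have -> : i *: Phi a1 *m (i *: Phi b1) + i *: Phi b1 *m (i *: Phi a1)
      = - Phi (a1 *m b1 + b1 *m a1).
    rewrite -!scalemxAr -!scalemxAl !scalerA -!expr2 iE !scaleN1r PD !PM -opprD.
    by rewrite addrC.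
  move: (Phi (br a0 b0)) (Phi (br a0 b1)) (Phi (br a1 b0)) => p q u.
  move: (Phi (a1 *m b1 + b1 *m a1)) => t.
  by rewrite opprD scalerDr [i *: u - t]addrC addrACA.
- move=> A; rewrite !in_sl PsiE mulmxDr mulmxN linearD linearN /= str.
  rewrite (od_tr charF (A := E0 *m (i *: _))); last first.
    by apply: evod => //; apply/odZ/Phio/od_odpart.
  rewrite addr0 oppr_eq0 mulf_eq0 invr_eq0 (negPf c0) /=.
  rewrite -[in RHS](parts_add charF A) mulmxDr linearD /=.
  rewrite (od_tr charF (A := E0 *m odpart A)) ?addr0 //.
  by apply: evod => //; apply: od_odpart.
rewrite PsiE od1 linear0 scaler0 addr0 (evpart_ev charF ev11) P1 memvN.
exact: P1id.
Qed.

End FromAlgebra.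
End Induce.

(** * From isomorphisms on psl to automorphisms and antiautomorphisms of M *)

Section FromLie.
Variables (F : closedFieldType) (charF : [pchar F] =i pred0).
Variables (G : zmodType) (n : nat) (n_gt0 : (0 < n)%N).
Local Notation r := n.+1.
Local Notation N := (r + r)%N.
Local Notation M := 'M[F]_N.
Local Notation E0 := (E0 F n).
Local Notation J := (J F n).
Local Notation proj := (psl_proj F r).
Implicit Types (A B : M).

Variables (Del Del' : G -> {vspace Mss F r}).
Hypotheses (DelG : is_super_grading Del) (DelG' : is_super_grading Del').
Variables t0 t0' : G.
Hypotheses (E0t : E0 \in Del t0) (E0t' : E0 \in Del' t0').
Hypothesis t02 : t0 *+ 2 = 0.

(** The components of a matrix in [S0] stay in [S0], because [E0] is homogeneous and the trace sees
    only degree 0. *)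
Lemma S0_homog : exists g A, [/\ A \in Del g, S0 A & A != 0].
Proof.
case: (DelG) => /gprojP[[s [pr gG]] mulG] _.
have [j ji pj] := par_other n_gt0 (lshift r ord0).
pose D : M := delta_mx j (lshift r ord0).
have SD : S0 D by apply: S0_delta.
have D0 : D != 0.
  apply/eqP => /matrixP/(_ j (lshift r ord0)); rewrite !mxE !eqxx => /eqP.
  by rewrite oner_eq0.
have trp h (X : M) : \tr X = 0 -> \tr (pr h X) = 0.
  move=> X0; have [->|h0] := eqVneq h 0; last first.
    exact: (gr_trace charF (m := n + n.+1) gG mulG (gproj_in gG h X) h0).
  have us : uniq s by case: gG.
  have := X0; rewrite {1}(gproj_sum gG X) linear_sum /= => E.
  have [s0|s0] := boolP (0 \in s).
    rewrite (bigD1_seq 0) //= big1 ?addr0 // in E => k k0.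
    exact: (gr_trace charF (m := n + n.+1) gG mulG (gproj_in gG k X) k0).
  have [->|p0] := eqVneq (pr 0 X) 0; first by rewrite mxtrace0.
  by rewrite (gproj_supp gG (gproj_in gG 0 X) p0) in s0.
have [g gD] := gproj_neq0 gG D0.
have [eD tD sD] := SD.
exists g, (pr g D); split=> //; first exact: gproj_in gG g D.
split; [|exact: trp|].
  rewrite /ev -(pr_mull (m := n + n.+1) gG mulG g D E0t).
  rewrite -(pr_mulr (m := n + n.+1) gG mulG g D E0t).
  by rewrite eD addrC.
by rewrite -(pr_mull (m := n + n.+1) gG mulG g D E0t) trp.
Qed.

Lemma algebra_map_of_iso :
  iso_gradings (A := psl F r) (induced Del) (induced Del') ->
  t0 = t0' /\ exists Phi : 'End(M),
    [/\ forall A, Phi A = 0 -> A = 0,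
        forall h A, A \in sharp Del h -> Phi A \in sharp Del' h
      & (forall x y, Phi (x *m y) = Phi x *m Phi y) \/
        (forall x y, Phi (x *m y) = Phi y *m Phi x)].
Proof.
case=> phi [phi_ker phi_part phi_mul] phi_gr.
have kphi : lker phi == 0%VS by apply/eqP.
have phiP p x : x \in sa_part (psl F r) p -> phi x \in sa_part (psl F r) p.
  by move=> xp; rewrite -phi_part memv_img.
have psiP p x : x \in sa_part (psl F r) p -> phi^-1%VF x \in sa_part (psl F r) p.
  by rewrite -{1}phi_part => /memv_imgP[y yp ->]; rewrite lker0_lfunK.
pose l0 xi : 'End(M) := linfun (HB.pack (lift0 xi)
  (GRing.isLinear.Build F M M _ _ (@lift0_linear F n xi)) : {linear M -> M}).
pose l1 xi : 'End(M) := linfun (HB.pack (lift1 xi)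
  (GRing.isLinear.Build F M M _ _ (@lift1_linear F n xi)) : {linear M -> M}).
have l0E xi A : l0 xi A = lift0 xi A by rewrite lfunE.
have l1E xi A : l1 xi A = lift1 xi A by rewrite lfunE.
pose phi0 := l0 phi; pose psi0 := l0 (phi^-1)%VF; pose phi1 := l1 phi.
have phi0P A : S0 A -> S0 (phi0 A) /\ proj (phi0 A) = phi (proj A).
  by move=> SA; rewrite /phi0 l0E; apply: lift0P.
have psi0P A : S0 A -> S0 (psi0 A) /\ proj (psi0 A) = (phi^-1)%VF (proj A).
  by move=> SA; rewrite /psi0 l0E; apply: lift0P.
have phi1P A : od A -> od (phi1 A) /\ proj (phi1 A) = phi (proj A).
  by move=> oA; rewrite /phi1 l1E; apply: lift1P.
have phi0S A : S0 A -> S0 (phi0 A) by case/phi0P.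
have psi0S A : S0 A -> S0 (psi0 A) by case/psi0P.
have phi0K A : S0 A -> psi0 (phi0 A) = A.
  move=> SA; have [Sp pE] := phi0P _ SA; have [Sq qE] := psi0P _ Sp.
  apply: (S0_proj_inj charF) => //; first by rewrite qE pE lker0_lfunK.
have psi0K A : S0 A -> phi0 (psi0 A) = A.
  move=> SA; have [Sp pE] := psi0P _ SA; have [Sq qE] := phi0P _ Sp.
  apply: (S0_proj_inj charF) => //; first by rewrite qE pE lker0_lfunVK.
have phi0B : forall A B, S0 A -> S0 B -> phi0 (br A B) = br (phi0 A) (phi0 B).
  move=> A B SA SB; have [SA' A'E] := phi0P _ SA; have [SB' B'E] := phi0P _ SB.
  have [SC' C'E] := phi0P _ (S0_br SA SB).
  apply: (S0_proj_inj charF) => //; first exact: S0_br.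
  have ev' (C : M) : S0 C -> ev C by case.
  rewrite C'E -(supercomm_ev charF (ev' _ SA) (ev' _ SB)).
  rewrite -(supercomm_ev charF (ev' _ SA') (ev' _ SB')).
  by rewrite -!psl_bracket_proj ?S0_sl // phi_mul A'E B'E.
have phi1o A : od A -> od (phi1 A) by case/phi1P.
have phi1I A : od A -> phi1 A = 0 -> A = 0.
  move=> oA E; have [_ pE] := phi1P _ oA.
  apply: (od_proj_inj charF) => //; first exact: od0.
  by apply: (lker0P kphi); rewrite -pE E !linear0.
have phi1S B : od B -> exists2 A, od A & phi1 A = B.
  move=> oB; have [oC CE] := lift1P charF psiP oB.
  exists (lift1 (phi^-1)%VF B) => //; have [oD DE] := phi1P _ oC.
  by apply: (od_proj_inj charF) => //; rewrite DE CE lker0_lfunVK.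
have phi1B A v : S0 A -> od v -> phi1 (br A v) = br (phi0 A) (phi1 v).
  move=> SA ov; have [SA' A'E] := phi0P _ SA; have [ov' v'E] := phi1P _ ov.
  have [eA _ _] := SA; have [eA' _ _] := SA'.
  have [oC CE] := phi1P _ (br_od eA ov).
  apply: (od_proj_inj charF) => //; first exact: br_od.
  rewrite CE -(supercomm_evod charF eA ov) -(supercomm_evod charF eA' ov').
  rewrite -(psl_bracket_proj (S0_sl SA) (od_sl charF ov)).
  by rewrite -(psl_bracket_proj (S0_sl SA') (od_sl charF ov')) phi_mul A'E v'E.
have phig g x : x \in induced Del g -> phi x \in induced Del' g.
  by move=> xg; rewrite -phi_gr memv_img.
have phi0g g A : S0 A -> A \in Del g -> phi0 A \in Del' g.
  by move=> SA Ag; rewrite /phi0 l0E; apply: (lift0_graded charF phiP DelG' (phig g)).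
have phi1g g A : od A -> A \in Del g -> phi1 A \in Del' g.
  by move=> oA Ag; rewrite /phi1 l1E; apply: (lift1_graded charF phiP DelG' (phig g)).
have [sg sg2 phi0E] := phi0_sign charF n_gt0 phi0S psi0S phi0K psi0K phi0B.
have [[s [pr gG]] mulG] : (exists s pr, gproj Del s pr) /\ forall g h x y,
    x \in Del g -> y \in Del h -> x *m y \in Del (g + h).
  by case: DelG => /gprojP[].
have [[s' [pr' gG']] mulG'] : (exists s pr, gproj Del' s pr) /\ forall g h x y,
    x \in Del' g -> y \in Del' h -> x *m y \in Del' (g + h).
  by case: DelG' => /gprojP[].
(* The nonzero matrix phi0 (E0 A) = sg E0 (phi0 A) has both degrees t0 + g and t0' + g. *)
have t0E : t0 = t0'.
  have [g [A [Ag SA A0]]] := S0_homog.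
  have B1 : phi0 (E0 *m A) \in Del' (t0 + g).
    by apply: phi0g; [apply: S0_E0 | apply: mulG].
  have B2 : phi0 (E0 *m A) \in Del' (t0' + g).
    by rewrite phi0E // memvZ // mulG' // phi0g.
  have B0 : phi0 (E0 *m A) != 0.
    apply: contraNneq A0 => E.
    have : psi0 (phi0 (E0 *m A)) = 0 by rewrite E linear0.
    by rewrite phi0K; [move=> /(congr1 (mulmx E0)); rewrite E0E0 mulmx0 => -> | apply: S0_E0].
  by have /addIr := gproj_inj gG' B1 B2 B0.
split=> //.
have [rho [mu [Phi [[rr mu0] PhiE PhiI Phie PM]]]] :=
  lie_lift charF n_gt0 phi0S sg2 phi0E phi1o phi1I phi1S phi1B.
exists Phi; split=> //.
have Phi1 g A : od A -> A \in Del g -> Phi A \in Del' g /\ od (Phi A).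
  move=> oA Ag; rewrite PhiE //; have oEA : od (E0 *m A) by apply: evod.
  split.
    rewrite memvZ // memvD ?phi1g // memvZ //.
    have -> : g = t0' + (t0 + g) by rewrite -t0E addrA -mulr2n t02 add0r.
    by rewrite mulG' ?phi1g ?mulG.
  apply: odZ; rewrite addrC; apply: odL; last exact: phi1o.
  by apply: evod => //; apply: phi1o.
move=> [g p] A; case: (Z2P p) => ->; last first.
  by move/(sharp1 charF) => [Ag oA]; apply/(sharp1 charF); apply: Phi1.
move/(sharp0 charF) => [Ag eA]; apply/(sharp0 charF); split; last exact: Phie.
have oJ := odJ charF n.
have oJh h : od (pr h J).
  rewrite /od -(pr_mull (m := n + n.+1) gG mulG h J E0t).
  rewrite -(pr_mulr (m := n + n.+1) gG mulG h J E0t) oJ linearN /=.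
  by rewrite addrC.
(* J J = 1 has degree 0, so it is the sum of the products J_h J_(-h) of components of J. This writes
   the even A through odd homogeneous factors, whose degrees are already under control. *)
have -> : A = \sum_(h <- s) (A *m pr h J) *m pr (- h) J.
  under eq_bigr do rewrite -mulmxA.
  rewrite -mulmx_sumr -[LHS]mulmx1; congr (_ *m _).
  have g1 := gr1 (m := n + n.+1) gG mulG.
  rewrite -[LHS](gproj_id gG g1) -(JJ F n) {1}(gproj_sum gG J) mulmx_suml linear_sum.
  apply: eq_bigr => h _ /=.
  by rewrite -(pr_mull (m := n + n.+1) gG mulG (- h) J (gproj_in gG h J)) subrr.
rewrite linear_sum memv_suml // => h _ /=.
have B1 : Phi (A *m pr h J) \in Del' (g + h).
  by apply: (Phi1 _ _ _ _).1; [apply: evod | apply: mulG => //; apply: gproj_in gG h J].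
have B2 : Phi (pr (- h) J) \in Del' (- h).
  by apply: (Phi1 _ _ _ _).1 => //; apply: gproj_in gG (- h) J.
have gE : g = g + h - h by rewrite addrK.
by case: PM => PM; rewrite PM gE; [| rewrite addrC]; apply: mulG'.
Qed.
End FromLie.

(** * Frames and the gradings Gamma *)

Section ParamFacts.
Variables (G : zmodType).

Lemma barB (t0 x y : G) : bar t0 (x - y) = bar t0 x - bar t0 y.
Proof. exact: raddfB. Qed.

Lemma bar0 (t0 : G) : bar t0 0 = 0.
Proof. exact: raddf0. Qed.

Lemma barD (t0 x y : G) : bar t0 (x + y) = bar t0 x + bar t0 y.
Proof. exact: raddfD. Qed.

Lemma cycP (t0 x : G) : t0 *+ 2 = 0 -> (x \in cyc t0) = (x == 0) || (x == t0).
Proof.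
move=> t02; apply/asboolP/orP => [[m ->]|[]/eqP->]; last 2 first.
- by exists 0; rewrite mulr0z.
- by exists 1; rewrite mulr1z.
have nat_case k : (t0 *+ k == 0) || (t0 *+ k == t0).
  rewrite -(odd_double_half k) mulrnDr -muln2 mulnC mulrnA t02 mul0rn addr0.
  by case: (odd k); rewrite ?eqxx ?orbT.
apply/orP; case: m => k; first exact: nat_case.
have Nt : - t0 = t0 by apply/eqP; rewrite eq_sym -addr_eq0 -mulr2n t02.
by rewrite NegzE mulrNz -mulNrn Nt; apply: nat_case.
Qed.

Lemma bar_eq0 (t0 x : G) : (bar t0 x == 0) = (x \in cyc t0).
Proof. by rewrite -(bar0 t0) bar_eq subr0. Qed.

Lemma bar_surj (t0 : G) (z : Gbar t0) : exists x, bar t0 x = z.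
Proof. by exists (repr z); rewrite /bar reprK. Qed.

Lemma TplusE (t0 : G) (T : {fset Gbar t0}) x : (x \in Tplus T) = (bar t0 x \in T).
Proof. by []. Qed.

Lemma Tplus_subgroup (t0 : G) (T : {fset Gbar t0}) :
  is_subgroup (mem T) -> is_subgroup (Tplus T).
Proof.
move=> [T0 TB]; split=> [|s t]; first by rewrite TplusE bar0.
by rewrite !TplusE barB; apply: TB.
Qed.

Lemma Tplus_t0 (t0 : G) (T : {fset Gbar t0}) :
  is_subgroup (mem T) -> t0 \in Tplus T.
Proof.
move=> [T0 _]; rewrite TplusE; suff -> : bar t0 t0 = 0 by [].
by apply/eqP; rewrite bar_eq0; apply/asboolP; exists 1; rewrite mulr1z.
Qed.

Lemma subgroupN (H : zmodType) (S : {pred H}) x :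
  is_subgroup S -> x \in S -> - x \in S.
Proof. by move=> [S0 SB] xS; rewrite -sub0r SB. Qed.

Lemma subgroupD (H : zmodType) (S : {pred H}) x y :
  is_subgroup S -> x \in S -> y \in S -> x + y \in S.
Proof. by move=> SG xS yS; rewrite -[y]opprK; apply: SG.2 => //; apply: subgroupN. Qed.

Variable F : fieldType.
Variable P : params F G.
Local Notation T := (p_T P).
Local Notation u := (p_u P).

Lemma Tu0 (g : G) : (((g, 0) : Gsharp G) \in Tu P) = (g \in Tplus T).
Proof. by rewrite unfold_in /= orbF. Qed.

Lemma Tu1 (g : G) : (((g, 1) : Gsharp G) \in Tu P) = (g - u \in Tplus T).
Proof. by rewrite unfold_in. Qed.

(** Twice t1 is (a, 0), and a lies in T^+. *)
Lemma Tu_subgroup a : is_subgroup (mem T) -> u *+ 2 = a -> a \in Tplus T ->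
  is_subgroup (Tu P).
Proof.
move=> TG ua aT; have SG := Tplus_subgroup TG; have [S0 SB] := SG.
split; first by have := S0; rewrite -Tu0.
have mE (g h : G) (p q c : 'Z_2) : p - q = c ->
    ((g, p) : Gsharp G) - (h, q) = (g - h, c) by move=> <-.
move=> [g p] [h q]; case: (Z2P p) => ->; case: (Z2P q) => ->.
- by rewrite !Tu0 (mE _ _ _ _ 0) ?Tu0; [apply: SB | apply/val_inj].
- rewrite Tu0 Tu1 (mE _ _ _ _ 1) ?Tu1; last exact/val_inj.
  move=> gT hT; have -> : g - h - u = g - ((h - u) + a).
    by rewrite -ua mulr2n addrA subrK opprD addrA.
  by apply: SB => //; apply: subgroupD.
- rewrite Tu0 Tu1 (mE _ _ _ _ 1) ?Tu1; last exact/val_inj.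
  by move=> gT hT; rewrite addrAC; apply: SB.
rewrite !Tu1 (mE _ _ _ _ 0) ?Tu0; last exact/val_inj.
by move=> gT hT; have := SB _ _ gT hT; rewrite opprB addrA subrK.
Qed.
End ParamFacts.

Section ElementaryMatrices.
Variables (R : nzRingType) (k : nat).
Definition el (a : R) (i j : 'I_k) : 'M[R]_k := a *: delta_mx i j.

Lemma elE a i j p q : el a i j p q = if (p == i) && (q == j) then a else 0.
Proof. by rewrite !mxE; case: (_ && _); rewrite ?mulr1 ?mulr0. Qed.

Lemma elM a b i j p q : el a i j *m el b p q = if j == p then el (a * b) i q else 0.
Proof.
apply/matrixP => s t; rewrite mxE (bigD1 j) //= big1 => [|l lj]; last first.
  by rewrite elE (negPf lj) andbF mul0r.
rewrite !elE eqxx andbT addr0 (fun_if (fun A : 'M_k => A s t)) elE mxE.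
by case: (s == i); case: (j == p); case: (t == q); rewrite ?mul0r ?mulr0.
Qed.
End ElementaryMatrices.

(** * From Gamma to frames and back *)

Section GammaFrame.
Variables (F : closedFieldType) (charF : [pchar F] =i pred0).
Variables (G : zmodType) (n : nat) (chi : char_choice F G).
Local Notation r := n.+1.
Local Notation N := (r + r)%N.
Local Notation M := 'M[F]_N.
Local Notation m := (n + n.+1)%N.
Variable P : params F G.
Hypothesis Pv : valid chi P n.

Local Notation k := (p_k P).
Local Notation gam := (tnth (p_gamma P)).

Lemma valid_k_gt0 : (0 < k)%N.
Proof. by case: Pv => _ _ _ _ [l _]; case: (k). Qed.

Lemma valid_Tu : is_subgroup (Tu P).
Proof. by case: Pv => _ TG _ [a [aT _ _] ua] _; apply: Tu_subgroup ua aT. Qed.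

Definition sh (g : G) : Gsharp G := (g, 0).

Lemma shB g h : sh (g - h) = sh g - sh h.
Proof. by rewrite /sh; congr (_, _); apply/val_inj. Qed.

Lemma shN g : sh (- g) = - sh g.
Proof. by rewrite /sh; congr (_, _); apply/val_inj. Qed.

(** The idempotent is E_00 tensor 1 for the first index 0. Then x_i is E_i0 tensor 1, of degree
    gam_i - gam_0, which explains the shift c. *)
Lemma frame_of_Gamma (Del : G -> {vspace Mss F r}) : is_Gamma chi P Del ->
  exists2 b, is_beta_u chi P b & exists c : G,
    inhabited (frame (sharp Del) (Tu P) b (fun i => sh (gam i - c) : Gsharp G)).
Proof.
move=> [DelG [b [D [DG [phi [bu [DGgr DGunit DGout [X [XP Xb]]] phiI phiC]]]]]].
exists b => //; case: phiI => [[psi phiK psiK] phiD phiZ phiM].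
pose i0 := Ordinal valid_k_gt0; exists (gam i0).
have [Tu00 TuB] := valid_Tu.
have [_ _ DGM] := DGgr.
have XU t : t \in Tu P -> X t \is a GRing.unit.
  move=> tT; have [Xn0 DGE] := XP t tT; apply: (DGunit t) => //.
  by rewrite DGE memv_line.
(* That 1 has degree 0 is derived here: X_0 is invertible and X_0 X_0 is a multiple of X_0, so X_0
   is a scalar. *)
have XX t t' : t \in Tu P -> t' \in Tu P -> t + t' = 0 ->
    exists2 c : F, c != 0 & X t * X t' = c%:A.
  move=> tT t'T tt0; have [X0n0 DG0E] := XP 0 Tu00.
  have in0 s s' : s \in Tu P -> s' \in Tu P -> s + s' = 0 ->
      exists2 c : F, c != 0 & X s * X s' = c *: X 0.
    move=> sT s'T ss0; have : X s * X s' \in DG 0.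
      by rewrite -ss0; apply: DGM; rewrite (XP _ _).2 ?memv_line.
    rewrite DG0E => /vlineP[c cE]; exists c => //.
    have U : X s * X s' \is a GRing.unit by rewrite unitrMl ?XU.
    by apply: contraTneq U => c0; rewrite cE c0 scale0r unitr0.
  have [c c0 cE] := in0 _ _ tT t'T tt0; have [d d0 dE] := in0 _ _ Tu00 Tu00 (addr0 0).
  have X0E : X 0 = d%:A.
    by apply: (mulIr (XU _ Tu00)); rewrite dE -scalerAl mul1r.
  by exists (c * d); rewrite ?mulf_neq0 // cE X0E scalerA.
have one0 : 1 \in DG 0.
  have [c c0 cE] := XX 0 0 Tu00 Tu00 (addr0 0).
  rewrite -[1](scalerK c0) memvZ // -cE -{3}[0](addr0 0).
  by apply: DGM; rewrite (XP _ Tu00).2 memv_line.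
have XV t : t \in Tu P -> (X t)^-1 \in DG (- t).
  move=> tT; have NtT := subgroupN valid_Tu tT.
  have [c c0 cE] := XX _ _ NtT tT (addNr t).
  have -> : (X t)^-1 = c^-1 *: X (- t).
    apply: (mulIr (XU _ tT)); rewrite mulVr ?XU // -scalerAl cE scalerA mulVf //.
    by rewrite scale1r.
  by rewrite memvZ // (XP _ NtT).2 memv_line.
have phi0 : phi 0 = 0 by apply: (addIr (phi 0)); rewrite -phiD !add0r.
have phi1 : phi 1%:M = 1%:M.
  by have := phiM 1%:M (psi 1%:M); rewrite mul1mx !psiK mulmx1 => <-.
have phi_el a i j (h : Gsharp G) :
    a \in DG (h - sh (gam i) + sh (gam j)) -> phi (el a i j) \in sharp Del h.
  move=> ah; case: h ah => g p ah; rewrite /sharp; apply/phiC => s t.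
  rewrite elE; case: ifP => [/andP[/eqP-> /eqP->]|_]; first exact: ah.
  exact: mem0v.
constructor.
have elMn0 a c : phi (el a i0 i0) *m phi (el c i0 i0) = phi (el (a * c) i0 i0).
  by rewrite -phiM elM eqxx.
apply: (@Frame _ _ _ _ _ _ _ _ (phi (el 1 i0 i0)) (fun i => phi (el 1 i i0))
  (fun i => phi (el 1 i0 i)) (fun t => phi (el (X t) i0 i0))
  (fun t => phi (el (X t)^-1 i0 i0))).
- rewrite (eq_bigr (fun i => phi (el 1 i i))) => [|i _]; last first.
    by rewrite -phiM elM eqxx mulr1.
  rewrite -(big_morph phi phiD phi0) -phi1; congr (phi _).
  apply/matrixP => i j; rewrite summxE (bigD1 i) //= big1 => [|l li].
    by rewrite elE eqxx addr0 !mxE eq_sym; case: eqVneq.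
  by rewrite elE eq_sym (negPf li).
- by move=> i j; rewrite -phiM elM; case: ifP => _ //; rewrite mulr1.
- by move=> i; apply: phi_el; rewrite shB addrAC subrK subrr.
- by move=> i; apply: phi_el; rewrite shB opprB addrAC subrK subrr.
- move=> t tT; apply: phi_el; rewrite subrK; have [_ ->] := XP t tT.
  exact: memv_line.
- by move=> t tT; apply: phi_el; rewrite subrK; apply: XV.
- by move=> t tT; rewrite !elMn0 mul1r mulr1.
- by move=> t tT; rewrite !elMn0 mul1r mulr1.
- by move=> t tT; rewrite elMn0 mulrV ?XU.
- by move=> t tT; rewrite elMn0 mulVr ?XU.
- move=> s t sT tT; rewrite !elMn0 Xb // -phiZ; congr (phi _).
  apply/matrixP => i j; rewrite [RHS]mxE !elE.
  by case: ifP => _; rewrite ?scaler0.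
move=> h a ah eae a0.
pose A := psi a; have aA : a = phi A by rewrite psiK.
have AE : A = el (A i0 i0) i0 i0.
  apply: (can_inj phiK); rewrite -[LHS]aA -eae aA -!phiM; congr (phi _).
  have E1 p q : (el 1 i0 i0 *m A) p q = if p == i0 then A i0 q else 0.
    rewrite mxE (bigD1 i0) //= big1 => [|l li]; last first.
      by rewrite elE (negPf li) andbF mul0r.
    by rewrite elE eqxx andbT addr0; case: ifP; rewrite ?mul1r ?mul0r.
  apply/matrixP => i j; rewrite elE mxE (bigD1 i0) //= big1 => [|l li]; last first.
    by rewrite elE (negPf li) mulr0.
  rewrite elE eqxx E1 addr0 /=.
  by case: (i == i0); case: (j == i0); rewrite ?mulr1 ?mul0r ?mulr0.
have Ah : A i0 i0 \in DG h.
  have : mxD_comp DG h A.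
    by case: h ah {eae} => g p ah; apply/phiC; rewrite -aA; apply: ah.
  by move/(_ i0 i0); rewrite subrK.
have A00 : A i0 i0 != 0.
  apply: contraNneq a0 => A0; rewrite aA AE A0 -phi0; apply/eqP; congr (phi _).
  by apply/matrixP => i j; rewrite elE mxE; case: ifP.
have hT : h \in Tu P.
  by apply: contraNT A00 => /DGout DG0; move: Ah; rewrite DG0 memv0.
split=> //; move: Ah; have [_ ->] := XP h hT => /vlineP[c cE]; exists c.
rewrite aA AE cE -phiZ; congr (phi _); apply/matrixP => i j.
by rewrite [RHS]mxE !elE; case: ifP => _; rewrite ?scaler0.
Qed.
End GammaFrame.

Section CornerAlgebra.
Variables (F : fieldType) (m : nat).
Local Notation M := 'M[F]_m.+1.

(** Turns e M e into an abstract algebra with unit e, the form in which the definition of Gamma asks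
    for D. *)
Lemma corner_algebra (e : M) : e *m e = e -> e != 0 ->
  exists (D : falgType F) (io : 'Hom(D, M)),
    [/\ injective io, io 1 = e, forall a b, io (a * b) = io a *m io b,
        forall a, e *m io a *m e = io a
      & forall A, e *m A *m e = A -> exists a, io a = A].
Proof.
move=> ee e0; pose U : {vspace M} := limg (amulr e \o amull e)%VF.
have UP A : reflect (e *m A *m e = A) (A \in U).
  apply: (iffP memv_imgP) => [[B _ ->]|E]; last first.
    by exists A; rewrite ?memvf // comp_lfunE !lfunE /=.
  by rewrite comp_lfunE !lfunE /= -!mulmxE !mulmxA ee -!mulmxA ee.
have Uel A : A \in U -> e *m A = A.
  by move=> /UP <-; rewrite !mulmxA ee.
have Uer A : A \in U -> A *m e = A.
  by move=> /UP <-; rewrite -!mulmxA ee.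
have Ua : is_aspace U.
  apply/andP; split.
    apply/has_algidP; exists e; split=> //; first by apply/UP; rewrite ee.
    by move=> u uU; rewrite -!mulmxE Uel ?Uer.
  apply/prodvP => u v uU vU; apply/UP; rewrite -!mulmxE mulmxA (Uel _ uU).
  by rewrite -mulmxA (Uer _ vU).
pose A := ASpace Ua; exists (subvs_of A).
exists (linfun (vsval : subvs_of A -> M)); split.
- by move=> a b; rewrite !lfunE /= => /val_inj.
- rewrite lfunE /=; have eA : e \in A by apply/UP; rewrite ee.
  rewrite -[LHS](Uer (val (1 : subvs_of A))) ?subvsP //.
  exact: (@algidl _ _ A e eA).
- by move=> a b; rewrite !lfunE.
- by move=> a; rewrite lfunE; apply/UP/subvsP.
by move=> B /UP BU; exists (Subvs BU); rewrite lfunE.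
Qed.
End CornerAlgebra.

Section FrameGamma.
Variables (F : closedFieldType) (charF : [pchar F] =i pred0).
Variables (G : zmodType) (n : nat) (chi : char_choice F G).
Local Notation r := n.+1.
Local Notation N := (r + r)%N.
Local Notation M := 'M[F]_N.
Local Notation m := (n + n.+1)%N.
Variable P : params F G.
Local Notation k := (p_k P).
Local Notation gam := (tnth (p_gamma P)).

(** D is the corner of the frame; a matrix A over D corresponds to the sum of the x_i A_ij y_j, and
    conversely B has entries y_i B x_j. *)
Lemma Gamma_of_frame (Del : G -> {vspace Mss F r}) b :
  is_super_grading Del -> is_beta_u chi P b ->
  frame (sharp Del) (Tu P) b (fun i => sh (gam i)) -> is_Gamma chi P Del.
Proof.
move=> DelG bu fr; have [s [pr gG]] := super_gproj charF DelG.
have mulG := super_mul charF DelG.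
have [D [io [ioI io1 ioM ioe ioS]]] :=
  corner_algebra (m := m) (fr_ee fr) (fr_e_neq0 fr).
pose oi := (io^-1)%VF.
have ioK : cancel io oi by apply: lker0_lfunK; apply/lker0P.
have oiK A : fr_e fr *m A *m fr_e fr = A -> io (oi A) = A.
  by case/ioS => a <-; rewrite ioK.
have ioel a : fr_e fr *m io a = io a by rewrite -ioe !mulmxA (fr_ee fr).
have ioer a : io a *m fr_e fr = io a by rewrite -ioe -!mulmxA (fr_ee fr).
pose DG h : {vspace D} := (io @^-1: sharp Del h)%VS.
have DGE h a : (a \in DG h) = (io a \in sharp Del h) by rewrite memv_preim.
have e0 := fr_e0 mulG fr.
have corner_pr h a : fr_e fr *m pr h (io a) *m fr_e fr = pr h (io a).
  have El : pr h (fr_e fr *m io a) = fr_e fr *m pr h (io a).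
    by rewrite -{1}[h]add0r (pr_mull (m := m) gG mulG _ _ e0).
  have Er : pr h (io a *m fr_e fr) = pr h (io a) *m fr_e fr.
    by rewrite -{1}[h]addr0 (pr_mulr (m := m) gG mulG _ _ e0).
  by rewrite -El ioel -Er ioer.
have [us prG prE prs] := gG.
have X_io t : t \in Tu P -> io (oi (fr_X fr t)) = fr_X fr t.
  by move=> tT; rewrite oiK // (fr_eXe fr).
split=> //; exists b, D, DG.
exists (fun A => \sum_i \sum_j fr_x fr i *m io (A i j) *m fr_y fr j).
have phiK (A : 'M[D]_k) p q :
    fr_y fr p *m (\sum_i \sum_j fr_x fr i *m io (A i j) *m fr_y fr j) *m fr_x fr q
    = io (A p q).
  rewrite mulmx_sumr mulmx_suml (bigD1 p) //= [X in _ + X]big1 => [|i ip]; last first.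
    rewrite mulmx_sumr mulmx_suml big1 // => j _.
    by rewrite !mulmxA fr_orth eq_sym (negPf ip) !mul0mx.
  rewrite addr0 mulmx_sumr mulmx_suml (bigD1 q) //= big1 => [|j jq]; last first.
    by rewrite -!mulmxA fr_orth (negPf jq) !mulmx0.
  by rewrite !mulmxA fr_orth eqxx ioel -mulmxA fr_orth eqxx ioer addr0.
split=> //.
- split.
  + apply/gprojP; split; last by move=> g h a a' ag ah; rewrite DGE ioM mulG -?DGE.
    exists s, (fun h => (oi \o pr h \o io)%VF); split=> //.
    * by move=> h a; rewrite DGE !comp_lfunE oiK.
    * move=> g h a; rewrite DGE !comp_lfunE => /prE->.
      by case: ifP => _; rewrite ?ioK ?linear0.
    move=> a; apply: ioI; rewrite linear_sum {1}(prs (io a)); apply: eq_bigr => h _.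
    by rewrite /= !comp_lfunE oiK.
  + move=> h a; rewrite DGE => ah a0.
    have ia0 : io a != 0 by rewrite -(linear0 io) (inj_eq ioI).
    have [hT [c cE]] := fr_line fr ah (ioe a) ia0.
    have c0 : c != 0 by apply: contraNneq ia0 => c0; rewrite cE c0 scale0r.
    have Y_io : io (oi (fr_Y fr h)) = fr_Y fr h by rewrite oiK // (fr_eYe fr).
    apply/unitrP; exists (c^-1 *: oi (fr_Y fr h)).
    by split; apply: ioI; rewrite ioM linearZ /= Y_io cE io1
      -?scalemxAl -?scalemxAr ?scalemxAr scalerA ?mulVf ?mulfV // scale1r
      ?(fr_YX fr) ?(fr_XY fr).
  + move=> h hT; apply/eqP; rewrite -subv0; apply/subvP => a; rewrite DGE memv0.
    move=> ah; apply: contraNT hT => a0.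
    have ia0 : io a != 0 by rewrite -(linear0 io) (inj_eq ioI).
    by have [] := fr_line fr ah (ioe a) ia0.
  exists (fun t => oi (fr_X fr t)); split=> [t tT|t t' tT t'T]; last first.
    by apply: ioI; rewrite linearZ /= !ioM !X_io // (fr_comm fr).
  have X0 : oi (fr_X fr t) != 0.
    apply: contraNneq (fr_X_neq0 fr tT) => E.
    by rewrite -(X_io t tT) E linear0.
  split=> //; apply: subv_anti; apply/andP; split; last first.
    by rewrite -memvE DGE X_io // (fr_degX fr).
  apply/subvP => a; rewrite DGE => at_.
  have [c cE] := fr_line_X at_ (ioel a) (ioer a) tT.
  by apply/vlineP; exists c; apply: ioI; rewrite linearZ /= X_io.
- split.
  + exists (fun B => \matrix_(i, j) oi (fr_y fr i *m B *m fr_x fr j)).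
      move=> A; apply/matrixP => p q; rewrite mxE phiK; exact: ioK.
    move=> B; transitivity (1%:M *m B *m 1%:M); last by rewrite mul1mx mulmx1.
    rewrite -(fr_sum fr) mulmx_suml mulmx_suml; apply: eq_bigr => i _.
    rewrite mulmx_sumr; apply: eq_bigr => j _.
    rewrite mxE oiK ?mulmxA // fr_ey -!mulmxA.
    by rewrite fr_xe.
  + move=> A B; rewrite -big_split; apply: eq_bigr => i _ /=.
    rewrite -big_split; apply: eq_bigr => j _ /=.
    by rewrite mxE linearD /= mulmxDr mulmxDl.
  + move=> c A; rewrite scaler_sumr; apply: eq_bigr => i _ /=.
    rewrite scaler_sumr; apply: eq_bigr => j _ /=.
    by rewrite mxE linearZ /= -scalemxAr -scalemxAl.
  move=> A B; rewrite mulmx_suml; apply: eq_bigr => i _.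
  rewrite mulmx_sumr; under [RHS]eq_bigr => l _ do rewrite mulmx_suml.
  transitivity (\sum_j \sum_l fr_x fr i *m io (A i l * B l j) *m fr_y fr j).
    apply: eq_bigr => j _; rewrite mxE linear_sum mulmx_sumr mulmx_suml.
    by apply: eq_bigr.
  transitivity (\sum_l \sum_j fr_x fr i *m io (A i l * B l j) *m fr_y fr j).
    exact: exchange_big.
  rewrite [RHS]exchange_big /=.
  transitivity (\sum_p fr_x fr i *m io (A i p) *m fr_y fr p
    *m (\sum_j fr_x fr p *m io (B p j) *m fr_y fr j)).
    apply: eq_bigr => p _; rewrite mulmx_sumr; apply: eq_bigr => j _.
    transitivity (fr_x fr i *m (io (A i p) *m (fr_y fr p *m fr_x fr p)
      *m io (B p j)) *m fr_y fr j); last by rewrite !mulmxA.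
    by rewrite fr_orth eqxx ioer ioM.
  apply: eq_bigr => p _; rewrite [RHS](bigD1 p) //= [X in _ + X]big1 ?addr0 // => l lp.
  rewrite mulmx_sumr big1 // => j _.
  transitivity (fr_x fr i *m (io (A i p) *m (fr_y fr p *m fr_x fr l)
    *m io (B l j)) *m fr_y fr j); first by rewrite !mulmxA.
  by rewrite fr_orth eq_sym (negPf lp) mulmx0 mul0mx mulmx0 mul0mx.
move=> g p A; split=> [Agp|].
  rewrite -[(_ :&: _)%VS]/(sharp Del (g, p)).
  apply: memv_suml => i _; apply: memv_suml => j _.
  have := Agp i j; rewrite DGE => ij.
  have -> : ((g, p) : Gsharp G) = sh (gam i) + ((g, p) - sh (gam i) + sh (gam j)) - sh (gam j).
    by rewrite addrA addrK addrC subrK.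
  have xA := super_mul charF DelG (fr_degx fr i) ij.
  by have := super_mul charF DelG xA (fr_degy fr j).
rewrite -[(_ :&: _)%VS]/(sharp Del (g, p)) => Agp i j; rewrite DGE -phiK.
rewrite [_ - _]addrC; have yA := super_mul charF DelG (fr_degy fr i) Agp.
by have := super_mul charF DelG yA (fr_degx fr j).
Qed.
End FrameGamma.

(** * Bicharacters and operations on frames *)

Section Bicharacters.
Variables (F : fieldType) (H : zmodType) (S : {pred H}) (b : H -> H -> F).
Hypotheses (SG : is_subgroup S) (bB : is_bichar S b).

Lemma bichar_neq0 s t : s \in S -> t \in S -> b s t != 0.
Proof. by move=> sS tS; case: (bB.1 s sS) => ->. Qed.

Lemma bicharDr s t u : s \in S -> t \in S -> u \in S ->
  b s (t + u) = b s t * b s u.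
Proof. by move=> sS tS uS; case: (bB.1 s sS) => _ ->. Qed.

Lemma bicharDl s t u : s \in S -> t \in S -> u \in S ->
  b (t + u) s = b t s * b u s.
Proof. by move=> sS tS uS; case: (bB.2 s sS) => _ ->. Qed.

Lemma bichar0l t : t \in S -> b 0 t = 1.
Proof.
move=> tS; have S0 := SG.1; apply: (mulIf (bichar_neq0 S0 tS)).
by rewrite -bicharDl // addr0 mul1r.
Qed.

Lemma bichar_sym s t : alternating S b -> s \in S -> t \in S ->
  b s t * b t s = 1.
Proof.
move=> alt sS tS; have stS := subgroupD SG sS tS; have := alt _ stS.
by rewrite bicharDl // !bicharDr // !alt // mulr1 mul1r.
Qed.

Lemma bichar_symV s t : alternating S b -> s \in S -> t \in S ->
  b t s = (b s t)^-1.
Proof.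
move=> alt sS tS; apply: (mulfI (bichar_neq0 sS tS)).
by rewrite bichar_sym // divff // bichar_neq0.
Qed.
End Bicharacters.

Section Frames.
Variables (F : closedFieldType) (m : nat) (H : zmodType).
Local Notation M := 'M[F]_m.+1.

Lemma frame_map (Gam Gam' : H -> {vspace M}) (T : {pred H}) b k
    (gam : 'I_k -> H) (f : 'End(M)) :
  frame Gam T b gam -> injective f -> f 1%:M = 1%:M ->
  (forall A B, f (A *m B) = f A *m f B) ->
  (forall h A, A \in Gam h -> f A \in Gam' h) ->
  (forall h A, A \in Gam' h -> exists2 B, B \in Gam h & A = f B) ->
  frame Gam' T b gam.
Proof.
move=> fr fI f1 fM fG fS.
apply: (@Frame _ _ _ _ _ _ _ _ (f (fr_e fr)) (fun i => f (fr_x fr i))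
  (fun i => f (fr_y fr i)) (fun t => f (fr_X fr t)) (fun t => f (fr_Y fr t))).
- rewrite -f1 -(fr_sum fr) linear_sum; apply: eq_bigr => i _ /=.
  by rewrite fM.
- by move=> i j; rewrite -fM fr_orth; case: ifP => _; rewrite ?linear0.
- by move=> i; apply/fG/(fr_degx fr).
- by move=> i; apply/fG/(fr_degy fr).
- by move=> t tT; apply/fG/(fr_degX fr).
- by move=> t tT; apply/fG/(fr_degY fr).
- by move=> t tT; rewrite -!fM fr_eXe.
- by move=> t tT; rewrite -!fM fr_eYe.
- by move=> t tT; rewrite -!fM fr_XY.
- by move=> t tT; rewrite -!fM fr_YX.
- by move=> s t sT tT; rewrite -!fM (fr_comm fr) // linearZ.
move=> h _ /fS[A Ah ->]; rewrite -!fM => /fI eAe fA0.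
have A0 : A != 0 by apply: contraNneq fA0 => ->; rewrite linear0.
have [hT [c cE]] := fr_line fr Ah eAe A0.
by split=> //; exists c; rewrite cE linearZ.
Qed.

(** An antiautomorphism exchanges the roles of x_i and y_i, which negates the gam_i, and reverses
    the products of the X_t, which transposes b; the X_t keep their degrees. *)
Lemma frame_map_anti (Gam Gam' : H -> {vspace M}) (T : {pred H}) b k
    (gam : 'I_k -> H) (f : 'End(M)) :
  frame Gam T b gam -> injective f -> f 1%:M = 1%:M ->
  (forall A B, f (A *m B) = f B *m f A) ->
  (forall h A, A \in Gam h -> f A \in Gam' h) ->
  (forall h A, A \in Gam' h -> exists2 B, B \in Gam h & A = f B) ->
  frame Gam' T (fun s t => b t s) (fun i => - gam i).
Proof.
move=> fr fI f1 fM fG fS.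
apply: (@Frame _ _ _ _ _ _ _ _ (f (fr_e fr)) (fun i => f (fr_y fr i))
  (fun i => f (fr_x fr i)) (fun t => f (fr_X fr t)) (fun t => f (fr_Y fr t))).
- rewrite -f1 -(fr_sum fr) linear_sum; apply: eq_bigr => i _ /=.
  by rewrite fM.
- by move=> i j; rewrite -fM fr_orth eq_sym; case: ifP => _; rewrite ?linear0.
- by move=> i; apply/fG/(fr_degy fr).
- by move=> i; rewrite opprK; apply/fG/(fr_degx fr).
- by move=> t tT; apply/fG/(fr_degX fr).
- by move=> t tT; apply/fG/(fr_degY fr).
- by move=> t tT; rewrite -!fM mulmxA fr_eXe.
- by move=> t tT; rewrite -!fM mulmxA fr_eYe.
- by move=> t tT; rewrite -!fM fr_YX.
- by move=> t tT; rewrite -!fM fr_XY.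
- by move=> s t sT tT; rewrite -!fM (fr_comm fr) // linearZ.
move=> h _ /fS[A Ah ->]; rewrite -!fM mulmxA => /fI eAe fA0.
have A0 : A != 0 by apply: contraNneq fA0 => ->; rewrite linear0.
have [hT [c cE]] := fr_line fr Ah eAe A0.
by split=> //; exists c; rewrite cE linearZ.
Qed.

(* Multiplying x_i by a unit of degree -s_i of the division algebra and y_i by
   its inverse shifts gam_i by s_i. *)
Lemma frame_reindex (Gam : H -> {vspace M}) (T T' : {pred H}) b b' k k'
    (gam : 'I_k -> H) (gam' : 'I_k' -> H) (p : 'I_k' -> 'I_k)
    (mulG : forall g h x y, x \in Gam g -> y \in Gam h -> x *m y \in Gam (g + h)) :
  frame Gam T b gam -> bijective p -> (forall i, gam' i - gam (p i) \in T) ->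
  T =i T' -> {in T &, forall s t, b s t = b' s t} -> frame Gam T' b' gam'.
Proof.
move=> fr pB gT TT' bb'.
apply: (@Frame _ _ _ _ _ _ _ _ (fr_e fr)
  (fun i => fr_x fr (p i) *m fr_X fr (gam' i - gam (p i)))
  (fun i => fr_Y fr (gam' i - gam (p i)) *m fr_y fr (p i)) (fr_X fr) (fr_Y fr)).
- rewrite -(fr_sum fr) [RHS](reindex p) /=; last exact: onW_bij.
  apply: eq_bigr => i _; rewrite mulmxA -[_ *m fr_Y fr _]mulmxA.
  by rewrite fr_XY // -mulmxA fr_ey.
- move=> i j; rewrite mulmxA -[_ *m fr_x fr _]mulmxA fr_orth (bij_eq pB).
  case: eqVneq => [->|_]; first by rewrite (fr_Ye fr) // fr_YX.
  by rewrite mulmx0 mul0mx.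
- move=> i; have := mulG _ _ _ _ (fr_degx fr (p i)) (fr_degX fr (gT i)).
  by rewrite [gam _ + _]addrC subrK.
- move=> i; have := mulG _ _ _ _ (fr_degY fr (gT i)) (fr_degy fr (p i)).
  by rewrite -opprD subrK.
- by move=> t; rewrite -TT'; apply: (fr_degX fr).
- by move=> t; rewrite -TT'; apply: (fr_degY fr).
- by move=> t; rewrite -TT'; apply: fr_eXe.
- by move=> t; rewrite -TT'; apply: fr_eYe.
- by move=> t; rewrite -TT'; apply: fr_XY.
- by move=> t; rewrite -TT'; apply: fr_YX.
- by move=> s t; rewrite -!TT' => sT tT; rewrite -bb' // (fr_comm fr).
by move=> h a; rewrite -TT'; apply: fr_line.
Qed.
End Frames.

Lemma shDp (G : zmodType) (g h : G) p : sh g + ((h, p) : Gsharp G) = (g + h, p).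
Proof. by rewrite /sh; congr (_, _); rewrite /= add0r. Qed.

(** * The bicharacter on T_u and the degree of [E0] *)

Section BetaU.
Variables (F : closedFieldType) (charF : [pchar F] =i pred0).
Variables (G : zmodType) (n : nat) (chi : char_choice F G).
Hypothesis chi_ok : char_choice_ok chi.
Local Notation r := n.+1.
Local Notation N := (r + r)%N.
Local Notation M := 'M[F]_N.
Local Notation m := (n + n.+1)%N.
Variable P : params F G.
Hypothesis Pv : valid chi P n.
Local Notation t0 := (p_t0 P).
Local Notation T := (p_T P).

Lemma valid_t02 : t0 *+ 2 = 0.
Proof. by case: Pv => -[]. Qed.

Lemma valid_T : is_subgroup (mem T).
Proof. by case: Pv. Qed.

Lemma t1_Tu : t1 P \in Tu P.
Proof. by rewrite Tu1 subrr; case: (Tplus_subgroup valid_T). Qed.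

Lemma Tu_cases s : s \in Tu P ->
  (exists2 t, t \in Tplus T & s = sh t) \/
  (exists2 t, t \in Tplus T & s = t1 P + sh t).
Proof.
case: s => g p; case: (Z2P p) => ->; first by rewrite Tu0; left; exists g.
rewrite Tu1; right; exists (g - p_u P) => //.
by rewrite /sh /t1; congr (_, _); [rewrite /= addrC subrK | apply/val_inj].
Qed.

Lemma Tu_sh t : t \in Tplus T -> sh t \in Tu P.
Proof. by rewrite Tu0. Qed.

Variable b : Gsharp G -> Gsharp G -> F.
Hypothesis bu : is_beta_u chi P b.

(** t0 is in the radical of beta^+, and its pairing with t1 is the inverse of chi(t0) = -1. *)
Lemma beta_u_t0 s : s \in Tu P -> b (sh t0) s = if s.2 == 0 then 1 else -1.
Proof.
case: bu => -[bB alt _] bT b1 sT.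
have TuG := valid_Tu Pv; have t0T := Tplus_t0 valid_T.
have [b0 _] : b (sh t0) (t1 P) = -1 /\ True.
  split=> //; rewrite (bichar_symV TuG bB alt t1_Tu (Tu_sh t0T)) b1 //.
  by have [_ ->] := chi_ok (let: And5 o _ _ _ _ := Pv in o) valid_T; rewrite invrN1.
have be0 t : t \in Tplus T -> b (sh t0) (sh t) = 1.
  move=> tT; rewrite bT //; have -> : bar t0 t0 = bar t0 0.
    by apply/eqP; rewrite bar_eq subr0 cycP ?valid_t02 // eqxx orbT.
  rewrite bar0; case: Pv => _ TG [betaB _ _] _ _; exact: (bichar0l TG betaB).
case: (Tu_cases sT) => -[t tT ->]; first by rewrite be0.
by rewrite (bicharDr bB) ?t1_Tu ?Tu_sh // b0 be0 // mulr1.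
Qed.

(** The diagonal copy of X_t0 commutes with even and anticommutes with odd matrices, so it is a
    multiple of [E0]. *)
Lemma E0_deg (Del : G -> {vspace Mss F r}) k (g : 'I_k -> G) :
  is_super_grading Del -> frame (sharp Del) (Tu P) b (fun i => sh (g i)) ->
  E0 F n \in Del t0.
Proof.
move=> DelG fr; have mulG := super_mul charF DelG.
have [s [pr gG]] := super_gproj charF DelG.
have t0T : sh t0 \in Tu P by rewrite Tu_sh // (Tplus_t0 valid_T).
pose C : M := fr_hat fr (sh t0).
have CA (A : M) : C *m evpart A = evpart A *m C /\
    C *m odpart A = - (odpart A *m C).
  move: A; apply: (fr_ind (m := m) gG mulG (fr := fr)) => [|c A' B [CAe CAo] [CBe CBo]|].
  - by rewrite (evpart_ev charF (ev0 _ _)) (odpart_ev (ev0 _ _)) !mulmx0 !mul0mx oppr0.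
  - rewrite evpart_linear odpart_linear.
    move: (evpart A') (odpart A') (evpart B) (odpart B) CAe CAo CBe CBo.
    move=> a a' d d' CAe CAo CBe CBo; rewrite !mulmxDr !mulmxDl -!scalemxAr -!scalemxAl.
    by rewrite CAe CAo CBe CBo opprD scalerN.
  move=> i j [g' p]; case: (Z2P p) => -> tT;
    set A := fr_x fr i *m fr_X fr _ *m fr_y fr j;
    (have CAE : C *m A = _ *: (A *m C) := fr_hat_comm (m := m) fr i j t0T tT);
    have := fr_degE (m := m) mulG fr i j tT;
    rewrite -/A; move: CAE; rewrite beta_u_t0 //=.
    rewrite scale1r => CAE degA.
    have eA : ev A.
      have /sharp0 [] // : A \in sharp Del (g i - g j + g', 0).
      by move: degA; rewrite -shB shDp.
    by rewrite (evpart_ev charF eA) (odpart_ev eA) !mulmx0 mul0mx oppr0.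
  rewrite scaleN1r => CAE degA.
  have oA : od A.
    have /sharp1 [] // : A \in sharp Del (g i - g j + g', 1).
    by move: degA; rewrite -shB shDp.
  by rewrite (evpart_od oA) (odpart_od charF oA) mulmx0 mul0mx.
have [|B oB|c CE] := E0_line charF (A := C).
- by move=> B eB; have [] := CA B; rewrite (evpart_ev charF eB).
- by have [] := CA B; rewrite (odpart_od charF oB).
have C0 : C != 0 by exact: (fr_hat_neq0 (m := m) fr t0T).
have c0 : c != 0 by apply: contraNneq C0 => c0; rewrite CE c0 scale0r.
have := fr_hat_deg (m := m) mulG fr t0T; rewrite -/C => /(sharp0 charF)[CD _].
by rewrite -[E0 F n](scalerK c0) -CE memvZ.
Qed.
End BetaU.

(** * The isomorphism criterion *)

Section Translates.
Variables (G : zmodType) (t0 t0' : G) (T : {fset Gbar t0}) (T' : {fset Gbar t0'}).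
Hypothesis TG : is_subgroup (mem T).
Hypothesis TT' : Tplus T =i Tplus T'.
Local Notation S := ([set` Tplus T])%classic.
Local Notation S' := ([set` Tplus T'])%classic.

Lemma translate_eq (x y : G) : (translate x S = translate y S) <-> x - y \in Tplus T.
Proof.
have [S0 SB] := Tplus_subgroup TG.
split=> [E|xy].
  have : translate x S x by exists 0 => //; rewrite addr0.
  by rewrite E => -[z /= zS <-]; rewrite addrC addKr.
have sub a c : a - c \in Tplus T -> (translate a S `<=` translate c S)%classic.
  move=> acT _ [z /= zS <-]; exists (a - c + z); last by rewrite addrA [c + _]addrC subrK.
  by rewrite /= (subgroupD (Tplus_subgroup TG)).
apply/seteqP; split; apply: sub => //.
by rewrite -opprB (subgroupN (Tplus_subgroup TG)).
Qed.

Lemma translateS : S = S'.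
Proof. by apply/seteqP; split=> x /=; rewrite TT'. Qed.

Lemma translateD (g x : G) : translate g (translate x S) = translate (g + x) S.
Proof.
apply/seteqP; split=> [_ [_ [z zS <-] <-]|_ [z zS <-]].
  by exists z; rewrite ?addrA.
by exists (x + z); rewrite ?addrA //; exists z.
Qed.

Lemma act_XiP (g : G) (s s' : seq G) :
  mset_act g (Xi T s) = Xi T' s' <->
  perm_eq [seq translate (g + x) S | x <- s] [seq translate x S | x <- s'].
Proof.
rewrite /mset_act {2}/Xi -translateS.
have -> : [seq translate (g + x) S | x <- s]
    = [seq translate g C | C <- [seq translate x S | x <- s]].
  by rewrite -map_comp; apply: eq_map => x; rewrite /= translateD.
have E : perm_eq [seq translate g C | C <- Xi T s]
    [seq translate g C | C <- [seq translate x S | x <- s]].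
  by apply/perm_map/perm_eq_seq_mset.
split=> [/eq_seq_msetP E'|E'].
  by apply: perm_trans E'; rewrite perm_sym.
by apply/eq_seq_msetP; apply: perm_trans E'.
Qed.

(** Both multisets consist of cosets of T^+, so comparing the multiplicity of each coset is
    enough. *)
Lemma act_Xi_count (g : G) (s s' : seq G) :
  (forall z, count (fun x => g + x - z \in Tplus T) s
             = count (fun x => x - z \in Tplus T) s') ->
  mset_act g (Xi T s) = Xi T' s'.
Proof.
move=> cE; apply/act_XiP.
have cnt z (f : G -> G) l : count_mem (translate z S) [seq translate (f x) S | x <- l]
    = count (fun x => f x - z \in Tplus T) l.
  rewrite count_map; apply: eq_count => x /=.
  by apply/eqP/idP => /translate_eq.
apply/allP => C _ /=; apply/eqP.
have [[z ->]|nC] := pselect (exists z, C = translate z S).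
  by rewrite cnt (cnt _ id) cE.
rewrite !(count_memPn _) //; apply/negP => /mapP[x _ E]; apply: nC.
  by exists x.
by exists (g + x).
Qed.
End Translates.

Lemma count_tnth (A : Type) k (t : k.-tuple A) (a : pred A) :
  count a t = #|[pred i | a (tnth t i)]|.
Proof.
rewrite -{1}(map_tnth_enum t) count_map -size_filter cardE; congr (size _).
by rewrite /enum_mem -filter_predI; apply: eq_filter => i; rewrite /= ?andbT.
Qed.

(** The type of T depends on t0, so equality of the preimages in G is transported to equality of the
    sets before the chosen characters are compared. *)
Lemma chi_eq (F : fieldType) (G : zmodType) (chi : char_choice F G) t0 t0'
    (T : {fset Gbar t0}) (T' : {fset Gbar t0'}) :
  t0 = t0' -> Tplus T =i Tplus T' -> chi t0 T = chi t0' T'.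
Proof.
move=> E; case: t0' / E T' => T' TT'; congr (chi _ _).
by apply/fsetP => z; have [x <-] := bar_surj z; apply: TT'.
Qed.

Section Signs.
Variables (delta : int) (dE : delta = 1 \/ delta = -1).

Lemma t1Z (F : fieldType) (G : zmodType) (P : params F G) :
  t1 P *~ delta = (p_u P *~ delta, 1).
Proof.
case: dE => ->; first by rewrite !mulr1z.
by rewrite !mulrN1z; congr (_, _); apply/val_inj.
Qed.

Lemma subgroupZ (H : zmodType) (S : {pred H}) x :
  is_subgroup S -> x \in S -> x *~ delta \in S.
Proof.
by case: dE => ->; rewrite ?mulr1z ?mulrN1z //; apply: subgroupN.
Qed.

Lemma bicharZ (F : fieldType) (H : zmodType) (S : {pred H}) (b : H -> H -> F) s t :
  is_subgroup S -> is_bichar S b -> s \in S -> t \in S ->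
  b (s *~ delta) t ^ delta = b s t.
Proof.
move=> SG bB sS tS; case: dE => ->; rewrite ?mulr1z ?expr1z // mulrN1z exprN1.
have NsS := subgroupN SG sS.
apply: (mulfI (bichar_neq0 bB NsS tS)); rewrite divff ?(bichar_neq0 bB) //.
by rewrite -(bicharDl bB) // addNr (bichar0l SG bB).
Qed.
End Signs.

Section Necessity.
Variables (F : closedFieldType) (charF : [pchar F] =i pred0).
Variables (G : zmodType) (n : nat) (chi : char_choice F G).
Hypothesis chi_ok : char_choice_ok chi.
Variables (P P' : params F G) (Pv : valid chi P n) (P'v : valid chi P' n).
Hypothesis t0E : p_t0 P = p_t0 P'.
Variables (b b' : Gsharp G -> Gsharp G -> F).
Hypotheses (bu : is_beta_u chi P b) (bu' : is_beta_u chi P' b').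
Variables (delta : int) (dE : delta = 1 \/ delta = -1).

(** Two frames of one grading share T, b and, up to a shift, the cosets of the gam_i. This is
    translated into the parameters, u being read off the odd coset. *)
Lemma equiv_of_frames m (Gam : Gsharp G -> {vspace 'M[F]_m.+1}) s pr c c' :
  gproj Gam s pr ->
  (forall g h x y, x \in Gam g -> y \in Gam h -> x *m y \in Gam (g + h)) ->
  frame Gam (Tu P) (fun s t => b s t ^ delta)
    (fun i => sh ((tnth (p_gamma P) i - c) *~ delta)) ->
  frame Gam (Tu P') b' (fun i => sh (tnth (p_gamma P') i - c')) ->
  equiv_params P P'.
Proof.
move=> gG mulG fr fr'.
have TuE : Tu P =i Tu P'.
  by move=> t; apply/idP/idP; [apply: (frames_sub charF gG mulG fr fr')
    | apply: (frames_sub charF gG mulG fr' fr)].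
have bE : {in Tu P &, forall s t, b s t ^ delta = b' s t}.
  exact: (frames_b charF gG mulG fr fr').
have TE : Tplus (p_T P) =i Tplus (p_T P') by move=> g; rewrite -!Tu0 TuE.
have TG := valid_T Pv; have TuG := valid_Tu Pv; have TuG' := valid_Tu P'v.
split=> //.
have {}t1T := subgroupZ dE TuG (t1_Tu Pv).
(* delta t1 and t1' are both odd elements of T_u' that pair with T^+ by chi, so their difference w
   is in the radical of beta', which is 0 modulo t0. *)
set w := p_u P *~ delta - p_u P'.
have wT : w \in Tplus (p_T P') by rewrite -Tu1 -TuE -(t1Z dE).
have [[bB _ _] _ bt1] := bu; have [[bB' _ _] bT' bt1'] := bu'.
have bw t : t \in Tplus (p_T P') -> b' (sh w) (sh t) = 1.
  move=> tT; have tT' : t \in Tplus (p_T P) by rewrite TE.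
  have sht := Tu_sh tT'; have sht' := Tu_sh tT.
  have [chiC _] := chi_ok (let: And5 o _ _ _ _ := P'v in o) (valid_T P'v).
  have c0 : b' (t1 P') (sh t) != 0 by rewrite bt1' //; apply: chiC.1.
  apply: (mulIf c0); rewrite mul1r -(bicharDl bB') ?Tu_sh ?(t1_Tu Pv) ?(t1_Tu P'v) //.
  have -> : sh w + t1 P' = t1 P *~ delta.
    by rewrite /t1 shDp subrK -(t1Z dE).
  rewrite -bE // (bicharZ dE TuG bB) ?(t1_Tu Pv) ?(t1_Tu P'v) ?Tu_sh //.
  rewrite [LHS](bt1 t tT') [RHS](bt1' t tT).
  by rewrite (chi_eq chi t0E TE).
have [d dP] := frames_coset charF gG mulG fr fr'.
(* The shift between the frames lies in G#; an odd one is made even by means of t1, which lies in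
   T_u. *)
have {d dP} [d dP] : exists d : G, forall h : G,
    #|[pred i | (tnth (p_gamma P) i - c) *~ delta - h \in Tplus (p_T P)]|
    = #|[pred j | tnth (p_gamma P') j - c' - h + d \in Tplus (p_T P)]|.
  case: d dP => d p dP.
  exists (if p == 0 then d else d - p_u P) => h; move: (dP (sh h)) => E.
  etransitivity; first by etransitivity; last exact: E; apply: eq_card => i;
    rewrite !inE -shB Tu0.
  apply: eq_card => j; rewrite !inE -shB shDp.
  by case: (Z2P p) => -> /=; rewrite ?Tu0 ?Tu1 ?addrA.
(* The shift combines the normalisations c and c' of the two frames with their relative shift d. *)
exists delta, (c' - c *~ delta - d); split=> //.
- have [_ bT _] := bu; move=> x y xT yT.
  by rewrite -bT // bE ?Tu_sh // bT' -?TE.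
- rewrite t0E -bar_eq0; apply/eqP.
  have [_ _ [_ _ nd] _ _] := P'v; apply: nd => // z zT.
  have [t tz] := bar_surj z; rewrite -tz in zT *.
  by rewrite -bT' // bw.
apply: act_Xi_count => // z; rewrite count_map !count_tnth.
set g := c' - _ - d; have := dP (z - g - c *~ delta).
have E1 x : (x - c) *~ delta - (z - g - c *~ delta) = g + x *~ delta - z.
  by rewrite mulrzBl [- (_ - _ - _)]opprB addrA subrK opprB addrA [_ + g]addrC.
have E2 x : x - c' - (z - g - c *~ delta) + d = x - z.
  have -> : z - g - c *~ delta = z - (c' - d).
    by rewrite -addrA -opprD /g addrAC subrK.
  by rewrite opprB -!addrA addKr [- z + d]addrC addKr.
move=> E; etransitivity; first by etransitivity; last exact: E;
  apply: eq_card => i; rewrite !inE E1.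
by apply: eq_card => j; rewrite !inE E2.
Qed.
End Necessity.

Lemma perm_bij (A : eqType) k k' (s : k.-tuple A) (s' : k'.-tuple A) :
  perm_eq s s' ->
  exists2 p : 'I_k -> 'I_k', bijective p & forall i, tnth s i = tnth s' (p i).
Proof.
move=> E; have kk : k = k' by have := perm_size E; rewrite !size_tuple.
case: k' / kk s' E => s' /perm.tuple_permP[p pE].
exists (fun i => perm.fun_of_perm.body p i).
  exact: (Bijective (perm.permK p) (perm.permKV p)).
move=> i; suff -> : s = [tuple tnth s' (perm.fun_of_perm.body p j) | j < k] by rewrite tnth_mktuple.
exact: val_inj.
Qed.

(** * Transposed gradings *)

Section Transposition.
Variables (F : fieldType) (m : nat) (H : zmodType).
Local Notation M := 'M[F]_m.+1.
Variables (Gam : H -> {vspace M}) (s : seq H) (pr : H -> 'End(M)).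
Hypothesis gG : gproj Gam s pr.
Hypothesis mulG : forall g h x y,
  x \in Gam g -> y \in Gam h -> x *m y \in Gam (g + h).

Definition trf : 'End(M) := linfun (trmx : M -> M).
(** Composing with transposition turns antiautomorphisms into automorphisms, so [frames_conj] also
    serves the case delta = -1. *)
Definition tr_grading h : {vspace M} := (trf @^-1: Gam h)%VS.

Lemma trfE A : trf A = A^T. Proof. by rewrite lfunE. Qed.

Lemma mem_tr_grading h A : (A \in tr_grading h) = (A^T \in Gam h).
Proof. by rewrite -memv_preim trfE. Qed.

Lemma tr_gproj : gproj tr_grading s (fun h => (trf \o pr h \o trf)%VF).
Proof.
have [us prG prE prs] := gG; split=> //.
- by move=> g A; rewrite mem_tr_grading !comp_lfunE !trfE trmxK.
- move=> g h A; rewrite mem_tr_grading !comp_lfunE !trfE => /prE->.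
  by case: ifP => _; rewrite ?trmxK ?trmx0.
move=> A; rewrite -{1}[A]trmxK [A^T]prs linear_sum; apply: eq_bigr => h _.
by rewrite /= !comp_lfunE !trfE.
Qed.

Lemma tr_mul g h A B : A \in tr_grading g -> B \in tr_grading h ->
  A *m B \in tr_grading (g + h).
Proof. by rewrite !mem_tr_grading trmx_mul addrC => Ag Bh; apply: mulG. Qed.
End Transposition.

(** * Equivalence of parameters and isomorphism *)

Section Criterion.
Variables (F : closedFieldType) (charF : [pchar F] =i pred0).
Variables (G : zmodType) (n : nat) (n_gt0 : (0 < n)%N) (chi : char_choice F G).
Hypothesis chi_ok : char_choice_ok chi.
Local Notation r := n.+1.
Local Notation N := (r + r)%N.
Local Notation M := 'M[F]_N.
Local Notation m := (n + n.+1)%N.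
Variables (P P' : params F G) (Pv : valid chi P n) (P'v : valid chi P' n).
Variables (Del Del' : G -> {vspace Mss F r}).
Hypotheses (DelP : is_Gamma chi P Del) (DelP' : is_Gamma chi P' Del').

Lemma iso_equiv :
  iso_gradings (A := psl F r) (induced Del) (induced Del') -> equiv_params P P'.
Proof.
have [DelG _] := DelP; have [DelG' _] := DelP'.
have [b bu [c [fr]]] := frame_of_Gamma Pv DelP.
have [b' bu' [c' [fr']]] := frame_of_Gamma P'v DelP'.
have E0t := E0_deg charF chi_ok Pv bu DelG fr.
have E0t' := E0_deg charF chi_ok P'v bu' DelG' fr'.
move/(algebra_map_of_iso charF n_gt0 DelG DelG' E0t E0t' (valid_t02 Pv)).
move=> [t0E [Phi [PhiI PhiD PhiM]]].
have [s [pr gG]] := super_gproj charF DelG.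
have [s' [pr' gG']] := super_gproj charF DelG'.
have PhiJ := Phi_inj PhiI.
have PhiS h A : A \in sharp Del' h -> exists2 B, B \in sharp Del h & A = Phi B.
  have [B ->] := Phi_surj PhiI A => Ah; exists B => //.
  exact: (gproj_onto gG gG' PhiD PhiJ) Ah.
have [bB alt _] := let: And3 x _ _ := bu in x.
case: PhiM => PhiM.
  have Phi1 : Phi 1%:M = 1%:M.
    have [B E] := Phi_surj PhiI 1%:M.
    by have := PhiM 1%:M B; rewrite mul1mx -E mulmx1 => <-.
  have fr1 := frame_map (m := m) fr PhiJ Phi1 PhiM PhiD PhiS.
  apply: (equiv_of_frames (c := c) charF chi_ok Pv P'v t0E bu bu' (or_introl erefl) gG' _ _ fr').
    exact: super_mul.
  apply: (frame_reindex (m := m) (p := id) _ fr1) => //.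
  - exact: super_mul.
  - by exists id.
  by move=> i; rewrite /= mulr1z subrr; case: (valid_Tu Pv).
have Phi1 : Phi 1%:M = 1%:M.
  have [B E] := Phi_surj PhiI 1%:M.
  by have := PhiM B 1%:M; rewrite mulmx1 -E mulmx1 => <-.
have fr1 := frame_map_anti (m := m) fr PhiJ Phi1 PhiM PhiD PhiS.
apply: (equiv_of_frames (c := c) charF chi_ok Pv P'v t0E bu bu' (or_intror erefl) gG' _ _ fr').
  exact: super_mul.
apply: (frame_reindex (m := m) (p := id) _ fr1) => //.
- exact: super_mul.
- by exists id.
- by move=> i; rewrite /= mulrN1z shN subrr; case: (valid_Tu Pv).
by move=> x y xT yT; rewrite exprN1 (bichar_symV (valid_Tu Pv) bB alt).
Qed.

(** Bicharacters need comparing only on T^+ and t1. The delicate value is b'(t1, t): delta t1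
    differs from t1' by an element of the subgroup of t0, which pairs trivially with T^+. *)
Lemma beta_u_equiv (delta : int) b b' : delta = 1 \/ delta = -1 ->
  p_t0 P = p_t0 P' -> Tplus (p_T P) =i Tplus (p_T P') ->
  {in Tplus (p_T P) &, forall s t,
    p_beta P (bar _ s) (bar _ t) ^ delta = p_beta P' (bar _ s) (bar _ t)} ->
  p_u P *~ delta - p_u P' \in cyc (p_t0 P) ->
  is_beta_u chi P b -> is_beta_u chi P' b' ->
  Tu P =i Tu P' /\ {in Tu P &, forall s t, b s t ^ delta = b' s t}.
Proof.
move=> dE t0E TE betaE uE bu bu'.
have TG := valid_T Pv; have TuG := valid_Tu Pv; have TuG' := valid_Tu P'v.
have TpG := Tplus_subgroup TG.
have [[bB alt _] bT bt1] := bu; have [[bB' alt' _] bT' bt1'] := bu'.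
have [_ [_ _] betaP' _ _] := P'v; have [beta'B _ _] := betaP'.
set w := p_u P *~ delta - p_u P'.
have barw : bar (p_t0 P') w = bar (p_t0 P') 0.
  by apply/eqP; rewrite bar_eq subr0 -t0E.
have wT : w \in Tplus (p_T P') by rewrite TplusE barw -TplusE -TE; case: TpG.
have t1E : t1 P *~ delta = sh w + t1 P' by rewrite (t1Z dE) /t1 shDp subrK.
have t1dT' : t1 P *~ delta \in Tu P'.
  by rewrite t1E (subgroupD TuG') ?(t1_Tu P'v) // Tu_sh.
have t1T' : t1 P \in Tu P'.
  have -> : t1 P = t1 P *~ delta *~ delta.
    by case: dE => ->; rewrite ?mulr1z // !mulrN1z opprK.
  exact: subgroupZ.
have shT' t : t \in Tplus (p_T P) -> sh t \in Tu P'.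
  by move=> tT; rewrite Tu0 -TE.
have sub s : s \in Tu P -> s \in Tu P'.
  move=> /Tu_cases[[t tT ->]|[t tT ->]]; first exact: shT'.
  by rewrite (subgroupD TuG') ?shT'.
have sub' s : s \in Tu P' -> s \in Tu P.
  move=> /Tu_cases[[t tT ->]|[t tT ->]]; rewrite -TE in tT.
    exact: Tu_sh.
  rewrite (subgroupD TuG) ?Tu_sh //.
  have -> : t1 P' = t1 P *~ delta - sh w by rewrite t1E addrC addKr.
  by apply: TuG.2; rewrite ?Tu_sh ?TE // (subgroupZ dE TuG) // (t1_Tu Pv).
have ee s t : s \in Tplus (p_T P) -> t \in Tplus (p_T P) ->
    b (sh s) (sh t) ^ delta = b' (sh s) (sh t).
  by move=> sT tT; rewrite [b _ _](bT s t) // betaE // [RHS](bT' s t) -?TE.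
have oe t : t \in Tplus (p_T P) -> b (t1 P) (sh t) ^ delta = b' (t1 P) (sh t).
  move=> tT; have tT' : t \in Tplus (p_T P') by rewrite -TE.
  have E : b' (t1 P *~ delta) (sh t) = b (t1 P) (sh t).
    rewrite t1E (bicharDl bB') ?Tu_sh ?(t1_Tu P'v) //.
    rewrite [b' (sh w) _](bT' w t) // barw bar0 (bichar0l (valid_T P'v) beta'B) ?mul1r //.
    rewrite [LHS](bt1' t tT') [RHS](bt1 t tT); congr (_ t).
    by symmetry; apply: chi_eq.
  by rewrite -E (bicharZ dE TuG' bB') // shT'.
have eo t : t \in Tplus (p_T P) -> b (sh t) (t1 P) ^ delta = b' (sh t) (t1 P).
  move=> tT; have tT' := shT' t tT; have t1T := t1_Tu Pv.
  rewrite (bichar_symV TuG bB alt t1T (Tu_sh tT)).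
  by rewrite (bichar_symV TuG' bB' alt' t1T' tT') -oe // exprz_inv invr_expz.
have oo : b (t1 P) (t1 P) ^ delta = b' (t1 P) (t1 P).
  by rewrite alt ?(t1_Tu Pv) // alt' // exp1rz.
split=> [s|s t]; first by apply/idP/idP; [apply: sub | apply: sub'].
have t1T := t1_Tu Pv.
case/Tu_cases => -[s' s'T ->]; case/Tu_cases => -[t' t'T ->].
- exact: ee.
- by rewrite (bicharDr bB) ?Tu_sh // (bicharDr bB') ?shT' // expfzMl eo // ee.
- by rewrite (bicharDl bB) ?Tu_sh // (bicharDl bB') ?shT' // expfzMl oe // ee.
have s2T := subgroupD TuG t1T (Tu_sh s'T).
rewrite (bicharDr bB) ?Tu_sh // (bicharDr bB') ?shT' ?sub // expfzMl.
rewrite !(bicharDl bB) ?Tu_sh // !(bicharDl bB') ?shT' // !expfzMl.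
by rewrite oo oe // eo // ee.
Qed.

Lemma equiv_iso :
  equiv_params P P' -> iso_gradings (A := psl F r) (induced Del) (induced Del').
Proof.
have [DelG _] := DelP; have [DelG' _] := DelP'.
have [b bu [c [fr]]] := frame_of_Gamma Pv DelP.
have [b' bu' [c' [fr']]] := frame_of_Gamma P'v DelP'.
case=> t0E TE [delta [g [dE betaE uE XiE]]].
have [TuE bE] := beta_u_equiv dE t0E TE betaE uE bu bu'.
have [s [pr gG]] := super_gproj charF DelG.
have [s' [pr' gG']] := super_gproj charF DelG'.
have TG := valid_T Pv; have mulG := super_mul charF DelG; have mulG' := super_mul charF DelG'.
(* Equality of the multisets matches indices so that g + delta gam_i and gam'_(p i) agree modulo
   T^+. *)
have [p pB pT] : exists2 p : 'I_(p_k P) -> 'I_(p_k P'), bijective p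
    & forall i, g + tnth (p_gamma P) i *~ delta - tnth (p_gamma P') (p i)
        \in Tplus (p_T P).
  have /(act_XiP TE) E := XiE.
  have [|p pB pE] := @perm_bij _ _ _
    [tuple of [seq translate (g + x *~ delta) [set` Tplus (p_T P)]%classic | x <- p_gamma P]]
    [tuple of [seq translate x [set` Tplus (p_T P)]%classic | x <- p_gamma P']].
    by move: E; rewrite -map_comp.
  exists p => // i; apply/(translate_eq TG).
  by have := pE i; rewrite !tnth_map.
have subK (x y z : G) : x - z - (y - z) = x - y by rewrite opprB addrA subrK.
have subKl (x y z : G) : z + x - (z + y) = x - y.
  by rewrite opprD addrACA subrr add0r.
pose gam i := sh (g + tnth (p_gamma P) i *~ delta - c').
(* The frame of [Del'] is rewritten in terms of the data of [P], so that it differs from a frame of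
   [Del] or of its transpose by a constant shift only. *)
have fr'' : frame (sharp Del') (Tu P) (fun s t => b s t ^ delta) gam.
  apply: (frame_reindex (m := m) (p := p) mulG' fr') => //.
  - by move=> i; rewrite /= -shB opprB addrA subrK -TuE Tu_sh.
  by move=> s1 t1; rewrite -!TuE => s1T t1T; rewrite bE.
have [bB alt _] := let: And3 x _ _ := bu in x.
case: dE => dE; rewrite {delta}dE in betaE uE XiE bE pT gam fr''.
  have fr1 : frame (sharp Del) (Tu P) (fun s t => b s t ^ 1)
      (fun i => sh (tnth (p_gamma P) i - c)).
    apply: (frame_reindex (m := m) (p := id) mulG fr) => //; first by exists id.
    by move=> i; rewrite /= subrr; case: (valid_Tu Pv).
  have [|Z Zu ZP] := frames_conj (m := m) gG gG' mulG mulG' fr1 fr''.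
    by move=> i j; rewrite -!shB !mulr1z !subK subKl.
  pose Phi : 'End(M) := linfun (mulmxr (invmx Z) \o mulmx Z).
  have PhiE A : Phi A = Z *m A *m invmx Z by rewrite lfunE.
  apply: (iso_of_algebra_map charF DelG DelG' (Phi := Phi)).
  - move=> A; rewrite PhiE => E0; rewrite -[A]mul1mx -(mulVmx Zu) -[A]mulmx1.
    by rewrite -(mulVmx Zu) !mulmxA -(mulmxA _ Z) -(mulmxA _ (Z *m A)) E0 mulmx0 mul0mx.
  - by move=> h A Ah; rewrite PhiE; apply: ZP.
  by left=> A B; rewrite !PhiE !mulmxA mulmxKV.
(* Case delta = -1: transposing first inverts b and the gam_i. *)
have trfI : injective (trf F m) by move=> A B; rewrite !trfE => /trmx_inj.
have fr0 : frame (tr_grading (sharp Del)) (Tu P) (fun s t => b t s)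
    (fun i => - sh (tnth (p_gamma P) i - c)).
  apply: (frame_map_anti (m := m) fr trfI).
  - by rewrite trfE trmx1.
  - by move=> A B; rewrite !trfE trmx_mul.
  - by move=> h A; rewrite mem_tr_grading trfE trmxK.
  by move=> h A; rewrite mem_tr_grading => Ah; exists A^T; rewrite // trfE trmxK.
have mulGT := tr_mul (m := m) mulG.
have fr1 : frame (tr_grading (sharp Del)) (Tu P) (fun s t => b s t ^ -1)
    (fun i => - sh (tnth (p_gamma P) i - c)).
  apply: (frame_reindex (m := m) (p := id) mulGT fr0) => //; first by exists id.
    by move=> i; rewrite /= subrr; case: (valid_Tu Pv).
  by move=> x y xT yT; rewrite exprN1 (bichar_symV (valid_Tu Pv) bB alt).
have [|Z Zu ZP] := frames_conj (m := m) (tr_gproj (m := m) gG) gG' mulGT mulG' fr1 fr''.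
  move=> i j; rewrite -opprD -!shB -shN !subK subKl !mulrN1z.
  by rewrite opprB opprK addrC.
pose Phi : 'End(M) := linfun (mulmxr (invmx Z) \o mulmx Z \o trmx).
have PhiE A : Phi A = Z *m A^T *m invmx Z by rewrite lfunE.
apply: (iso_of_algebra_map charF DelG DelG' (Phi := Phi)).
- move=> A; rewrite PhiE => E0; apply: trmx_inj; rewrite trmx0.
  rewrite -[A^T]mul1mx -(mulVmx Zu) -[A^T]mulmx1.
  by rewrite -(mulVmx Zu) !mulmxA -(mulmxA _ Z) -(mulmxA _ (Z *m A^T)) E0 mulmx0 mul0mx.
- by move=> h A Ah; rewrite PhiE; apply: ZP; rewrite mem_tr_grading trmxK.
by right=> A B; rewrite !PhiE trmx_mul !mulmxA mulmxKV.
Qed.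
End Criterion.

(** * Odd gradings *)

Section EvenSupport.
Variables (F : closedFieldType) (charF : [pchar F] =i pred0).
Variables (G : zmodType) (n : nat).
Local Notation r := n.+1.
Local Notation N := (r + r)%N.
Local Notation M := 'M[F]_N.
Local Notation m := (n + n.+1)%N.
Local Notation proj := (psl_proj F r).
Variables (Del : G -> {vspace Mss F r}) (DelG : is_super_grading Del).
Variables (T : {pred Gsharp G}) (b : Gsharp G -> Gsharp G -> F).
Variables (k : nat) (gam : 'I_k -> Gsharp G).
Variable fr : frame (sharp Del) T b gam.
Hypothesis T_even : forall t, t \in T -> t.2 = 0.

Section OneCharacter.
Variables (chi : G -> F) (chiC : is_char predT chi).
Variable t : Gsharp G.
Hypotheses (tT : t \in T) (bt : {in T, forall s, b t s = chi s.1}).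
Local Notation x := (fr_x fr).
Local Notation y := (fr_y fr).

(** For Z in the corner this is the diagonal matrix of M_k(D) with entries c_i Z. *)
Definition twist (c : 'I_k -> F) (Z : M) : M := \sum_i c i *: (x i *m Z *m y i).

Lemma twist_mul c d (Z W : M) : Z *m fr_e fr = Z ->
  twist c Z *m twist d W = twist (fun i => c i * d i) (Z *m W).
Proof.
move=> Ze; rewrite mulmx_suml; apply: eq_bigr => i _.
rewrite mulmx_sumr (bigD1 i) //= big1 ?addr0 => [|j ji].
  rewrite -scalemxAl -scalemxAr scalerA; congr (_ *: _).
  rewrite !mulmxA -(mulmxA _ (y i)) fr_orth eqxx -(mulmxA (x i)).
  by rewrite Ze.
rewrite -scalemxAl -scalemxAr !mulmxA -(mulmxA _ (y i)) fr_orth eq_sym (negPf ji).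
by rewrite mulmx0 !mul0mx !scaler0.
Qed.

Lemma chi_neq0 g : chi g != 0. Proof. by case: chiC => ->. Qed.
Lemma chiD g h : chi (g + h) = chi g * chi h. Proof. by case: chiC => _ ->. Qed.
Lemma chi0 : chi 0 = 1.
Proof. by apply: (mulfI (chi_neq0 0)); rewrite -chiD addr0 mulr1. Qed.
Lemma chiB g h : chi (g - h) = chi g / chi h.
Proof. by apply: (mulIf (chi_neq0 h)); rewrite -chiD subrK divfK ?chi_neq0. Qed.

Let B := twist (fun i => chi (gam i).1) (fr_X fr t).
Let B' := twist (fun i => (chi (gam i).1)^-1) (fr_Y fr t).

Lemma twist_e : twist (fun=> 1) (fr_e fr) = 1%:M.
Proof.
rewrite -(fr_sum fr); apply: eq_bigr => i _.
by rewrite scale1r -mulmxA fr_ey.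
Qed.

Lemma B_inv : B *m B' = 1%:M.
Proof.
rewrite twist_mul ?fr_Xe // fr_XY // -twist_e; apply: eq_bigr => i _.
by rewrite divff // chi_neq0.
Qed.

Lemma B_unit : B \in unitmx.
Proof. by case: (mulmx1_unit B_inv). Qed.

Lemma B_even : B \in Mpart F r 0.
Proof.
apply: memv_suml => i _; apply: memvZ.
have := fr_degE (m := m) (super_mul charF DelG) fr i i tT.
by rewrite subrr add0r memv_cap T_even // => /andP[].
Qed.

(** On x_i X_v y_j of degree h = gam_i - gam_j + v, moving B across gives chi(gam_i) / chi(gam_j)
    from the diagonal coefficients and b t v = chi(v) from X_t, in all chi(h). *)
Lemma B_comm h A : A \in sharp Del h -> B *m A = chi h.1 *: (A *m B).
Proof.
move=> /(fr_span (m := m) (super_mul charF DelG) fr) [c [cT ->]].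
rewrite mulmx_sumr mulmx_suml scaler_sumr; apply: eq_bigr => i _.
rewrite mulmx_sumr mulmx_suml scaler_sumr; apply: eq_bigr => j _.
have [->|/cT] := eqVneq (c i j) 0; first by rewrite !scale0r mulmx0 mul0mx scaler0.
set v := h - gam i + gam j => vT.
rewrite -scalemxAr -scalemxAl !scalerA [_ * c i j]mulrC -scalerA; congr (_ *: _).
have -> : B *m (x i *m fr_X fr v *m y j)
    = chi (gam i).1 *: (x i *m (fr_X fr t *m fr_X fr v) *m y j).
  rewrite mulmx_suml (bigD1 i) //= [X in _ + X]big1 => [|l li]; last first.
    rewrite -scalemxAl !mulmxA -(mulmxA _ (y l)) fr_orth (negPf li).
    by rewrite mulmx0 !mul0mx scaler0.
  rewrite addr0 -!scalemxAl; congr (_ *: _).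
  rewrite !mulmxA -(mulmxA _ (y i)) fr_orth eqxx -(mulmxA (x i)) fr_Xe //.
have -> : x i *m fr_X fr v *m y j *m B
    = chi (gam j).1 *: (x i *m (fr_X fr v *m fr_X fr t) *m y j).
  rewrite mulmx_sumr (bigD1 j) //= [X in _ + X]big1 => [|l li]; last first.
    by rewrite -scalemxAr !mulmxA -(mulmxA _ (y j)) fr_orth eq_sym (negPf li)
      mulmx0 !mul0mx scaler0.
  rewrite addr0 -scalemxAr; congr (_ *: _).
  rewrite !mulmxA -(mulmxA _ (y j)) fr_orth eqxx -(mulmxA (x i)) fr_Xe //.
rewrite (fr_comm fr) // bt // -scalemxAr -scalemxAl !scalerA; congr (_ *: _).
by rewrite chiD chiB mulrA [_ * (_ / _)]mulrC divfK // chi_neq0.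
Qed.

Lemma B_conj g A : A \in Del g -> B *m A *m invmx B = chi g *: A.
Proof.
move=> Ag; have [eg og] := super_parts charF DelG Ag.
have E : B *m A = chi g *: (A *m B).
  rewrite -[A](parts_add charF) mulmxDr mulmxDl scalerDr.
  rewrite (@B_comm (g, 0)) ?(@B_comm (g, 1)) //.
    by apply/(sharp1 charF); split=> //; apply: od_odpart.
  by apply/(sharp0 charF); split=> //; apply: ev_evpart.
by rewrite E -scalemxAl mulmxK // B_unit.
Qed.

Lemma even_action : exists2 alpha, in_E alpha & acts_as (induced Del) chi alpha.
Proof.
pose alpha : 'End(psl F r) :=
  (proj \o linfun (mulmxr (invmx B) \o mulmx B) \o linfun (vsval : psl F r -> M))%VF.
have aE v : alpha v = proj (B *m vsval v *m invmx B).
  by rewrite !comp_lfunE !lfunE.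
have aP X : X \in sl F r -> alpha (proj X) = proj (B *m X *m invmx B).
  move=> /proj_lift[c cE]; rewrite aE cE mulmxDr mulmxDl linearD /=.
  by rewrite mul_mx_scalar -scalemxAl mulmxV ?B_unit // scalemx1 proj_scalar addr0.
exists alpha.
  by exists B; split=> //; [apply: B_even | apply: B_unit].
move=> g _ /memv_imgP[X /memv_capP[Xsl Xg] ->].
by rewrite aP // (B_conj Xg) linearZ.
Qed.
End OneCharacter.

Lemma even_of_frame : even_typeI (induced Del).
Proof.
split; first by exists Del.
move=> chi chiC; have [s [pr gG]] := super_gproj charF DelG.
(* A character of G is one of T through the first coordinate, hence equals b t _ for some t in T. *)
have [|t tT bt] := fr_char_ext (m := m) charF gG (super_mul charF DelG) fr
  (S := T) (chi := fun h => chi h.1) (fun _ => id) (fr_T_subgroup (super_mul charF DelG) fr).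
  by split=> [h _|h h' _ _]; [case: chiC => -> | case: chiC => _ ->].
exact (even_action chiC tT bt).
Qed.
End EvenSupport.

(** * Averaging over the support, and the dimension formula *)

Section Casimir.
Variables (F : closedFieldType) (charF : [pchar F] =i pred0).
Variables (m : nat) (H : zmodType).
Local Notation N := m.+1.
Local Notation M := 'M[F]_N.
Variables (Gam : H -> {vspace M}) (s : seq H) (pr : H -> 'End(M)).
Hypothesis gG : gproj Gam s pr.
Hypothesis mulG : forall g h x y,
  x \in Gam g -> y \in Gam h -> x *m y \in Gam (g + h).
Variables (T : {pred H}) (b : H -> H -> F) (k : nat) (gam : 'I_k -> H).
Variable fr : frame Gam T b gam.
Variables (q : seq H) (uq : uniq q) (Tq : T =i q).
Local Notation e := (fr_e fr).
Local Notation X := (fr_X fr).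
Local Notation Y := (fr_Y fr).

(** Conjugation by X_t multiplies X_h by b t h, and summing over t gives |T| for h = 0 and 0
    otherwise. What survives is the degree 0 part, a multiple of e determined by its trace. *)
Lemma casimir A : \sum_(t <- q) X t *m A *m Y t
  = ((size q)%:R * \tr (e *m A) / \tr e) *: e.
Proof.
have trn0 := fr_tre_neq0 charF fr; have TG := fr_T_subgroup mulG fr.
have XeYe t B : t \in q -> X t *m B *m Y t = X t *m (e *m B *m e) *m Y t.
  by rewrite -Tq => tT; rewrite !mulmxA fr_Xe // -(mulmxA _ e) fr_eY.
have hom h B : B \in Gam h -> \sum_(t <- q) X t *m B *m Y t
    = ((size q)%:R * \tr (e *m B) / \tr e) *: e.
  move=> Bh; set a := e *m B *m e.
  have ea : e *m a = a by rewrite /a !mulmxA fr_ee.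
  have ae : a *m e = a by rewrite /a -!mulmxA fr_ee.
  have tra : \tr (e *m B) = \tr a.
    by rewrite /a -[in LHS](fr_ee fr) -mulmxA mxtrace_mulC.
  have e0 := fr_e0 mulG fr.
  have ah : a \in Gam h.
    by have := mulG (mulG e0 Bh) e0; rewrite add0r addr0.
  rewrite tra; transitivity (\sum_(t <- q) X t *m a *m Y t).
    by apply: eq_big_seq => t tq; apply: XeYe.
  have [a0|an0] := eqVneq a 0.
    rewrite a0 mxtrace0 mulr0 mul0r scale0r big1 // => t _.
    by rewrite mulmx0 mul0mx.
  have [hT [c cE]] : h \in T /\ exists c, a = c *: X h.
    by apply: (fr_line fr ah) => //; rewrite ea.
  transitivity ((\sum_(t <- q) b t h) *: a).
    rewrite scaler_suml; apply: eq_big_seq => t; rewrite -Tq => tT.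
    rewrite cE -scalemxAr -scalemxAl (fr_comm fr) // -scalemxAl -mulmxA fr_XY //.
    by rewrite fr_Xe // !scalerA mulrC.
  have [h0|hn0] := eqVneq h 0.
    have [d dE] : exists d, a = d *: e.
      have [d dE] := fr_line_X e0 (fr_ee fr) (fr_ee fr) (fr_T0 mulG fr).
      have d0 : d != 0.
        by apply: contraNneq (fr_e_neq0 fr) => d0; rewrite dE d0 scale0r.
      by exists (c / d); rewrite dE scalerA divfK // cE h0.
    rewrite dE mxtraceZ mulrA mulfK // scalerA; congr (_ * _ *: _).
    rewrite (eq_big_seq (fun=> 1)) ?big_const_seq ?count_predT ?iter_addr_0 // => t.
    rewrite -Tq => tT; have tn := fr_b_neq0 fr tT (fr_T0 mulG fr).
    by apply: (mulfI tn); rewrite h0 -(fr_bDr mulG fr) ?(fr_T0 mulG fr) // addr0 mulr1.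
  rewrite (gr_trace charF gG mulG ah hn0) mulr0 mul0r scale0r.
  have [t tT bth] : exists2 t, t \in T & b t h != 1.
    apply: contrapT => nex; move/eqP: hn0; apply; apply: (fr_nondeg gG mulG fr hT) => t tT.
    have := fr_bC fr hT tT; suff -> : b t h = 1 by rewrite mulr1.
    by apply/eqP/negPn/negP => nb; apply: nex; exists t.
  rewrite (char_sum0 (f := b^~ h) uq Tq TG _ tT bth) ?scale0r // => t1 t2 t1T t2T.
  exact: (fr_bDl mulG fr).
rewrite [A](gproj_sum gG); set S := \sum_(h <- s) _.
transitivity (\sum_(h <- s) \sum_(t <- q) X t *m pr h A *m Y t).
  rewrite exchange_big /=; apply: eq_bigr => t _.
  by rewrite mulmx_sumr mulmx_suml.
rewrite mulmx_sumr linear_sum /= mulr_sumr mulr_suml scaler_suml.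
by apply: eq_bigr => h _; apply: hom (gproj_in gG h A).
Qed.

(* Contracting [casimir] on the matrix units gives (tr e)^2 = |T|, since only
   t = 0 contributes to \sum_t tr X_t tr Y_t; and k tr e = N. *)
Lemma fr_dim : (k ^ 2 * size q = N ^ 2)%N.
Proof.
have trn0 := fr_tre_neq0 charF fr.
have dl i j p l : (X p *m delta_mx i j *m Y p) i l = X p i i * Y p j l.
  rewrite mxE (bigD1 j) //= big1 => [|a aj]; last first.
    rewrite mxE big1 ?mul0r // => c _; rewrite mxE (negPf aj) andbF mulr0 //.
  rewrite addr0 mxE (bigD1 i) //= big1 => [|a ai].
    by rewrite mxE !eqxx mulr1 addr0.
  by rewrite mxE (negPf ai) mulr0.
have L : \sum_i \sum_j (\sum_(t <- q) X t *m delta_mx i j *m Y t) i j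
    = \tr e ^+ 2.
  transitivity (\sum_(t <- q) \tr (X t) * \tr (Y t)).
    transitivity (\sum_i \sum_j \sum_(t <- q) X t i i * Y t j j).
      apply: eq_bigr => i _; apply: eq_bigr => j _; rewrite summxE.
      by apply: eq_bigr => t _; apply: dl.
    transitivity (\sum_i \sum_(t <- q) X t i i * \tr (Y t)).
      apply: eq_bigr => i _; rewrite exchange_big; apply: eq_bigr => t _ /=.
      by rewrite -mulr_sumr.
    rewrite exchange_big; apply: eq_bigr => t _ /=.
    by rewrite -mulr_suml.
  have T0 := fr_T0 mulG fr; have q0 : 0 \in q by rewrite -Tq.
  have e0 := fr_e0 mulG fr.
  rewrite (bigD1_seq 0) //= big_seq_cond big1 => [|t /andP[tq tn0]]; last first.
    by rewrite (gr_trace charF gG mulG (fr_degX fr _) tn0) ?mul0r // Tq.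
  (* X_0 is a multiple of e and Y_0 its inverse, so the product of their traces is (tr e)^2. *)
  have [d dE] := fr_line_X e0 (fr_ee fr) (fr_ee fr) T0.
  have YE : Y 0 = d *: e.
    by rewrite -(fr_eY fr T0) {1}dE -scalemxAl fr_XY.
  have trE : \tr e = d * \tr (X 0) by rewrite {1}dE mxtraceZ.
  by rewrite addr0 YE mxtraceZ mulrA [_ * d]mulrC -trE expr2.
have R : \sum_i \sum_j (\sum_(t <- q) X t *m delta_mx i j *m Y t) i j
    = (size q)%:R.
  transitivity (\sum_i \sum_j (size q)%:R / \tr e * (e i j * e j i)).
    apply: eq_bigr => i _; apply: eq_bigr => j _; rewrite casimir mxE.
    have -> : \tr (e *m delta_mx i j) = e j i.
      rewrite /mxtrace (bigD1 j) //= big1 => [|l lj].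
        rewrite addr0 mxE (bigD1 i) //= big1 ?addr0 => [|a ai].
          by rewrite mxE !eqxx mulr1.
        by rewrite mxE (negPf ai) mulr0.
      by rewrite mxE big1 // => a _; rewrite mxE (negPf lj) andbF mulr0.
    by rewrite -!mulrA; congr (_ * _); rewrite mulrCA [e j i * _]mulrC.
  transitivity ((size q)%:R / \tr e * \tr (e *m e)); last by rewrite fr_ee divfK.
  rewrite /mxtrace [RHS]mulr_sumr; apply: eq_bigr => i _.
  by rewrite [(_ *m _) i i]mxE mulr_sumr.
have E : \tr e ^+ 2 = (size q)%:R by rewrite -L.
apply: (natf_inj charF); rewrite natrM -E !natrX -(fr_tre fr).
by rewrite exprMn.
Qed.
End Casimir.

(** Used twice to count T: for its two parities, and for the even part over its quotient by t0. *)
Lemma size_double (H : zmodType) (l q : seq H) (d : H) :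
  uniq l -> uniq q -> (forall x, x \in l -> x + d \notin l) ->
  (forall x, (x \in q) = (x \in l) || (x - d \in l)) -> size q = (2 * size l)%N.
Proof.
move=> ul uq disj qE; rewrite mul2n -addnn -{2}(size_map (+%R^~ d) l) -size_cat.
apply: perm_size; apply: uniq_perm => //.
  rewrite cat_uniq ul map_inj_uniq ?ul ?andbT; last exact: addIr.
  by apply/hasPn => _ /mapP[x xl ->]; apply: disj.
move=> x; rewrite qE mem_cat; congr (_ || _).
by apply/idP/mapP => [xl|[z zl ->]]; [exists (x - d); rewrite ?subrK | rewrite addrK].
Qed.

(** * Reading off the parameters of an odd grading *)

Section OddSupport.
Variables (F : closedFieldType) (charF : [pchar F] =i pred0).
Variables (G : zmodType) (n : nat) (chi : char_choice F G).
Hypothesis chi_ok : char_choice_ok chi.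
Local Notation r := n.+1.
Local Notation N := (r + r)%N.
Local Notation M := 'M[F]_N.
Local Notation m := (n + n.+1)%N.
Variables (Del : G -> {vspace Mss F r}) (DelG : is_super_grading Del).
Variables (T : {pred Gsharp G}) (b : Gsharp G -> Gsharp G -> F).
Variables (k : nat) (gam : 'I_k -> Gsharp G).
Variable fr : frame (sharp Del) T b gam.
Variables (tau : Gsharp G) (tauT : tau \in T) (tau1 : tau.2 = 1).

Let mulG := super_mul charF DelG.
Let TG : is_subgroup T := fr_T_subgroup (m := m) mulG fr.
Let bND : nondeg_alt_bichar T b.
Proof.
have [s [pr gG]] := super_gproj charF DelG.
exact: (fr_nondeg_alt_bichar (m := m) gG mulG fr).
Qed.
Let bB : is_bichar T b. Proof. by case: bND. Qed.
Let alt : alternating T b. Proof. by case: bND. Qed.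
Let nd : Defs.nondegenerate T b. Proof. by case: bND. Qed.

Definition sgp (p : 'Z_2) : F := if p == 0 then 1 else -1.

Lemma sgpD p q : sgp (p + q) = sgp p * sgp q.
Proof.
have E11 : (1 + 1 : 'Z_2) = 0 by apply/val_inj.
by case: (Z2P p) => ->; case: (Z2P q) => ->;
  rewrite ?addr0 ?add0r ?E11 /sgp /= ?mulrNN ?mulr1 ?mul1r.
Qed.

Lemma m1_neq1 : (-1 : F) != 1.
Proof.
by rewrite -subr_eq0 -opprD oppr_eq0 -mulr2n (natf_neq0 charF 1).
Qed.

Lemma Gsharp_eta (s : Gsharp G) : s.2 = 0 -> s = sh s.1.
Proof. by case: s => g p /= ->. Qed.

Lemma shD (g h : G) : sh (g + h) = sh g + sh h.
Proof. by rewrite {2}/sh shDp. Qed.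

Lemma char_elt (S : {pred Gsharp G}) f : {subset S <= T} -> is_subgroup S ->
  is_char S f -> exists2 t, t \in T & {in S, forall s, b t s = f s}.
Proof.
have [s [pr gG]] := super_gproj charF DelG.
exact: (fr_char_ext (m := m) charF gG mulG fr).
Qed.

(** Parity is a character of T, hence b t _ for some t in T. Alternation makes t even, nondegeneracy
    gives 2 t = 0, and the odd element [tau] shows that t is not 0. *)
Lemma parity_elt : exists t0, [/\ order2 t0, sh t0 \in T
  & {in T, forall s, b (sh t0) s = sgp s.2}].
Proof.
have [|t tT tE] := char_elt (S := T) (f := fun s => sgp s.2) (fun _ => id) TG.
  split=> [s _|s t _ _]; last exact: sgpD.
  by rewrite /sgp; case: ifP; rewrite ?oppr_eq0 oner_eq0.
have t20 : t.2 = 0.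
  have := tE t tT; rewrite alt // => /esym; case: (Z2P t.2) => -> // /eqP.
  by rewrite /sgp /= (negPf m1_neq1).
exists t.1; rewrite -(Gsharp_eta t20); split=> //; split.
  move=> t10; have /eqP := tE tau tauT; rewrite tau1 (Gsharp_eta t20) t10.
  by rewrite [sh 0]/(0 : Gsharp G) (bichar0l TG bB) // eq_sym (negPf m1_neq1).
have ttT := subgroupD TG tT tT.
have : t + t = 0.
  apply: nd => // s sT; rewrite (bicharDl bB) // tE //.
  by rewrite /sgp; case: ifP; rewrite ?mulrNN mulr1.
by move/(congr1 fst); rewrite mulr2n.
Qed.

Section WithT0.
Variable t0 : G.
Hypotheses (t0o : order2 t0) (t0T : sh t0 \in T).
Hypothesis bt0 : {in T, forall s, b (sh t0) s = sgp s.2}.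

(** T contains t0, so its even part is the full preimage of its image modulo t0. *)
Lemma exists_Tbar : exists2 TT : {fset Gbar t0},
  (forall g, (g \in Tplus TT) = (sh g \in T)) & is_subgroup (mem TT).
Proof.
have [s [pr gG]] := super_gproj charF DelG.
have [q uq Tq] := fr_T_finite (m := m) gG fr.
pose TT : {fset Gbar t0} :=
  [fset z in [seq bar t0 s.1 | s : Gsharp G <- q & s.2 == 0]]%fset.
have TTE g : (g \in Tplus TT) = (sh g \in T).
  rewrite TplusE in_fset; apply/mapP/idP => [[s']|gT]; last first.
    by exists (sh g) => //; rewrite mem_filter eqxx -Tq.
  rewrite mem_filter -Tq => /andP[/eqP s'2 s'T] /eqP; rewrite bar_eq.
  rewrite cycP; last by case: t0o.
  rewrite (Gsharp_eta s'2) /= in s'T *.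
  case/orP => [|] /eqP gE; first by move/eqP: gE; rewrite subr_eq0 => /eqP->.
  by rewrite -[g](subrK s'.1) gE shD (subgroupD TG).
exists TT => //; split; first by rewrite -(bar0 t0) -TplusE TTE; exact: TG.1.
move=> z w; have [g <-] := bar_surj z; have [h <-] := bar_surj w.
by rewrite -barB -!TplusE !TTE shB; apply: TG.2.
Qed.

Variable TT : {fset Gbar t0}.
Hypotheses (TTE : forall g, (g \in Tplus TT) = (sh g \in T)) (TTG : is_subgroup (mem TT)).

(** On the image of the even part of T the choice of representatives is immaterial, since t0 pairs
    trivially with even elements. *)
Definition betabar (z w : Gbar t0) : F := b (sh (repr z)) (sh (repr w)).

Lemma bt0sh g : sh g \in T -> b (sh t0) (sh g) = 1.
Proof. by move=> gT; rewrite bt0. Qed.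

Lemma bsht0 g : sh g \in T -> b (sh g) (sh t0) = 1.
Proof. by move=> gT; rewrite (bichar_symV TG bB alt t0T gT) bt0sh // invr1. Qed.

Lemma repr_bar (g : G) : repr (bar t0 g) = g \/ repr (bar t0 g) = g + t0.
Proof.
have : repr (bar t0 g) - g \in cyc t0 by rewrite -bar_eq /bar reprK.
rewrite cycP; last by case: t0o.
case/orP => /eqP E; [left | right]; first by apply/eqP; rewrite -subr_eq0 E.
by apply/eqP; rewrite addrC -subr_eq E.
Qed.

Lemma betabarE g h : sh g \in T -> sh h \in T ->
  betabar (bar t0 g) (bar t0 h) = b (sh g) (sh h).
Proof.
move=> gT hT; have gtT := subgroupD TG gT t0T; have htT := subgroupD TG hT t0T.
rewrite /betabar; case: (repr_bar g) => ->; case: (repr_bar h) => -> //; rewrite !shD.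
- by rewrite (bicharDr bB) // bsht0 // mulr1.
- by rewrite (bicharDl bB) // bt0sh // mulr1.
by rewrite (bicharDr bB) ?(subgroupD TG) // !(bicharDl bB) // bsht0 // !bt0sh // !mulr1.
Qed.

Lemma barT z : z \in TT -> exists2 g, sh g \in T & z = bar t0 g.
Proof. by have [g <-] := bar_surj z; rewrite -TplusE TTE => gT; exists g. Qed.

(** For nondegeneracy: if g pairs trivially with the even part, then b(g, tau)^2 = b(g, 2 tau) = 1.
    So g, or g + t0 if the sign is -1, is in the radical of b, and g vanishes modulo t0. *)
Lemma betabar_nd : nondeg_alt_bichar (mem TT) betabar.
Proof.
split.
- split=> _ /barT[g gT ->]; split=> [_ /barT[h hT ->]|_ _ /barT[h hT ->] /barT[h' h'T ->]].
  + by rewrite betabarE // (bichar_neq0 bB).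
  + by rewrite -barD !betabarE ?shD ?(subgroupD TG) // (bicharDr bB).
  + by rewrite betabarE // (bichar_neq0 bB).
  by rewrite -barD !betabarE ?shD ?(subgroupD TG) // (bicharDl bB).
- by move=> _ /barT[g gT ->]; rewrite betabarE // alt.
move=> _ /barT[g gT ->] b1; apply/eqP; rewrite bar_eq0 cycP; last by case: t0o.
have b1' h : sh h \in T -> b (sh g) (sh h) = 1.
  by move=> hT; rewrite -betabarE // b1 // -TplusE TTE.
have key c : sh c \in T -> b (sh c) tau = 1 ->
    (forall h, sh h \in T -> b (sh c) (sh h) = 1) -> c = 0.
  move=> cT ct ch; suff : sh c = 0 by move/(congr1 fst).
  apply: nd => // s sT; case: (Z2P s.2) => s2.
    by rewrite (Gsharp_eta s2) ch // -(Gsharp_eta s2).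
  have E2 : (s - tau).2 = 0 by rewrite /= s2 tau1 subrr.
  have dT : s - tau \in T by apply: TG.2.
  rewrite -[s](subrK tau) (bicharDr bB) // ct mulr1 (Gsharp_eta E2) ch //.
  by rewrite -(Gsharp_eta E2).
have tt2 : (tau + tau).2 = 0 by rewrite /= tau1; apply/val_inj.
have ttT := subgroupD TG tauT tauT.
have sq : b (sh g) tau ^+ 2 = 1.
  by rewrite expr2 -(bicharDr bB) // (Gsharp_eta tt2) b1' // -(Gsharp_eta tt2).
have /eqP := sq; rewrite sqrf_eq1 => /orP[/eqP e1|/eqP e1].
  by rewrite (key g) ?eqxx.
have gtT : sh (g + t0) \in T by rewrite shD (subgroupD TG).
have gt0 : g + t0 = 0.
  apply: key => //.
    by rewrite shD (bicharDl bB) // e1 bt0 // tau1 mulrNN mulr1.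
  by move=> h hT; rewrite shD (bicharDl bB) // b1' // bt0sh // mulr1.
have t0N : t0 = - t0.
  by apply/eqP; rewrite -addr_eq0 -mulr2n; case: t0o => _ ->.
by rewrite [X in _ || (_ == X)]t0N -addr_eq0 gt0 eqxx orbT.
Qed.

(** The fixed character of T^+ is the restriction of b t _ for some t in T, and its value -1 at t0
    forces t to be odd. *)
Lemma exists_u : exists2 u : G, (u, 1) \in T
  & forall t, sh t \in T -> b (u, 1) (sh t) = chi TT t.
Proof.
have [chiC chit0] := chi_ok t0o TTG.
pose S : {pred Gsharp G} := fun s => (s.2 == 0) && (s \in T).
have SP s : s \in S -> s.2 = 0 /\ s \in T by case/andP => /eqP.
have [|||t tT tE] := char_elt (S := S) (f := fun s => chi TT s.1).
- by move=> s /SP[].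
- split=> [|s t /SP[s2 sT] /SP[t2 tT]]; apply/andP; split=> //.
  + by case: TG.
  + by rewrite /= s2 t2 subrr.
  exact: TG.2.
- split=> [s /SP[s2 sT]|s t /SP[s2 sT] /SP[t2 tT]].
    by apply: chiC.1; rewrite TTE -(Gsharp_eta s2).
  by apply: chiC.2; rewrite TTE -Gsharp_eta.
have tE' g : sh g \in T -> b t (sh g) = chi TT g by move=> gT; apply: tE.
have t1 : t.2 = 1.
  have := bt0 tT; rewrite (bichar_symV TG bB alt tT t0T) tE' // chit0.
  case: (Z2P t.2) => -> // /eqP.
  by rewrite invrN1 /sgp /= (negPf m1_neq1).
by exists t.1; rewrite -t1 -surjective_pairing.
Qed.

Variable u : G.
Hypotheses (uT : (u, 1) \in T) (bu : forall t, sh t \in T -> b (u, 1) (sh t) = chi TT t).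
Variable gamma : k.-tuple G.
Let P := Params TT betabar u gamma.

Lemma Tu_T : T =i Tu P.
Proof.
move=> [g p]; case: (Z2P p) => ->; first by rewrite Tu0 TTE.
have E : sh (g - u) = ((g, 1) : Gsharp G) - (u, 1).
  by rewrite /sh; congr (_, _); apply/val_inj.
rewrite Tu1 TTE E; apply/idP/idP => [gT|guT]; first exact: TG.2.
by rewrite -[(g, 1)](subrK ((u, 1) : Gsharp G)) (subgroupD TG).
Qed.

Lemma is_beta_u_P : is_beta_u chi P b.
Proof.
split.
- split.
  + split=> s; rewrite -Tu_T => sT; split=> [t|t t']; rewrite -!Tu_T => tT.
    * exact: (bichar_neq0 bB).
    * by move=> t'T; apply: (bicharDr bB).
    * exact: (bichar_neq0 bB).
    by move=> t'T; apply: (bicharDl bB).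
  + by move=> t; rewrite -Tu_T; apply: alt.
  move=> s; rewrite -Tu_T => sT s1; apply: nd => // t tT.
  by apply: s1; rewrite -Tu_T.
- by move=> s t; rewrite !TTE => sT tT; rewrite [RHS]betabarE.
by move=> t; rewrite TTE; apply: bu.
Qed.

Lemma size_T q : uniq q -> T =i q -> size q = (4 * #|` TT|)%N.
Proof.
move=> uq Tq; pose E := [seq s : Gsharp G <- q | s.2 == 0].
have EP s : (s \in E) = (s.2 == 0) && (s \in T) by rewrite mem_filter Tq.
have Z11 : (1 + 1 : 'Z_2) = 0 by apply/val_inj.
have uE : uniq E by rewrite filter_uniq.
rewrite (@size_double _ E q (u, 1)) //.
- rewrite -(size_map fst E) (@size_double _ [seq repr z | z <- TT] _ t0).
  + by rewrite size_map mulnA.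
  + by rewrite map_inj_uniq ?fset_uniq //; apply: can_inj reprK.
  + rewrite map_inj_in_uniq // => s t; rewrite !EP => /andP[/eqP s2 _] /andP[/eqP t2 _].
    by move=> E1; rewrite (Gsharp_eta s2) (Gsharp_eta t2) E1.
  + move=> _ /mapP[z zT ->]; apply/mapP => -[w wT E1].
    have zw : z = w.
      rewrite -[z]reprK -[w]reprK; apply/eqP.
      rewrite -[(_ == _)]/(bar t0 (repr z) == bar t0 (repr w)) -E1 bar_eq.
      by rewrite opprD addrA subrr sub0r rpredN cycP ?eqxx ?orbT //; case: t0o.
    move: E1; rewrite zw -[RHS]addr0 => /addrI t00.
    by case: t0o.
  move=> g; have gE (h : G) : (h \in [seq s.1 | s <- E]) = (sh h \in T).
    apply/mapP/idP => [[s]|hT]; last by exists (sh h); rewrite ?EP.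
    by rewrite EP => /andP[/eqP s2 sT] ->; rewrite -(Gsharp_eta s2).
  have rE (z : Gbar t0) : z \in TT -> sh (repr z) \in T.
    by move=> zT; rewrite -TTE TplusE /bar reprK.
  rewrite gE; apply/idP/orP => [gT|[/mapP[z zT ->]|/mapP[z zT E1]]]; last 2 first.
  + exact: rE.
  + by rewrite -[g](subrK t0) E1 shD (subgroupD TG) // rE.
  have bT : bar t0 g \in TT by rewrite -TplusE TTE.
  case: (repr_bar g) => gr; [left | right]; apply/mapP; exists (bar t0 g) => //.
  by rewrite gr; apply/eqP; rewrite subr_eq -addrA -mulr2n; case: t0o => _ ->; rewrite addr0.
- by move=> s; rewrite !EP => /andP[/eqP s2 _]; rewrite /= s2 add0r.
move=> s; rewrite -Tq !EP; case: (Z2P s.2) => s2; rewrite /= s2 /=.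
  by rewrite orbF.
apply/idP/idP => [sT|suT]; first exact: TG.2.
by rewrite -[s](subrK ((u, 1) : Gsharp G)) (subgroupD TG).
Qed.

Lemma valid_P : valid chi P n.
Proof.
have [_ t02] := t0o.
have uuT : sh (u *+ 2) \in T.
  have E : sh (u *+ 2) = (u, 1) + (u, 1) by rewrite /sh; congr (_, _); apply/val_inj.
  by rewrite E (subgroupD TG).
have uuE : sh (u *+ 2) = (u, 1) + (u, 1) by rewrite /sh; congr (_, _); apply/val_inj.
split=> //; first exact: betabar_nd.
  (* With t1 = (u, 1) in T: b(t1, 2 t1) = 1 by alternation, and b(2 t1, t) = chi(t)^2. *)
  exists (u *+ 2) => //; split; first by rewrite TTE.
    by rewrite -[LHS]bu // uuE (bicharDr bB) // alt // mulr1.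
  move=> t; rewrite TTE => tT; rewrite [RHS]betabarE // uuE (bicharDl bB) //.
  by rewrite expr2 -!bu.
have [s [pr gG]] := super_gproj charF DelG.
have [q uq Tq] := fr_T_finite (m := m) gG fr.
(* The formula reads 4 k^2 |Tbar| = (2 (n + 1))^2, so k divides n + 1 and the quotient is the square
   root of |Tbar|. *)
have := fr_dim (m := m) charF gG mulG fr uq Tq.
rewrite (size_T uq Tq) => E.
have {}E : (k ^ 2 * #|` TT| = n.+1 ^ 2)%N.
  apply/eqP; rewrite -(eqn_pmul2l (m := 4)) // mulnCA E; apply/eqP.
  have -> : (n + n.+1).+1 = (2 * n.+1)%N by rewrite mul2n -addnn addSn.
  by rewrite expnMn.
have kn : (k %| n.+1)%N.
  by rewrite -(@dvdn_pexp2r _ _ 2) // -E dvdn_mulr.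
exists (n.+1 %/ k)%N; last by rewrite /= mulnC divnK.
have k0 : (0 < k)%N := fr_k_gt0 (m := m) fr.
apply/eqP; rewrite -(eqn_pmul2l (m := k ^ 2)) ?expn_gt0 ?k0 // E -expnMn.
by rewrite mulnC divnK.
Qed.
End WithT0.

Lemma Gamma_of_odd : exists2 P : params F G, valid chi P n & is_Gamma chi P Del.
Proof.
have [t0 [t0o t0T bt0]] := parity_elt.
have [TT TTE TTG] := exists_Tbar t0o t0T.
have [u uT bu] := exists_u t0o t0T bt0 TTE TTG.
(* An odd gam_i becomes even by adding [tau], which leaves its coset modulo T unchanged. *)
pose g i := (if (gam i).2 == 0 then gam i else gam i + tau).1.
pose gamma := [tuple g i | i < k].
pose P := Params TT (betabar (t0 := t0)) u gamma.
exists P; first exact: valid_P.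
apply: (Gamma_of_frame charF (b := b)) => //.
  exact: is_beta_u_P.
apply: (frame_reindex (m := m) (p := id) mulG fr) => //; first by exists id.
  move=> i; rewrite /= tnth_mktuple /g.
  case: (Z2P (gam i).2) => gi; rewrite gi /=.
    by rewrite -(Gsharp_eta gi) subrr; case: TG.
  have g2 : (gam i + tau).2 = 0 by rewrite /= gi tau1; apply/val_inj.
  have -> : sh ((gam i).1 + tau.1) = gam i + tau by rewrite [RHS](Gsharp_eta g2).
  by rewrite addrC addKr.
exact: Tu_T.
Qed.
End OddSupport.

Theorem corollary5p9 (F : closedFieldType) (charF : [pchar F] =i pred0)
    (G : zmodType) (n : nat) (n_gt0 : (1 <= n)%N)
    (chi : char_choice F G) (chi_ok : char_choice_ok chi) :
  (forall Gam : G -> {vspace A_ F n}, odd_typeI Gam ->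
     exists2 P : params F G, valid chi P n
       & exists2 Gam' : G -> {vspace A_ F n},
           is_Gamma_A chi P Gam' & iso_gradings Gam Gam')
  /\
  (forall P P' : params F G, valid chi P n -> valid chi P' n ->
     forall Gam Gam' : G -> {vspace A_ F n},
       is_Gamma_A chi P Gam -> is_Gamma_A chi P' Gam' ->
       (iso_gradings Gam Gam' <-> equiv_params P P')).
Proof.
split=> [Gam [[Del DelG /funext->] nev]|P P' Pv P'v Gam Gam'].
  have [s [pr gG]] := super_gproj charF DelG.
  have [k [gam [T [b [fr]]]]] :=
    frame_exists (m := (n + n.+1)%N) charF gG (super_mul charF DelG).
  have [[tau tauT tau1]|T_even] := pselect (exists2 tau, tau \in T & tau.2 = 1).
    have [P Pv PDel] := Gamma_of_odd charF chi_ok DelG fr tauT tau1.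
    exists P => //; exists (induced Del); first by exists Del.
    (* The grading on M is itself a Gamma, so the identity is the isomorphism. *)
    exists \1%VF; last by move=> g; rewrite lim1g.
    split=> [|p|x y]; last by rewrite !id_lfunE.
      by apply/eqP/lker0P => x y; rewrite !id_lfunE.
    exact: lim1g.
  case: nev; apply: (even_of_frame charF DelG fr) => t tT.
  by case: (Z2P t.2) => // t1; case: T_even; exists t.
move=> [Del DelP /funext->] [Del' DelP' /funext->]; split.
  exact: (iso_equiv charF n_gt0 chi_ok Pv P'v DelP DelP').
exact: (equiv_iso charF Pv P'v DelP DelP').
Qed.
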